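(* If $F:\mathcal K\to L^2(\Omega)$ is Lipschitz and sticking, then every Lagrangian solution $X$ with initial data $\bar X\in\mathcal K$ and $\bar V\in\mathcal H_{\bar X}$ is sticky, i.e. $\Omega_{X(t_1)}\subset\Omega_{X(t_2)}$ for all $0\le t_1\le t_2$.
   Context: $\Omega=(0,1)$. $\mathcal K\subset L^2(\Omega)$ is the closed convex cone of nondecreasing functions (right-continuous representatives). For $X\in\mathcal K$: $\Omega_X$ is the set of $m\in\Omega$ such that $X$ is constant in a neighborhood of $m$; $\mathcal H_X:=\{U\in L^2(\Omega):U\text{ is (a.e.) constant in each interval }(\alpha,\beta)\subset\Omega_X\}$; $\partial I_{\mathcal K}(X)=\{W\in L^2(\Omega):\int_\Omega W(\tilde X-X)\,dm\le0\ \forall\tilde X\in\mathcal K\}$. $\mathsf P_{\mathcal H_X}$ is the $L^2(\Omega)$-orthogonal projection onto $\mathcal H_X$. $F$ is Lipschitz if $\|F[X_1]-F[X_2]\|_{L^2(\Omega)}\le L\|X_1-X_2\|_{L^2(\Omega)}$ for all $X_1,X_2\in\mathcal K$ and some $L\ge0$. $F$ is sticking if for all $X,Y\in\mathcal K$ with $Y\in\mathcal H_X$ one has $F[X]-\mathsf P_{\mathcal H_X}(F[X])\in\partial I_{\mathcal K}(Y)$. A Lagrangian solution with initial data $(\bar X,\bar V)\in\mathcal K\times L^2(\Omega)$ is a curve $X\in\mathrm{Lip}_{\rm loc}([0,\infty);\mathcal K)$ with $X(0)=\bar X$ and $\dot X(t)+\partial I_{\mathcal K}(X(t))\ni\bar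 V+\int_0^tF[X(s)]\,ds$ for a.e. $t>0$. *)

(* Defs.v *)
From HB Require Import structures.
From mathcomp Require Import all_boot all_order all_algebra.
From mathcomp Require Import all_classical all_reals all_analysis.

Set Implicit Arguments.
Unset Strict Implicit.
Unset Printing Implicit Defensive.

Import Order.TTheory GRing.Theory Num.Theory.
Import numFieldNormedType.Exports.

Local Open Scope classical_set_scope.
Local Open Scope ring_scope.

Definition Omega (R : realType) : set R := `]0, 1[%classic.

Definition muOmega (R : realType) :
    {measure set (measurableTypeR R) -> \bar R} :=
  mrestr (@lebesgue_measure R) (measurable_itv `]0, 1[).

(* Elements of L^2(Omega) are represented by functions on the whole line; their
   values outside Omega are irrelevant, since the measure is carried by Omega.
   Equality in L^2(Omega) is equality muOmega-almost everywhere, not Leibniz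
   equality: the quotient LspaceType of the library has no vector-space
   structure. *)
Definition L2 (R : realType) := LfunType (@muOmega R) (lee1n 2).

Definition L2norm (R : realType) (f : L2 R) : R :=
  fine ('N[@muOmega R]_2%:E [EFin \o (f : R -> R)])%E.

Definition L2dot (R : realType) (f g : L2 R) : R :=
  (\int[@muOmega R]_x (f x * g x))%R.

(* A class of L^2(Omega) containing a nondecreasing function is represented by
   its right-continuous version, which is unique on Omega. *)
Definition K (R : realType) : set (L2 R) :=
  [set X | {in `]0, 1[ &, nondecreasing_fun (X : R -> R)} /\
           (forall m, Omega m -> X x @[x --> m^'+] --> X m)].

Definition OmegaX (R : realType) (X : L2 R) : set R :=
  [set m | Omega m /\ \forall x \near m, X x = X m].

Definition HX (R : realType) (X : L2 R) : set (L2 R) :=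
  [set U | forall a b : R, `]a, b[%classic `<=` OmegaX X ->
     exists c : R,
       {ae @lebesgue_measure R, forall x, x \in `]a, b[ -> U x = c}].

Definition subdiffK (R : realType) (X : L2 R) : set (L2 R) :=
  [set W | forall X' : L2 R, @K R X' -> L2dot W (X' - X) <= 0].

Definition is_orthogonal_projection (R : realType) (S : set (L2 R))
    (U P : L2 R) : Prop :=
  S P /\ forall Z, S Z -> L2dot (U - P) Z = 0.

(* The projection is determined only up to almost everywhere equality; some
   representative is chosen. *)
Definition orthogonal_projection (R : realType) (S : set (L2 R))
    (U : L2 R) : L2 R :=
  xget 0 (is_orthogonal_projection S U).

(* Forces F : K -> L^2(Omega) are given as total functions on representatives;
   only their values on K are constrained. The Lipschitz bound makes F
   compatible with almost everywhere equality on K. *)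
Definition force_lipschitz (R : realType) (F : L2 R -> L2 R) : Prop :=
  exists2 L : R, 0 <= L &
    forall X1 X2, @K R X1 -> @K R X2 ->
      L2norm (F X1 - F X2) <= L * L2norm (X1 - X2).

Definition force_sticking (R : realType) (F : L2 R -> L2 R) : Prop :=
  forall X Y, @K R X -> @K R Y -> HX X Y ->
    subdiffK Y (F X - orthogonal_projection (HX X) (F X)).

(* A list of pairs (A, u) stands for the simple function sum of the 1_A *: u. *)
Definition L2simple (R : realType) (s : seq (set R * L2 R)) (r : R) : L2 R :=
  \sum_(p <- s) (\1_(p.1) r : R) *: p.2.

Definition L2simple_integral (R : realType) (s : seq (set R * L2 R)) : L2 R :=
  \sum_(p <- s) fine (@lebesgue_measure R p.1) *: p.2.

(* Bochner integral with values in L^2(Omega), for the Lebesgue measure on D *)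
Definition is_bochner_integral (R : realType) (D : set R) (f : R -> L2 R)
    (I : L2 R) : Prop :=
  exists s_ : nat -> seq (set R * L2 R),
  [/\ forall n p, p \in s_ n ->
        [/\ measurable (p.1 : set (measurableTypeR R)), p.1 `<=` D &
            (@lebesgue_measure R p.1 < +oo)%E],
      {ae @lebesgue_measure R, forall r, D r ->
        L2norm (f r - L2simple (s_ n) r) @[n --> \oo] --> (0 : R)},
      (\int[@lebesgue_measure R]_(r in D)
          (L2norm (f r - L2simple (s_ n) r))%:E)%E @[n --> \oo] --> 0%E &
      L2norm (L2simple_integral (s_ n) - I) @[n --> \oo] --> (0 : R)].

Definition bochner_integral (R : realType) (D : set R) (f : R -> L2 R) : L2 R :=
  xget 0 (is_bochner_integral D f).

Definition is_L2derivative (R : realType) (X : R -> L2 R) (t : R)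
    (V : L2 R) : Prop :=
  L2norm (h^-1 *: (X (t + h) - X t) - V) @[h --> (0 : R)^'] --> (0 : R).

Definition loc_lipschitz_curve (R : realType) (X : R -> L2 R) : Prop :=
  forall T : R, 0 <= T -> exists L : R,
    forall s t : R, 0 <= s <= T -> 0 <= t <= T ->
      L2norm (X s - X t) <= L * `|s - t|.

(* Curves on [0, +oo[ are total functions whose values at negative times are
   unconstrained. *)
Definition lagrangian_solution (R : realType) (F : L2 R -> L2 R)
    (Xbar Vbar : L2 R) (X : R -> L2 R) : Prop :=
  [/\ forall t : R, 0 <= t -> @K R (X t),
      loc_lipschitz_curve X,
      (X 0 : R -> R) = (Xbar : R -> R) %[ae @muOmega R] &
      {ae @lebesgue_measure R, forall t : R, 0 < t ->
        exists2 V : L2 R, is_L2derivative X t V &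
          subdiffK (X t)
            (Vbar + bochner_integral `[0, t]%classic (F \o X) - V)}].

Definition sticky (R : realType) (X : R -> L2 R) : Prop :=
  forall t1 t2 : R, 0 <= t1 -> t1 <= t2 -> OmegaX (X t1) `<=` OmegaX (X t2).

(* Main.v *)
Require Import Defs.
From mathcomp Require Import all_boot all_order all_algebra.
From mathcomp Require Import all_classical all_reals all_analysis.
From mathcomp Require Import ring lra measurable_realfun.

Set Implicit Arguments.
Unset Strict Implicit.
Unset Printing Implicit Defensive.

Import Order.TTheory GRing.Theory Num.Theory.
Import numFieldNormedType.Exports.

Local Open Scope classical_set_scope.
Local Open Scope ring_scope.

(** Consider the implicit scheme Z_(n+1) = P_K (Z_n + tau w_n),
    w_(n+1) = w_n + tau F[Z_(n+1)]. Suppose that on every maximal interval where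
    Z_n is constant, w_n is nonpositively correlated with the fluctuation (the
    deviation from the mean) of every nondecreasing function. By Chebyshev's
    correlation inequality the projection then cannot split the interval, and the
    sticking property of F preserves the condition on w; so flat intervals persist
    along the scheme. By a discrete Gronwall argument the scheme started from X(t1)
    and W(t1) = Vbar + int_0^t1 F[X] converges to X, and flatness of a fixed
    interval is closed in L2.

    It remains to know the condition for W(t1) at X(t1). It holds at time 0 because
    Vbar is in H_Xbar. The residuals of the scheme lie in normal cones to K, which
    grow with the flat set; summing them and passing to the limit puts
    X(s) - X(t) + int_s^t W in the normal cone at X(t). Testing this with
    fluctuations over a component of X(t), dividing by t - s and letting s tend to t
    gives the condition at time t. *)

(** * Hilbert space tools in L2 *)

(** Flat sets are not continuous under L2 limits: a limit may be flat where its approximants are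
    not. The scheme run from time 0 therefore need not see the flat set of [X t1], and it is
    restarted at [t1]. The condition required there on the impulse is extracted from the scheme run
    from time 0, through a property that does survive the limit: being polar to [K] and annihilating
    the steps that jump outside the flat set. It survives because a point outside the flat set of
    the limit is approached by points outside the flat sets of the approximants.

    The differential inclusion holds only at almost every time, with an unknown velocity. It is used
    solely through the squared distance of [X] to a fixed element of [K], a real Lipschitz function
    of time. The resulting evolution inequality has an exact counterpart for the projections of the
    scheme, and comparing the two gives the error estimate.

    Flatness and [K] are pointwise notions while L2 information holds almost everywhere; right
    continuity converts between them. *)

Lemma ae_imp d (T : ringOfSetsType d) (R : realFieldType)
    (m : {measure set T -> \bar R}) (P Q : T -> Prop) :
  (forall x, P x -> Q x) -> {ae m, forall x, P x} -> {ae m, forall x, Q x}.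
Proof. by move=> PQ; apply: filterS. Qed.

Lemma ae_imp2 d (T : ringOfSetsType d) (R : realFieldType)
    (m : {measure set T -> \bar R}) (P P' Q : T -> Prop) :
  (forall x, P x -> P' x -> Q x) ->
  {ae m, forall x, P x} -> {ae m, forall x, P' x} -> {ae m, forall x, Q x}.
Proof. by move=> PQ; apply: filterS2. Qed.

Section L2_basics.
Context (R : realType).
Local Notation mu := (@muOmega R).
Implicit Types (f g U V W : L2 R).

Lemma muOmegaE (A : set R) : mu A = lebesgue_measure (A `&` `]0, 1[).
Proof. by []. Qed.

Lemma muOmega_setT : mu setT = 1%E.
Proof. by rewrite muOmegaE setTI lebesgue_measure_itv/= lte_fin ltr01 oppr0 adde0. Qed.

Lemma L2_measurable U : measurable_fun setT (U : R -> R).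
Proof. by move: (LfunP U); rewrite inE => /andP[/[!inE]]. Qed.

Lemma L2_integrableM U V : mu.-integrable setT (EFin \o (fun x => U x * V x)).
Proof. exact/Lfun1_integrable/Lfun2_mul_Lfun1/LfunP/LfunP. Qed.

Lemma L2dotC U V : L2dot U V = L2dot V U.
Proof. by apply: eq_Rintegral => x _; rewrite mulrC. Qed.

Lemma L2dotDl U V W : L2dot (U + V) W = L2dot U W + L2dot V W.
Proof.
rewrite /L2dot -RintegralD//; [|exact: L2_integrableM..].
by apply: eq_Rintegral => x _; rewrite -mulrDl.
Qed.

Lemma L2dotZl a U W : L2dot (a *: U) W = a * L2dot U W.
Proof.
rewrite /L2dot -RintegralZl//; last exact: L2_integrableM.
by apply: eq_Rintegral => x _; rewrite mulrA.
Qed.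

Lemma L2dotNl U W : L2dot (- U) W = - L2dot U W.
Proof. by rewrite -scaleN1r L2dotZl mulN1r. Qed.

Lemma L2dotBl U V W : L2dot (U - V) W = L2dot U W - L2dot V W.
Proof. by rewrite L2dotDl L2dotNl. Qed.

Lemma L2dotDr U V W : L2dot W (U + V) = L2dot W U + L2dot W V.
Proof. by rewrite L2dotC L2dotDl !(L2dotC W). Qed.

Lemma L2dotZr a U W : L2dot W (a *: U) = a * L2dot W U.
Proof. by rewrite L2dotC L2dotZl !(L2dotC W). Qed.

Lemma L2dotNr U W : L2dot W (- U) = - L2dot W U.
Proof. by rewrite L2dotC L2dotNl !(L2dotC W). Qed.

Lemma L2dotBr U V W : L2dot W (U - V) = L2dot W U - L2dot W V.
Proof. by rewrite L2dotDr L2dotNr. Qed.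

Lemma L2dot0r U : L2dot U 0 = 0.
Proof. by rewrite -(scale0r 0) L2dotZr mul0r. Qed.

Lemma L2dot0l U : L2dot 0 U = 0.
Proof. by rewrite L2dotC L2dot0r. Qed.

Definition L2dotE := (L2dotDl, L2dotDr, L2dotNl, L2dotNr, L2dotZl, L2dotZr).

Lemma L2dot_ge0 U : 0 <= L2dot U U.
Proof. by apply: Rintegral_ge0 => x _; rewrite -expr2 sqr_ge0. Qed.

Lemma L2norm_ge0 U : 0 <= L2norm U.
Proof. by rewrite /L2norm fine_ge0// Lnorm_ge0. Qed.

Lemma L2norm_sqr U : L2norm U ^+ 2 = L2dot U U.
Proof.
apply: EFin_inj.
have -> : (L2norm U ^+ 2)%:E = ('N[mu]_2%:E[EFin \o U] `^ 2)%E.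
  by rewrite -[in RHS](finite_norm_fine U) poweR_EFin powR_mulrn// L2norm_ge0.
rewrite powR_Lnorm// /L2dot /Rintegral fineK//; last first.
  by apply: integrable_fin_num => //; exact: L2_integrableM.
apply: eq_integral => x _ /=.
rewrite powR_mulrn ?normr_ge0// real_normK ?num_real// expr2.
Qed.

Lemma L2norm_sqrt U : L2norm U = Num.sqrt (L2dot U U).
Proof. by rewrite -L2norm_sqr sqrtr_sqr ger0_norm// L2norm_ge0. Qed.

Lemma L2norm_dot_le U V : L2dot U U <= L2dot V V -> L2norm U <= L2norm V.
Proof. by move=> h; rewrite !L2norm_sqrt; apply: ler_wsqrtr. Qed.

Lemma L2_cauchy_schwarz U V : L2dot U V <= L2norm U * L2norm V.
Proof.
have q (f g : L2 R) s : 0 <= L2dot f f - 2 * s * L2dot f g + s ^+ 2 * L2dot g g.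
  have := L2dot_ge0 (f - s *: g); rewrite !L2dotE (L2dotC g f) => /le_trans; apply.
  by rewrite le_eqVlt; apply/orP; left; apply/eqP; ring.
have z (f g : L2 R) : L2norm g = 0 -> L2dot f g <= 0.
  move=> g0; have [//|fg0] := leP (L2dot f g) 0.
  (* With [L2norm g = 0] the quadratic is affine in [s], and this [s] gives it the value -1. *)
  have := q f g ((L2dot f f + 1) / (2 * L2dot f g)).
  rewrite -(L2norm_sqr g) g0.
  have fg : L2dot f g != 0 by rewrite gt_eqF.
  rewrite (_ : _ + _ = -1) ?oppr_ge0 ?ler10//; by field.
have [v0|v0] := eqVneq (L2norm V) 0; first by rewrite v0 mulr0 z.
have [u0|u0] := eqVneq (L2norm U) 0; first by rewrite u0 mul0r L2dotC z.
have up : 0 < L2norm U by rewrite lt_neqAle eq_sym u0 L2norm_ge0.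
have vp : 0 < L2norm V by rewrite lt_neqAle eq_sym v0 L2norm_ge0.
(* For this choice the quadratic factors as [2 * u * v * (u * v - d)]. *)
have := q (L2norm V *: U) V (L2norm U).
rewrite !L2dotZl !L2dotZr -!L2norm_sqr.
move: (L2norm U) (L2norm V) (L2dot U V) up vp => u v d up vp H.
have : 0 <= (2 * u * v) * (u * v - d) by rewrite (le_trans H)// le_eqVlt; apply/orP; left; apply/eqP; ring.
by rewrite pmulr_rge0 ?subr_ge0// !mulr_gt0.
Qed.

Lemma L2_cauchy_schwarz_norm U V : `|L2dot U V| <= L2norm U * L2norm V.
Proof.
rewrite ler_norml L2_cauchy_schwarz andbT lerNl -L2dotNl.
have -> : L2norm U = L2norm (- U) by rewrite !L2norm_sqrt !L2dotE opprK.
exact: L2_cauchy_schwarz.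
Qed.

Lemma L2normZ a U : L2norm (a *: U) = `|a| * L2norm U.
Proof.
by rewrite !L2norm_sqrt !L2dotE mulrA -expr2 sqrtrM ?sqr_ge0// sqrtr_sqr.
Qed.

Lemma L2normN U : L2norm (- U) = L2norm U.
Proof. by rewrite -scaleN1r L2normZ normrN1 mul1r. Qed.

Lemma L2norm0 : L2norm (0 : L2 R) = 0.
Proof. by rewrite -(scale0r 0) L2normZ normr0 mul0r. Qed.

Lemma L2normD U V : L2norm (U + V) <= L2norm U + L2norm V.
Proof.
rewrite -ler_sqr ?nnegrE ?addr_ge0 ?L2norm_ge0// L2norm_sqr !L2dotE -!L2norm_sqr.
rewrite (L2dotC V U) sqrrD; have := L2_cauchy_schwarz U V; lra.
Qed.

Lemma L2normB U V : L2norm (U - V) = L2norm (V - U).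
Proof. by rewrite -L2normN opprB. Qed.

Lemma L2norm_triangle W U V : L2norm (U - V) <= L2norm (U - W) + L2norm (W - V).
Proof. by rewrite (le_trans _ (L2normD _ _))// subrKA. Qed.

Lemma L2_apply0 x : (0 : L2 R) x = 0. Proof. by []. Qed.
Lemma L2_applyD U V x : (U + V) x = U x + V x. Proof. by []. Qed.
Lemma L2_applyN U x : (- U) x = - U x. Proof. by []. Qed.
Lemma L2_applyB U V x : (U - V) x = U x - V x. Proof. by []. Qed.
Lemma L2_applyZ a U x : (a *: U) x = a * U x. Proof. by []. Qed.

Definition L2_applyE := (L2_applyD, L2_applyN, L2_applyZ).

Lemma L2_intro (f : R -> R) : measurable_fun setT f ->
  (\int[mu]_x ((f x) ^+ 2)%:E < +oo)%E -> f \in Lfun mu 2%:E.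
Proof.
move=> mf fi; apply/andP; split; rewrite inE//= /finite_norm unlock poweR_lty//.
apply: le_lt_trans fi; rewrite le_eqVlt; apply/orP; left; apply/eqP.
apply: eq_integral => x _ /=.
by rewrite powR_mulrn ?normr_ge0// real_normK ?num_real.
Qed.

Definition toL2 (f : R -> R) (h : f \in Lfun mu 2%:E) : L2 R :=
  Lfun_Sub (lee1n 2) h.

Lemma L2_dominated (f : R -> R) U : measurable_fun setT f ->
  (forall x, `|f x| <= `|U x|) -> f \in Lfun mu 2%:E.
Proof.
move=> mf fU; apply: L2_intro => //.
have /integrableP[_] := L2_integrableM U U; apply: le_lt_trans.
apply: ge0_le_integral => //.
- by move=> x _; rewrite lee_fin sqr_ge0.
- by apply/measurable_EFinP; exact: measurable_funX.
- apply: measurableT_comp => //; apply/measurable_EFinP.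
  by apply: measurable_funM; exact: L2_measurable.
- move=> x _ /=; rewrite lee_fin -expr2 normrX -[leLHS]real_normK ?num_real//.
  by rewrite ler_sqr ?nnegrE.
Qed.

Lemma L2_bounded (f : R -> R) (M : R) : measurable_fun setT f ->
  (forall x, `|f x| <= M) -> f \in Lfun mu 2%:E.
Proof.
move=> mf fM; apply: L2_intro => //.
apply: (@le_lt_trans _ _ (\int[mu]_x (cst (M ^+ 2)%:E x))%E).
  apply: ge0_le_integral => //.
  - by move=> x _; rewrite lee_fin sqr_ge0.
  - by apply/measurable_EFinP; exact: measurable_funX.
  - move=> x _ /=; rewrite lee_fin -[leLHS]real_normK ?num_real//.
    by rewrite ler_sqr ?nnegrE// (le_trans _ (fM x)).
by rewrite integral_cst// [X in (_ * X)%E]muOmega_setT mule1 ltry.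
Qed.

Lemma L2_ae_eq U V : L2norm (U - V) = 0 <-> (U : R -> R) = V %[ae mu].
Proof.
split=> [/fine_Lnormr_eq0|UV].
  apply: ae_imp => x /= /(_ Logic.I) h _.
  by apply/eqP; rewrite -subr_eq0; apply/eqP.
rewrite L2norm_sqrt /L2dot /Rintegral.
rewrite (ae_eq_integral (cst 0)%E)//; first by rewrite integral0/= sqrtr0.
  by apply/measurable_EFinP/measurable_funM; exact: L2_measurable.
by apply: ae_imp UV => x /= h _; rewrite -[_ x]/(U x - V x) h// subrr mul0r.
Qed.

Lemma L2dot_aeq U V W : L2norm (U - V) = 0 -> L2dot U W = L2dot V W.
Proof.
move=> h; apply/eqP; rewrite -subr_eq0 -L2dotBl -normr_le0.
by rewrite (le_trans (L2_cauchy_schwarz_norm _ _))// h mul0r.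
Qed.

End L2_basics.

(** * Completeness of L2 *)

Section L2_complete.
Context (R : realType).
Local Notation mu := (@muOmega R).
Implicit Types (U V W : L2 R).

Lemma Lfun_abs U : (fun x => `|U x|) \in Lfun mu 2%:E.
Proof.
apply: (@L2_dominated _ _ U) => [|x]; last by rewrite normr_id.
by apply: measurableT_comp => //; exact: L2_measurable.
Qed.

Lemma Lfun_one : (fun=> 1 : R) \in Lfun mu 2%:E.
Proof. by apply: (@L2_bounded _ _ 1) => // x; rewrite normr1. Qed.

Definition L2one : L2 R := toL2 Lfun_one.

Lemma L2oneE x : L2one x = 1. Proof. by []. Qed.

Lemma L2norm_one : L2norm L2one = 1.
Proof.
rewrite L2norm_sqrt /L2dot /Rintegral.
under eq_integral do rewrite L2oneE mulr1.
by rewrite integral_cst// mul1e [mu _]muOmega_setT sqrtr1.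
Qed.

Lemma L2norm_L1 U : (\int[mu]_x (`|U x|)%:E <= (L2norm U)%:E)%E.
Proof.
have <- : L2norm (toL2 (Lfun_abs U)) = L2norm U.
  rewrite !L2norm_sqrt; congr Num.sqrt; apply: eq_Rintegral => x _.
  by rewrite -[_ * _]/(`|U x| * `|U x|) -!expr2 real_normK ?num_real.
have := L2_cauchy_schwarz (toL2 (Lfun_abs U)) L2one; rewrite L2norm_one mulr1.
rewrite -lee_fin; apply: le_trans; rewrite /L2dot /Rintegral fineK//.
  by rewrite le_eqVlt; apply/orP; left; apply/eqP; apply: eq_integral => x _; rewrite L2oneE mulr1.
by apply: integrable_fin_num => //; exact: L2_integrableM.
Qed.

Lemma L2norm_sqrE U : (\int[mu]_x (U x ^+ 2)%:E = (L2norm U ^+ 2)%:E)%E.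
Proof.
rewrite L2norm_sqr /L2dot /Rintegral fineK; first by apply: eq_integral => x _; rewrite expr2.
by apply: integrable_fin_num => //; exact: L2_integrableM.
Qed.

Lemma L2_fast_tail (v : nat -> L2 R) n k :
  (forall k, L2norm (v k.+1 - v k) <= 2^-1 ^+ k) ->
  L2norm (v n - v (k + n)%N) <= 2 * 2^-1 ^+ n.
Proof.
(* The bound is strengthened by the exact geometric remainder so that the induction closes. *)
move=> hv; suff : L2norm (v n - v (k + n)%N) <= 2 * 2^-1 ^+ n - 2 * 2^-1 ^+ (k + n).
  by move/le_trans; apply; rewrite gerBl mulr_ge0// exprn_ge0// invr_ge0.
elim: k => [|k IH]; first by rewrite add0n !subrr L2norm0.
apply: le_trans (L2norm_triangle (v (k + n)%N) _ _) _.
rewrite addSn; have := hv (k + n)%N; rewrite L2normB exprS.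
by move: IH; set a := 2^-1 ^+ (k + n); lra.
Qed.

(** Riesz-Fischer. On a space of mass one the L1 norm is at most the L2 norm, so the sum [G] of the
    absolute increments is integrable and the sequence converges almost everywhere; Fatou's lemma
    bounds the tails. The pointwise convergence is kept in the conclusion because monotonicity of a
    limit is read off from it. *)
Lemma L2_complete_fast (v : nat -> L2 R) :
  (forall k, L2norm (v k.+1 - v k) <= 2^-1 ^+ k) ->
  exists U, (forall n, L2norm (v n - U) <= 2 * 2^-1 ^+ n) /\
    {ae mu, forall x, v k x @[k --> \oo] --> U x}.
Proof.
move=> hv.
pose g n x : \bar R := (`|(v n.+1 - v n) x|)%:E.
have mg n : measurable_fun setT (g n).
  by apply/measurable_EFinP; apply: measurableT_comp => //; exact: L2_measurable.
have g0 n x : setT x -> (0 <= g n x)%E by move=> _; rewrite lee_fin.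
pose G x := (\sum_(n <oo) g n x)%E.
have mG : measurable_fun setT G.
  by apply: ge0_emeasurable_sum => // n x _ _; exact: g0.
have iG : mu.-integrable setT G.
  apply/integrableP; split=> //.
  rewrite (eq_integral G); last first.
    by move=> x _; rewrite gee0_abs//; apply: nneseries_ge0 => n _ _; exact: g0.
  rewrite integral_nneseries//.
  apply: (@le_lt_trans _ _ 2%:E); last exact: ltry.
  apply: lime_le; first by apply: is_cvg_nneseries => n _ _; apply: integral_ge0 => x _; exact: g0.
  apply: nearW => n.
  apply: (@le_trans _ _ (\sum_(0 <= i < n) (2^-1 ^+ i)%:E)%E).
    by apply: lee_sum => i _; apply: le_trans (L2norm_L1 _) _; rewrite lee_fin.
  rewrite sumEFin lee_fin.
  suff -> : \sum_(0 <= i < n) 2^-1 ^+ i = 2 - 2 * 2^-1 ^+ n :> R.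
    by rewrite gerBl mulr_ge0// exprn_ge0// invr_ge0.
  elim: n => [|n IHn]; first by rewrite big_geq// expr0 mulr1 subrr.
  by rewrite big_nat_recr//= IHn exprS; set a := 2^-1 ^+ n; lra.
pose E := [set x | G x \is a fin_num].
have mE : measurable E.
  by have := emeasurable_fin_num measurableT mG; rewrite setTI.
have vE x : E x -> cvgn (fun k => v k x).
  move=> Ex.
  have -> : (fun k => v k x) = (fun n => v 0%N x + series (fun n => v n.+1 x - v n x) n).
    apply/funext => n; rewrite /series/=.
    by rewrite telescope_sumr// addrC subrK.
  apply: is_cvgD; first exact: is_cvg_cst.
  apply: normed_cvg; apply: nondecreasing_is_cvgn.
    by apply/nondecreasing_seqP => n; rewrite [leRHS](@big_nat_recr _ _ _ n 0) //= lerDl.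
  exists (fine (G x)) => _ [n _ <-].
  rewrite -lee_fin fineK// /series/= -sumEFin.
  apply: (@le_trans _ _ (\sum_(0 <= i < n) g i x)%E); first by [].
  by apply: nneseries_lim_ge => k _ _; exact: g0.
(* Cutting off outside [E] makes the sequence converge at every point, so that its limit is
   measurable. *)
pose h k x := v k x * \1_E x.
have mh k : measurable_fun setT (h k).
  by apply: measurable_funM; [exact: L2_measurable|exact: measurable_indic].
pose U0 x := limn (h ^~ x).
have hU x : h ^~ x @ \oo --> U0 x.
  have [Ex|nEx] := pselect (E x).
    rewrite /U0 /h indicE mem_set//; under eq_fun do rewrite mulr1.
    exact: vE.
  rewrite /U0 /h indicE memNset//; under eq_fun do rewrite mulr0.
  exact: is_cvg_cst.
have mU : measurable_fun setT U0 by apply: (measurable_fun_cvg mh) => x _; exact: hU.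
have aeE : {ae mu, forall x, E x}.
  by apply: ae_imp (integrable_ae measurableT iG) => x /(_ Logic.I).
have bnd n : (\int[mu]_x ((v n x - U0 x) ^+ 2)%:E <= ((2 * 2^-1 ^+ n) ^+ 2)%:E)%E.
  rewrite (_ : (\int[mu]_x _)%E =
      (\int[mu]_x limn_einf (fun k => ((v n x - h (k + n)%N x) ^+ 2)%:E))%E); last first.
    apply: eq_integral => x _; apply/esym; apply: (cvg_limn_einf_sup _).1.
    apply/cvg_EFin; first exact: nearW.
    have c : (fun k => v n x - h (k + n)%N x) @ \oo --> v n x - U0 x.
      apply: cvgB; first exact: cvg_cst.
      by have := hU x; rewrite -(cvg_shiftn n).
    exact: (cvgM c c).
  apply: le_trans (fatou _ _ _ _) _ => //.
  - move=> k; apply/measurable_EFinP; apply: measurable_funX.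
    by apply: measurable_funB => //; exact: L2_measurable.
  - by move=> k x _; rewrite lee_fin sqr_ge0.
  have le k : (\int[mu]_x ((v n x - h (k + n)%N x) ^+ 2)%:E <= ((2 * 2^-1 ^+ n) ^+ 2)%:E)%E.
    have -> : (\int[mu]_x ((v n x - h (k + n)%N x) ^+ 2)%:E =
        \int[mu]_x (((v n - v (k + n)%N) x) ^+ 2)%:E)%E.
      apply: ae_eq_integral => //.
      - apply/measurable_EFinP; apply: measurable_funX.
        by apply: measurable_funB => //; exact: L2_measurable.
      - apply/measurable_EFinP; apply: measurable_funX; exact: L2_measurable.
      - by apply: ae_imp aeE => x Ex _; rewrite /h indicE mem_set// mulr1.
    rewrite L2norm_sqrE lee_fin ler_sqr ?nnegrE ?L2norm_ge0 ?mulr_ge0 ?exprn_ge0 ?invr_ge0//.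
    exact: L2_fast_tail.
  rewrite limn_einf_lim; apply: lime_le; first exact: is_cvg_einfs.
  apply: nearW => k; apply: le_trans (le k).
  by apply: ereal_inf_lbound; exists k => //=.
have dP : (fun x => v 0%N x - U0 x) \in Lfun mu 2%:E.
  apply: L2_intro; first by apply: measurable_funB => //; exact: L2_measurable.
  exact: le_lt_trans (bnd 0%N) (ltry _).
pose U := v 0%N - toL2 dP.
have UE x : U x = U0 x by rewrite /U L2_applyB/= opprB addrC subrK.
exists U; split => [n|].
  rewrite -ler_sqr ?nnegrE ?L2norm_ge0 ?mulr_ge0 ?exprn_ge0 ?invr_ge0//.
  rewrite -lee_fin -L2norm_sqrE; apply: le_trans (bnd n).
  by under eq_integral do rewrite L2_applyB UE.
apply: ae_imp aeE => x Ex; rewrite UE.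
have := hU x; rewrite /h indicE mem_set//.
by under eq_fun do rewrite mulr1.
Qed.

Lemma L2_complete (u : nat -> L2 R) :
  (forall e, 0 < e -> exists N, forall n m, (N <= n)%N -> (N <= m)%N ->
    L2norm (u n - u m) <= e) ->
  exists U, L2norm (u n - U) @[n --> \oo] --> (0 : R) /\
    exists phi : nat -> nat, {ae mu, forall x, u (phi k) x @[k --> \oo] --> U x}.
Proof.
move=> hu.
have half0 k : 0 < 2^-1 ^+ k :> R by rewrite exprn_gt0// invr_gt0.
pose N k := projT1 (cid (hu _ (half0 k))).
have NP k n m : (N k <= n)%N -> (N k <= m)%N -> L2norm (u n - u m) <= 2^-1 ^+ k.
  by move=> Nn Nm; rewrite /N in Nn Nm; case: cid Nn Nm => /= ? h; exact: h.
(* The maximum puts both [phi k] and [phi k.+1] beyond [N k]. *)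
pose phi k := (\max_(j < k.+1) N j)%N.
have Nphi k m : (k <= m)%N -> (N k <= phi m)%N.
  by move=> km; rewrite -ltnS in km; exact: (@leq_bigmax _ (fun j : 'I_m.+1 => N j) (Ordinal km)).
have [U [nU aeU]] := @L2_complete_fast (u \o phi) (fun k => NP k _ _ (Nphi k k.+1 (leqnSn k)) (Nphi k k (leqnn k))).
exists U; split; last by exists phi.
apply/cvgrPdist_le => e e0.
have : (fun n => 3 * 2^-1 ^+ n : R) @ \oo --> (0 : R).
  by apply: cvg_geometric; rewrite ger0_norm ?invr_ge0// invf_lt1// ltr1n.
move/cvgrPdist_le => /(_ e e0)[K _ HK]; exists (N K) => // n /= Kn.
rewrite sub0r normrN ger0_norm ?L2norm_ge0//.
apply: le_trans (L2norm_triangle (u (phi K)) _ _) _.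
have /= := HK K (leqnn K); rewrite sub0r normrN => /(le_trans (ler_norm _)); apply: le_trans.
by have /= := nU K; have /= := NP K n (phi K) Kn (Nphi _ _ (leqnn _)); set a := 2^-1 ^+ K; lra.
Qed.

End L2_complete.

(** * Projection onto closed convex sets *)

Section L2_projection.
Context (R : realType).
Implicit Types (U V W : L2 R).

Definition L2lim (u : nat -> L2 R) U :=
  forall e, 0 < e -> exists N, forall n, (N <= n)%N -> L2norm (u n - U) <= e.

Lemma L2limP (u : nat -> L2 R) U :
  L2lim u U <-> L2norm (u n - U) @[n --> \oo] --> (0 : R).
Proof.
split=> [h|/cvgrPdist_le h e e0].
  apply/cvgrPdist_le => e e0; have [N HN] := h e e0.
  by exists N => // n /= Nn; rewrite sub0r normrN ger0_norm ?L2norm_ge0// HN.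
have [N _ HN] := h e e0; exists N => n Nn.
by have := HN n Nn; rewrite /= sub0r normrN ger0_norm// L2norm_ge0.
Qed.

Lemma L2lim_cauchy (u : nat -> L2 R) U : L2lim u U ->
  forall e, 0 < e -> exists N, forall n m, (N <= n)%N -> (N <= m)%N ->
    L2norm (u n - u m) <= e.
Proof.
move=> h e e0; have e20 : 0 < e / 2 by rewrite divr_gt0.
have [N HN] := h _ e20; exists N => n m Nn Nm.
rewrite (le_trans (L2norm_triangle U _ _))// (splitr e) lerD ?HN//.
by rewrite L2normB HN.
Qed.

Lemma L2lim_uniq (u : nat -> L2 R) U V : L2lim u U -> L2lim u V ->
  L2norm (U - V) = 0.
Proof.
move=> hU hV; apply/eqP; rewrite eq_le L2norm_ge0 andbT.
apply/ler_addgt0Pl => e e0; rewrite addr0.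
have e20 : 0 < e / 2 by rewrite divr_gt0.
have [N HN] := hU _ e20; have [M HM] := hV _ e20.
rewrite (le_trans (L2norm_triangle (u (maxn N M)) _ _))// (splitr e) lerD//.
  by rewrite L2normB HN// leq_maxl.
by rewrite HM// leq_maxr.
Qed.

(** The limit is allowed to enter [C] after a change on a null set, since membership in [K] depends
    on the representative. *)
Definition L2closed (C : set (L2 R)) := forall u U,
  (forall n, C (u n)) -> L2lim u U -> exists V, C V /\ L2norm (U - V) = 0.

Lemma L2_parallelogram U V W :
  L2norm (V - W) ^+ 2 = 2 * L2norm (U - V) ^+ 2 + 2 * L2norm (U - W) ^+ 2
    - 4 * L2norm (U - 2^-1 *: (V + W)) ^+ 2.
Proof.
rewrite !L2norm_sqr !L2dotE (L2dotC V U) (L2dotC W U) (L2dotC W V).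
by field.
Qed.

(** A minimizing sequence for the distance is Cauchy by the parallelogram law applied to midpoints.
    Minimality of [P] along the segment from [P] to [Z] gives the variational inequality. *)
Lemma L2_projection (C : set (L2 R)) U : L2closed C -> C !=set0 ->
  (forall x y t, C x -> C y -> 0 <= t <= 1 -> C (x + t *: (y - x))) ->
  exists P, C P /\ forall Z, C Z -> L2dot (U - P) (Z - P) <= 0.
Proof.
move=> Ccl [c0 Cc0] Cconv.
pose A := [set L2norm (U - c) ^+ 2 | c in C].
have Alb : lbound A 0 by move=> _ [c _ <-]; rewrite sqr_ge0.
have iA : has_inf A by split; [exists (L2norm (U - c0) ^+ 2), c0|exists 0].
pose d := inf A.
have dle c : C c -> d <= L2norm (U - c) ^+ 2.
  by move=> Cc; apply: ge_inf; [exists 0|exists c].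
have ex n : exists c, C c /\ L2norm (U - c) ^+ 2 <= d + n.+1%:R^-1.
  have [|_ [c Cc <-] h] := @inf_adherent _ A n.+1%:R^-1 _ iA; first by rewrite invr_gt0.
  by exists c; split => //; exact: ltW.
pose u n := projT1 (cid (ex n)).
have Cu n : C (u n) by rewrite /u; case: cid => ? [].
have ud n : L2norm (U - u n) ^+ 2 <= d + n.+1%:R^-1 by rewrite /u; case: cid => ? [].
have midE n m : u n + 2^-1 *: (u m - u n) = 2^-1 *: (u n + u m).
  by apply/LfuneqP => x; rewrite !L2_applyE; field.
have dist n m : L2norm (u n - u m) ^+ 2 <= 2 * n.+1%:R^-1 + 2 * m.+1%:R^-1.
  have /dle : C (2^-1 *: (u n + u m)).
    by rewrite -midE; apply: Cconv => //; rewrite invr_ge0 ler0n invf_le1// ler1n.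
  have := ud n; have := ud m; rewrite (L2_parallelogram U (u n) (u m)).
  set i := n.+1%:R^-1; set j := m.+1%:R^-1; lra.
have [W [uW _]] : exists W, L2norm (u n - W) @[n --> \oo] --> (0 : R) /\
    exists phi : nat -> nat, {ae (@muOmega R), forall x, u (phi k) x @[k --> \oo] --> W x}.
  apply: L2_complete => e e0.
  have [N HN] : exists N : nat, 4 * N.+1%:R^-1 <= e ^+ 2.
    have /cvgrPdist_le /(_ (e ^+ 2 / 4))[] := @cvg_harmonic R; first by rewrite divr_gt0// exprn_gt0.
    move=> N _ /(_ N (leqnn N)); rewrite /= sub0r normrN => /(le_trans (ler_norm _)) h.
    by exists N; rewrite mulrC -ler_pdivlMr.
  exists N => n m Nn Nm.
  rewrite -ler_sqr ?nnegrE ?L2norm_ge0 ?(ltW e0)//.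
  have inv k : (N <= k)%N -> k.+1%:R^-1 <= N.+1%:R^-1 :> R.
    by move=> Nk; rewrite lef_pV2 ?posrE// ler_nat.
  have := dist n m; have := inv n Nn; have := inv m Nm; move: HN.
  set i := n.+1%:R^-1; set j := m.+1%:R^-1; set k := N.+1%:R^-1. lra.
have uW' : L2lim u W by apply/L2limP.
have [P [CP WP]] := Ccl u W Cu uW'.
have UP : L2norm (U - P) ^+ 2 <= d.
  apply/ler_addgt0Pr => e e0.
  have P0 : 0 <= L2norm (U - P) by exact: L2norm_ge0.
  have [h|h] := leP (L2norm (U - P) ^+ 2) e.
    by apply: (le_trans h); rewrite lerDr; apply: lb_le_inf => //; case: iA.
  have p0 : 0 < L2norm (U - P).
    by rewrite lt_neqAle P0 andbT; apply/eqP => p0; move: h; rewrite -p0 expr0n/= ltNge ltW.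
  (* With [p], [q], [r] the norms of [U - P], [U - u n], [u n - W], one has
     [p ^+ 2 <= q ^+ 2 + 2 * r * p]; this threshold for [r] makes the last term at most [e / 2]. *)
  have e'0 : 0 < e / (4 * L2norm (U - P)) by rewrite divr_gt0// mulr_gt0.
  have [N HN] := uW' _ e'0.
  have e''0 : 0 < e / 2 by rewrite divr_gt0.
  have /cvgrPdist_le /(_ (e / 2) e''0)[M _ HM] := @cvg_harmonic R.
  pose n := maxn N M.
  have hn := HN n (leq_maxl _ _).
  have := HM n (leq_maxr _ _); rewrite /= sub0r normrN => /(le_trans (ler_norm _)) hM.
  have tri : L2norm (U - P) <= L2norm (U - u n) + L2norm (u n - W).
    by rewrite (le_trans (L2norm_triangle (u n) _ _))// lerD2l (le_trans (L2norm_triangle W _ _))// WP addr0.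
  have := ud n.
  have q0 : 0 <= L2norm (U - u n) by exact: L2norm_ge0.
  move: tri hn hM h p0 P0 q0; set p := L2norm (U - P); set q := L2norm (U - u n).
  set r := L2norm _ => tri hn hM h p0 P0 q0 hq.
  have hr : r * (4 * p) <= e by rewrite -ler_pdivlMr ?mulr_gt0.
  have r0 : 0 <= r by exact: L2norm_ge0.
  have : p ^+ 2 <= q ^+ 2 + 2 * r * p.
    have [pr|pr] := leP p r; first by nra.
    have : (p - r) ^+ 2 <= q ^+ 2 by rewrite ler_sqr ?nnegrE//; lra.
    by rewrite !expr2; nra.
  move: hM hq; rewrite /harmonic; set i := n.+1%:R^-1; lra.
exists P; split => // Z CZ.
have key t : 0 < t -> t <= 1 -> 2 * L2dot (U - P) (Z - P) <= t * L2norm (Z - P) ^+ 2.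
  move=> t0 t1.
  have := dle _ (Cconv P Z t CP CZ _); rewrite (ltW t0) t1 => /(_ isT) h.
  have := le_trans UP h; rewrite opprD addrA.
  rewrite (_ : L2norm (U - P - t *: (Z - P)) ^+ 2 = L2norm (U - P) ^+ 2
     - 2 * t * L2dot (U - P) (Z - P) + t ^+ 2 * L2norm (Z - P) ^+ 2); last first.
    rewrite !L2norm_sqr; move: (U - P) (Z - P) => f g.
    by rewrite !L2dotE (L2dotC g f); ring.
  set a := L2dot _ _; set b := L2norm (Z - P) ^+ 2 => h1.
  have : t * (2 * a) <= t * (t * b) by move: h1; rewrite expr2; lra.
  by rewrite ler_pM2l.
rewrite leNgt; apply/negP => a0.
have b0 : 0 <= L2norm (Z - P) ^+ 2 by rewrite sqr_ge0.
move: key a0 b0; set a := L2dot _ _; set b := L2norm (Z - P) ^+ 2 => key a0 b0.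
have k1 := key 1 ltr01 (lexx _).
have b1 : 0 < b by lra.
(* At [t = a / b], which is at most 1 by the case [t = 1], the inequality reads [2 * a <= a]. *)
have := key (a / b); rewrite divr_gt0// ler_pdivrMr// mul1r => /(_ isT).
have ab : a <= b by lra.
by move=> /(_ ab); rewrite divfK ?gt_eqF//; lra.
Qed.

End L2_projection.

(** * Restrictions to intervals, indicators and steps *)

Section L2_intervals.
Context (R : realType).
Local Notation mu := (@muOmega R).
Implicit Types (U V W : L2 R) (i : interval R).

Lemma L2_subcE U c x : (U - c *: L2one R) x = U x - c.
Proof. by rewrite L2_applyD L2_applyN L2_applyZ L2oneE mulr1. Qed.

Lemma ae_Omega : {ae mu, forall x : R, 0 < x < 1}.
Proof.
exists (~` `]0, 1[%classic); split; first exact: measurableC.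
  by rewrite muOmegaE setICl measure0.
by apply: subsetC => x; rewrite /= in_itv.
Qed.

Lemma L2_eq_on U V : (forall x : R, 0 < x < 1 -> U x = V x) -> L2norm (U - V) = 0.
Proof. by move=> UV; apply/L2_ae_eq; apply: ae_imp ae_Omega => x /UV. Qed.

Lemma Lfun_res i U : (fun x => \1_[set` i] x * U x) \in Lfun mu 2%:E.
Proof.
apply: (@L2_dominated _ _ U) => [|x].
  by apply: measurable_funM; [exact: measurable_indic|exact: L2_measurable].
by rewrite normrM indicE; case: (_ \in _); rewrite ?normr1 ?normr0 ?mul1r ?mul0r.
Qed.

Definition L2res i U : L2 R := toL2 (Lfun_res i U).

Lemma L2resE i U x : L2res i U x = if x \in i then U x else 0.
Proof.
rewrite -[LHS]/(\1_[set` i] x * U x) indicE mem_setE.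
by case: ifP => _; rewrite ?mul1r ?mul0r.
Qed.

Lemma L2resB i U V : L2res i (U - V) = L2res i U - L2res i V.
Proof.
apply/LfuneqP => x; rewrite !(L2_applyE, L2resE).
by case: ifP; rewrite ?subr0.
Qed.

Lemma L2resD i U V : L2res i (U + V) = L2res i U + L2res i V.
Proof.
apply/LfuneqP => x; rewrite !(L2_applyE, L2resE).
by case: ifP; rewrite ?addr0.
Qed.

Lemma L2resZ i a U : L2res i (a *: U) = a *: L2res i U.
Proof.
by apply/LfuneqP => x; rewrite !(L2_applyE, L2resE); case: ifP; rewrite ?mulr0.
Qed.

Lemma L2dot_res i U V : L2dot (L2res i U) V = L2dot U (L2res i V).
Proof.
by apply: eq_Rintegral => x _; rewrite !L2resE; case: ifP; rewrite ?mul0r ?mulr0.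
Qed.

Lemma L2res_id i U : L2res i (L2res i U) = L2res i U.
Proof. by apply/LfuneqP => x; rewrite !L2resE; case: (_ \in _). Qed.

Lemma L2dot_le_on U V U' V' :
  (forall x : R, 0 < x < 1 -> U x * V x <= U' x * V' x) -> L2dot U V <= L2dot U' V'.
Proof.
move=> h.
have q W : L2norm (W - L2res `]0, 1[ W) = 0.
  by apply: L2_eq_on => x x01; rewrite L2resE in_itv/= x01.
rewrite (L2dot_aeq _ (q U)) (L2dot_aeq _ (q U')).
apply: le_Rintegral => //; [exact: L2_integrableM..|] => x _.
by rewrite !L2resE; case: ifP; rewrite ?mul0r// in_itv/= => /h.
Qed.

Lemma L2dot_ge0_on U V : (forall x : R, 0 < x < 1 -> 0 <= U x * V x) ->
  0 <= L2dot U V.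
Proof.
by move=> h; have := @L2dot_le_on 0 0 U V; rewrite L2dot0l; apply => x /h; rewrite mul0r.
Qed.

Lemma L2norm_le U V : (forall x, `|U x| <= `|V x|) -> L2norm U <= L2norm V.
Proof.
move=> h; rewrite -ler_sqr ?nnegrE ?L2norm_ge0// !L2norm_sqr.
apply: L2dot_le_on => x _; rewrite -!expr2 -[leLHS]real_normK ?num_real//.
by rewrite -[leRHS]real_normK ?num_real// ler_sqr ?nnegrE.
Qed.

(** Left-closed, right-open intervals make indicators pointwise differences of steps, and the steps
    right-continuous. *)
Definition L2ind (a b : R) : L2 R := L2res `[a, b[ (L2one R).

Definition L2step (a : R) : L2 R := L2res `[a, +oo[ (L2one R).

Lemma L2indE (a b x : R) : L2ind a b x = if a <= x < b then 1 else 0.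
Proof. by rewrite L2resE in_itv. Qed.

Lemma L2stepE (a x : R) : L2step a x = if a <= x then 1 else 0.
Proof. by rewrite L2resE in_itv/= andbT. Qed.

Lemma L2ind_step (a b : R) : a <= b -> L2ind a b = L2step a - L2step b.
Proof.
move=> ab; apply/LfuneqP => x; rewrite L2_applyE L2_applyN L2indE !L2stepE.
have [bx|xb] := leP b x; last by rewrite andbT subr0.
by rewrite andbF (le_trans ab bx) subrr.
Qed.

Lemma L2ind_sqr (a b : R) : L2norm (L2ind a b) ^+ 2 = fine (mu `[a, b[%classic).
Proof.
rewrite L2norm_sqr /L2dot /Rintegral -[X in mu X]setIT -integral_indic//; congr fine.
apply: eq_integral => x _; rewrite !L2indE [RHS]/= indicE mem_setE in_itv/=.
by case: ifP; rewrite ?mulr1 ?mulr0.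
Qed.

Lemma L2norm_ind_le (a b : R) : a <= b -> L2norm (L2ind a b) ^+ 2 <= b - a.
Proof.
move=> ab; rewrite L2ind_sqr -lee_fin fineK; last first.
  rewrite ge0_fin_numE//; apply: (@le_lt_trans _ _ (mu setT)).
    by apply: le_measure; rewrite ?inE.
  by rewrite [mu _]muOmega_setT ltry.
apply: (@le_trans _ _ (lebesgue_measure `[a, b[%classic)).
  by rewrite [leLHS]muOmegaE; apply: le_measure; rewrite ?inE//; exact: measurableI.
by rewrite lebesgue_measure_itv/= lte_fin; case: ifP => //; rewrite lee_fin subr_ge0.
Qed.

Lemma L2dot_ind_ind (a b : R) : 0 <= a -> a <= b -> b <= 1 ->
  L2dot (L2ind a b) (L2ind a b) = b - a.
Proof.
move=> a0 ab b1; rewrite -L2norm_sqr L2ind_sqr muOmegaE.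
(* The point 0 is outside Omega, so for [a = 0] the intersection is open on the left. *)
have -> : `[a, b[ `&` `]0, 1[ = [set` if a == 0 then `]a, b[ else `[a, b[] :> set R.
  have e x : (x \in `[a, b[) && (x \in `]0, 1[) =
      (x \in if a == 0 then `]a, b[ else `[a, b[).
    case: eqP => a00; rewrite !in_itv/=.
      rewrite a00; apply/andP/andP => [[/andP[_ ->] /andP[->]]//|[x0 xb]].
      by rewrite (ltW x0) xb x0 (lt_le_trans xb).
    have {}a0 : 0 < a by rewrite lt_neqAle a0 andbT eq_sym; apply/eqP.
    apply/idP/idP => [/andP[]//|/andP[ax xb]].
    by rewrite ax xb (lt_le_trans a0 ax) (lt_le_trans xb).
  by apply/seteqP; split => x /=; rewrite -e => /andP.
by case: ifP => _; rewrite lebesgue_measure_itv/= lte_fin; case: ltP => //= ba;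
  rewrite ?subr0; apply/esym/eqP; rewrite subr_eq0 eq_le ab ba.
Qed.

Lemma L2_eq_but1 U V (a : R) : (forall x : R, 0 < x < 1 -> x != a -> U x = V x) ->
  L2norm (U - V) = 0.
Proof.
move=> UV; apply/L2_ae_eq.
have ae_a : {ae mu, forall x, x != a}.
  exists [set a]; split => //.
    apply/eqP; rewrite -measure_le0 -(lebesgue_measure_set1 a) [leLHS]muOmegaE.
    by apply: le_measure; rewrite ?inE//; exact: measurableI.
  by move=> x /= /negP; rewrite negbK => /eqP.
by apply: ae_imp2 ae_Omega ae_a => x x01 xa _; exact: UV.
Qed.

(** The bound is asked on the open interval only: an endpoint may be 0 or 1, where membership in [K]
    gives no information. *)
Lemma L2dot_ind_le V (k a b : R) : 0 <= a -> a <= b -> b <= 1 ->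
  (forall x : R, a < x < b -> V x <= k) -> L2dot V (L2ind a b) <= k * (b - a).
Proof.
move=> a0 ab b1 h; rewrite -(L2dot_ind_ind a0 ab b1) -L2dotZl -subr_le0.
have -> : L2dot (k *: L2ind a b) (L2ind a b) = L2dot (k *: L2one R) (L2ind a b).
  by rewrite !L2dotZl L2dot_res L2res_id.
rewrite -L2dotBl L2dotC (@L2dot_aeq _ _ (L2res `]a, b[ (L2one R))); last first.
  apply: (@L2_eq_but1 _ _ a) => x _ xa; rewrite !L2resE !in_itv/=.
  by rewrite le_eqVlt eq_sym (negbTE xa).
rewrite -oppr_ge0 -L2dotNr; apply: L2dot_ge0_on => x _.
rewrite L2resE L2oneE L2_applyN L2_subcE in_itv/=; case: ifP => [/h|_]; last by rewrite mul0r.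
by rewrite mul1r oppr_ge0 subr_le0.
Qed.

Lemma L2dot_ind_ge V (k a b : R) : 0 <= a -> a <= b -> b <= 1 ->
  (forall x : R, a < x < b -> k <= V x) -> k * (b - a) <= L2dot V (L2ind a b).
Proof.
move=> a0 ab b1 h; rewrite -lerN2 -L2dotNl -mulNr.
by apply: L2dot_ind_le => // x xab; rewrite L2_applyN lerN2 h.
Qed.

(** The norm of an indicator is at most the square root of its length, whence [e ^+ 2]. *)
Lemma L2norm_step_close (a b e : R) : 0 <= e -> `|a - b| <= e ^+ 2 ->
  L2norm (L2step a - L2step b) <= e.
Proof.
wlog ab : a b / a <= b => [H e0 h|e0 h].
  have [/H|/ltW /H] := leP a b; first exact.
  by rewrite L2normB; apply => //; rewrite distrC.
rewrite -L2ind_step// -ler_sqr ?nnegrE ?L2norm_ge0//.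
rewrite (le_trans (L2norm_ind_le ab))//.
by rewrite distrC ger0_norm// in h; rewrite subr_ge0.
Qed.

End L2_intervals.

(** * The cone of nondecreasing functions and its flat intervals *)

Lemma clampP (R : realType) (p q u : R) : p <= q ->
  [\/ u <= p /\ Num.max p (Num.min q u) = p,
      p <= u <= q /\ Num.max p (Num.min q u) = u |
      q <= u /\ Num.max p (Num.min q u) = q].
Proof.
move=> pq; have [qu|uq] := leP q u.
  by apply: Or33; rewrite max_r.
have [pu|up] := leP p u; first by apply: Or32; rewrite (ltW uq).
by apply: Or31; rewrite (ltW up).
Qed.

Section cone_K.
Context (R : realType).
Local Notation mu := (@muOmega R).
Implicit Types (U V W X Y Z : L2 R).

(** For a nondecreasing function, right continuity at [m] amounts to a single point to the right of
    [m] for each [e]; membership in [K] becomes pointwise arithmetic. *)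
Lemma KP X : K X <->
  (forall x y : R, 0 < x -> x <= y -> y < 1 -> X x <= X y) /\
  (forall m e : R, 0 < m -> m < 1 -> 0 < e -> exists y : R, [/\ m < y, y < 1 & X y <= X m + e]).
Proof.
split=> [[mX rX]|[mX rX]].
  have mX' x y : 0 < x -> x <= y -> y < 1 -> X x <= X y.
    move=> x0 xy y1; apply: mX => //; rewrite in_itv/=.
      by rewrite x0 (le_lt_trans xy).
    by rewrite y1 (lt_le_trans x0).
  split=> // m e m0 m1 e0.
  have : Omega m by rewrite /Omega/= in_itv/= m0.
  move/rX/cvgrPdist_le/(_ e e0) => h.
  have : \forall x \near m^'+, [/\ m < x, x < 1 & X x <= X m + e].
    near=> x; split.
    - by near: x; exact: nbhs_right_gt.
    - by near: x; exact: nbhs_right_lt.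
    - have : `|X m - X x| <= e by near: x.
      by rewrite ler_norml => /andP[+ _]; lra.
  by move=> /(@filter_ex _ _ (at_right_proper_filter m)).
split=> [x y|m].
  by rewrite !in_itv/= => /andP[x0 x1] /andP[y0 y1] xy; exact: mX.
rewrite /Omega/= in_itv/= => /andP[m0 m1].
apply/cvgrPdist_le => e e0; have [y [my y1 Xy]] := rX m e m0 m1 e0.
near=> x.
have mx : m < x by near: x; exact: nbhs_right_gt.
have xy : x < y by near: x; exact: nbhs_right_lt.
have h1 : X m <= X x := mX m x m0 (ltW mx) (lt_trans xy y1).
have h2 : X x <= X y := mX x y (lt_trans m0 mx) (ltW xy) y1.
by rewrite ler_norml; apply/andP; split; lra.
Unshelve. all: by end_near. Qed.

Lemma K_le X (x y : R) : K X -> 0 < x -> x <= y -> y < 1 -> X x <= X y.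
Proof. by move=> /KP[+ _]; exact. Qed.

Lemma KD X Y : K X -> K Y -> K (X + Y).
Proof.
move=> /KP[mX rX] /KP[mY rY]; apply/KP; split=> [x y x0 xy y1|m e m0 m1 e0].
  by rewrite !L2_applyD lerD ?mX ?mY.
have e20 : 0 < e / 2 by rewrite divr_gt0.
have [y [my y1 Xy]] := rX m _ m0 m1 e20; have [z [mz z1 Yz]] := rY m _ m0 m1 e20.
exists (Num.min y z); split; rewrite ?lt_min ?my ?mz ?gt_min ?y1//.
rewrite !L2_applyD.
have h1 : X (Num.min y z) <= X y by apply: mX; rewrite ?lt_min ?ge_min ?lexx ?(lt_trans m0).
have h2 : Y (Num.min y z) <= Y z by apply: mY; rewrite ?lt_min ?ge_min ?lexx ?orbT ?(lt_trans m0).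
by lra.
Qed.

Lemma KZ (a : R) X : 0 <= a -> K X -> K (a *: X).
Proof.
rewrite le_eqVlt => /predU1P[<- _|a0 /KP[mX rX]].
  rewrite scale0r; apply/KP; split => // m e m0 m1 e0.
  by exists ((m + 1) / 2); split; [lra|lra|rewrite L2_apply0 add0r ltW].
apply/KP; split=> [x y x0 xy y1|m e m0 m1 e0].
  by rewrite !L2_applyZ ler_wpM2l ?(ltW a0)// mX.
have ea0 : 0 < e / a by rewrite divr_gt0.
have [y [my y1 Xy]] := rX m _ m0 m1 ea0; exists y; split => //.
have -> : (a *: X) m + e = a * (X m + e / a).
  by rewrite L2_applyZ mulrDr mulrCA mulfV ?gt_eqF// mulr1.
by rewrite L2_applyZ ler_pM2l.
Qed.

Lemma K_cst c : @K R (c *: L2one R).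
Proof.
apply/KP; split=> [x y _ _ _|m e m0 m1 e0]; first by rewrite !L2_applyZ.
by exists ((m + 1) / 2); split; [lra|lra|rewrite !L2_applyZ lerDl ltW].
Qed.

Lemma K0 : @K R 0.
Proof. by rewrite -(scale0r (L2one R)); exact: K_cst. Qed.

Lemma K_convex (x y : L2 R) (t : R) : K x -> K y -> 0 <= t <= 1 -> K (x + t *: (y - x)).
Proof.
move=> Kx Ky /andP[t0 t1].
have -> : x + t *: (y - x) = (1 - t) *: x + t *: y.
  by apply/LfuneqP => z; rewrite !L2_applyE; ring.
by apply: KD; apply: KZ => //; rewrite subr_ge0.
Qed.

(** Both a clamp and the identity minus a clamp are nondecreasing, so [Y] splits into two members of
    [K]. A vector polar to [K] and orthogonal to [Y] is then orthogonal to each of them. *)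
Lemma K_clamp (p q : R) Y : p <= q -> K Y ->
  exists T, [/\ K T, K (Y - T) & forall x, T x = Num.max p (Num.min q (Y x))].
Proof.
move=> pq KY.
have TP : (fun x => Num.max p (Num.min q (Y x))) \in Lfun mu 2%:E.
  apply: (@L2_bounded _ _ (`|p| + `|q|)).
    apply: measurable_maxr => //; apply: measurable_minr => //; exact: L2_measurable.
  move=> x; rewrite ler_norml.
  have p1 : p <= `|p| := ler_norm p. have q1 : q <= `|q| := ler_norm q.
  have p2 : - p <= `|p| by rewrite -normrN ler_norm.
  have q2 : 0 <= `|q| by []. have p3 : 0 <= `|p| by [].
  by rewrite le_max ge_max ge_min; apply/andP; split; [|apply/andP; split]; lra.
exists (toL2 TP); split => //.
  move/KP : KY => [mY rY]; apply/KP; split=> [x y x0 xy y1|m e m0 m1 e0].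
    have := mY x y x0 xy y1; rewrite /=; move: (Y x) (Y y) => u v uv.
    by case: (clampP u pq) => -[hu ->]; case: (clampP v pq) => -[hv ->]; lra.
  have [y [my y1 Yy]] := rY m e m0 m1 e0; exists y; split => //; rewrite /=.
  move: (Y y) (Y m) Yy => u v uv.
  by case: (clampP u pq) => -[hu ->]; case: (clampP v pq) => -[hv ->]; lra.
move/KP : KY => [mY rY]; apply/KP; split=> [x y x0 xy y1|m e m0 m1 e0].
  have := mY x y x0 xy y1; rewrite !L2_applyD !L2_applyN /=.
  move: (Y x) (Y y) => u v uv.
  by case: (clampP u pq) => -[hu ->]; case: (clampP v pq) => -[hv ->]; lra.
have [y [my y1 Yy]] := rY m e m0 m1 e0; exists y; split => //.
have := mY m y m0 (ltW my) y1.
rewrite !L2_applyD !L2_applyN /=; move: (Y y) (Y m) Yy => u v uv uv'.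
by case: (clampP u pq) => -[hu ->]; case: (clampP v pq) => -[hv ->]; lra.
Qed.

End cone_K.

(** * Flat intervals and their maximal components *)

Section flat.
Context (R : realType).
Local Notation mu := (@muOmega R).
Implicit Types (U V W X Y Z : L2 R).

Definition flat X (a b : R) :=
  forall x y : R, a < x < b -> a < y < b -> X x = X y.

Lemma OmegaXP X (m : R) : OmegaX X m <->
  exists a b : R, [/\ 0 <= a, a < m, m < b, b <= 1 & flat X a b].
Proof.
split=> [[]|[a [b [a0 am mb b1 h]]]].
  rewrite /Omega/= in_itv/= => /andP[m0 m1] /nbhs_ballP[d /= d0 h].
  pose a := Num.max 0 (m - d); pose b := Num.min 1 (m + d).
  have e (x : R) : a < x < b -> X x = X m.
    rewrite gt_max lt_min => /andP[/andP[x0 x1] /andP[x2 x3]].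
    by apply: h; rewrite /ball/= ltr_norml; apply/andP; split; lra.
  exists a, b; split.
  - by rewrite le_max lexx.
  - by rewrite gt_max m0; lra.
  - by rewrite lt_min m1; lra.
  - by rewrite ge_min lexx.
  - by move=> x y xab yab; rewrite (e x)// (e y).
split; first by rewrite /Omega/= in_itv/= (le_lt_trans a0 am) (lt_le_trans mb).
near=> x; apply: h; last by rewrite am.
by apply/andP; split; near: x; [exact: lt_nbhsr|exact: lt_nbhsl].
Unshelve. all: by end_near. Qed.

Lemma flat_OmegaX X (a b : R) : 0 <= a -> b <= 1 -> flat X a b ->
  `]a, b[%classic `<=` OmegaX X.
Proof.
move=> a0 b1 h m; rewrite /= in_itv/= => /andP[am mb].
by apply/OmegaXP; exists a, b.
Qed.

(** Connectedness: let [s] be the supremum of the points up to which [X] keeps the value [X x]. A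
    flat neighbourhood of [s] would push this supremum further unless it already reaches beyond
    [y]. *)
Lemma OmegaX_flat X (a b : R) : `]a, b[%classic `<=` OmegaX X -> flat X a b.
Proof.
move=> h.
suff H (x y : R) : a < x -> x <= y -> y < b -> X x = X y.
  move=> x y /andP[ax xb] /andP[ay yb].
  by have [/H|/ltW /H] := leP x y; [apply|move=> ->].
move=> ax xy yb.
pose S := [set z : R | x <= z <= y /\ forall w, x <= w <= z -> X w = X x].
have Sx : S x by split=> [|w]; [rewrite lexx xy|rewrite -eq_le => /eqP ->].
have supS : has_sup S by split; [exists x|exists y => z [/andP[]]].
pose s := sup S.
have xs : x <= s by apply: ub_le_sup => //; case: supS.
have sy : s <= y by apply: ge_sup => [|z [/andP[]]//]; case: supS.
have /h/OmegaXP[c [d [c0 cs sd d1 fl]]] : `]a, b[%classic s.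
  by rewrite /= in_itv/= (lt_le_trans ax xs) (le_lt_trans sy yb).
have [z Sz cz] : exists2 z, S z & c < z.
  have sc : 0 < s - c by rewrite subr_gt0.
  by have [z Sz] := sup_adherent sc supS; rewrite -/s opprB addrCA subrr addr0 => ?; exists z.
have zs : z <= s by apply: ub_le_sup => //; case: supS.
have all (w : R) : x <= w < d -> X w = X x.
  move=> /andP[xw wd]; have [wz|zw] := leP w z.
    by case: Sz => _; apply; rewrite xw.
  case: Sz => /andP[xz _] hz; rewrite -(hz z) ?xz ?lexx//.
  by apply: fl; rewrite ?wd ?cz ?(lt_trans cz zw)//= (le_lt_trans zs).
have [dy|yd] := leP d y; last by rewrite (all y)// xy.
have mid : S ((s + d) / 2).
  split=> [|w /andP[xw wm]]; first by apply/andP; split; lra.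
  by apply: all; rewrite xw/=; lra.
suff : (s + d) / 2 <= s by lra.
by apply: ub_le_sup => //; case: supS.
Qed.

(** Maximality is expressed by endpoints outside [OmegaX X]; for 0 and 1 this is automatic, as they
    are not in Omega. *)
Definition component X (a b : R) :=
  [/\ 0 <= a, a < b, b <= 1, flat X a b & ~ OmegaX X a /\ ~ OmegaX X b].

(** The endpoints are the infimum and supremum of the level set of [X] through [m], between which
    [X] is constant by monotonicity. A flat neighbourhood of an endpoint would carry points of the
    level set beyond it. *)
Lemma OmegaX_component X (m : R) : K X -> OmegaX X m ->
  exists a b : R, component X a b /\ a < m < b.
Proof.
move=> KX /[dup] Om /OmegaXP[c [d [c0 cm md d1 fl]]].
pose A := [set z : R | 0 < z < 1 /\ X z = X m].
have cA (z : R) : c < z < d -> A z.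
  move=> /andP[cz zd]; split; first by rewrite (le_lt_trans c0 cz) (lt_le_trans zd).
  by apply: fl; rewrite ?cz ?cm.
have iA : has_inf A.
  by split; [exists m; apply: cA; rewrite cm|exists 0 => z [/andP[/ltW]]].
have sA : has_sup A.
  by split; [exists m; apply: cA; rewrite cm|exists 1 => z [/andP[_ /ltW]]].
pose a := inf A; pose b := sup A.
have lA (z : R) : A z -> a <= z <= b.
  by move=> Az; apply/andP; split; [apply: ge_inf => //; case: iA|apply: ub_le_sup => //; case: sA].
have a0 : 0 <= a by apply: lb_le_inf => [|z [/andP[/ltW]]//]; case: iA.
have b1 : b <= 1 by apply: ge_sup => [|z [/andP[_ /ltW]]//]; case: sA.
have nearA e : 0 < e -> exists2 z, A z & z < a + e.
  by move=> e0; have [z] := inf_adherent e0 iA; exists z.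
have nearB e : 0 < e -> exists2 z, A z & b - e < z.
  by move=> e0; have [z] := sup_adherent e0 sA; exists z.
have am : a < m.
  have /cA/lA/andP[] : c < (c + m) / 2 < d by apply/andP; split; lra.
  lra.
have mb : m < b.
  have /cA/lA/andP[] : c < (d + m) / 2 < d by apply/andP; split; lra.
  lra.
have Xm (x : R) : a < x < b -> X x = X m.
  move=> /andP[ax xb].
  have [|z Az zx] := nearA (x - a); first by rewrite subr_gt0.
  have [|w Aw xw] := nearB (b - x); first by rewrite subr_gt0.
  case: Az Aw => /andP[z0 z1] Xz [/andP[w0 w1] Xw].
  apply/eqP; rewrite eq_le -{1}Xw -Xz.
  by rewrite !(K_le KX)//; lra.
have fab : flat X a b by move=> x y /Xm -> /Xm ->.
exists a, b; split; last by rewrite am.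
split => //; first exact: lt_trans mb.
split=> /OmegaXP[c' [d' [c0' cm' md' d1' fl']]].
  have [|z Az] := nearA (d' - a); first by rewrite subr_gt0.
  rewrite addrC subrK => zd'; have /andP[az zb] := lA z Az.
  have : A ((c' + a) / 2).
    split; first by apply/andP; split; lra.
    by case: Az => _ <-; apply: fl'; apply/andP; split; lra.
  by move/lA/andP => []; lra.
have [|z Az] := nearB (b - c'); first by rewrite subr_gt0.
rewrite subKr => zd'; have /andP[az zb] := lA z Az.
have : A ((d' + b) / 2).
  split; first by apply/andP; split; lra.
  by case: Az => _ <-; apply: fl'; apply/andP; split; lra.
by move/lA/andP => []; lra.
Qed.

Lemma L2dot_flat Y (a b c d : R) : 0 <= c -> a < c -> c <= d -> d <= b -> d <= 1 ->
  flat Y a b -> L2dot Y (L2ind c d) = Y c * (d - c).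
Proof.
move=> c0 ac cd db d1 fl; apply: le_anti.
have h (x : R) : c < x < d -> Y x = Y c.
  by move=> /andP[cx xd]; apply: fl; apply/andP; split; lra.
by apply/andP; split; [apply: L2dot_ind_le|apply: L2dot_ind_ge] => // x /h ->.
Qed.

(** If [Y x < Y y], then [psi], which compares the masses just right of [y] and just left of [x]
    within [(a, b)], pairs positively with [Y] but vanishes on every function flat on [(a, b)].
    Being monotone, [Y] turns this L2 information into a pointwise statement. *)
Lemma flat_closed Y (a b : R) : K Y -> 0 <= a -> b <= 1 ->
  (forall e, 0 < e -> exists Z, flat Z a b /\ L2norm (Y - Z) <= e) -> flat Y a b.
Proof.
move=> KY a0 b1 h.
suff H (x y : R) : a < x -> x < y -> y < b -> Y x = Y y.
  move=> x y /andP[ax xb] /andP[ay yb].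
  by case: (ltgtP x y) => [/H|/H|->//]; [apply|move=> ->].
move=> ax xy yb.
have mxy : Y x <= Y y by apply: (K_le KY); lra.
apply: le_anti; rewrite mxy/= leNgt; apply/negP => Yxy.
pose t := Num.min ((x - a) / 2) ((b - y) / 2).
have t1 : t <= (x - a) / 2 by rewrite ge_min lexx.
have t2 : t <= (b - y) / 2 by rewrite ge_min lexx orbT.
have t0 : 0 < t by rewrite lt_min; apply/andP; split; lra.
pose psi := L2ind y (y + t) - L2ind (x - t) x.
have g0 : 0 < (Y y - Y x) * t by rewrite mulr_gt0// subr_gt0.
have ge : (Y y - Y x) * t <= L2dot Y psi.
  rewrite L2dotBr.
  have h1 : Y y * (y + t - y) <= L2dot Y (L2ind y (y + t)).
    by apply: L2dot_ind_ge => [|||z /andP[yz zt]]; [lra|lra|lra|apply: (K_le KY); lra].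
  have h2 : L2dot Y (L2ind (x - t) x) <= Y x * (x - (x - t)).
    by apply: L2dot_ind_le => [|||z /andP[yz zt]]; [lra|lra|lra|apply: (K_le KY); lra].
  by lra.
have e0 : 0 < (Y y - Y x) * t / (L2norm psi + 1).
  by rewrite divr_gt0// ltr_pwDr// L2norm_ge0.
have [Z [fZ nZ]] := h _ e0.
have Z0 : L2dot Z psi = 0.
  rewrite L2dotBr (L2dot_flat _ _ _ _ _ fZ); [|lra..].
  rewrite (L2dot_flat _ _ _ _ _ fZ); [|lra..].
  have -> : Z y = Z (x - t) by apply: fZ; apply/andP; split; lra.
  by rewrite -mulrBr; lra.
have := L2_cauchy_schwarz (Y - Z) psi; rewrite L2dotBl Z0 subr0.
have n0 := L2norm_ge0 psi.
have n1 : 0 < L2norm psi + 1 by rewrite ltr_pwDr.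
move: nZ; rewrite ler_pdivlMr// => nZ.
have := L2norm_ge0 (Y - Z).
move: nZ ge g0 n0; set p := L2norm psi; set q := L2norm (Y - Z); set g := _ * t; set l := L2dot _ _.
nra.
Qed.

End flat.

(** * Closedness of the cone *)

Section K_closed.
Context (R : realType).
Local Notation mu := (@muOmega R).
Implicit Types (U V W X Y Z : L2 R).

Lemma measurable_nondecreasing_in (D : set R) (f : R -> R) : is_interval D ->
  (forall x y, D x -> D y -> x <= y -> f x <= f y) -> measurable_fun D f.
Proof.
move=> iD f_nd.
apply: (measurability (@RGenCInfty.G R)) => [|_ [_] [r] -> <-].
  exact: RGenCInfty.measurableE.
apply: is_interval_measurable => s t [Ds].
rewrite /= in_itv/= andbT => fs [Dt].
rewrite in_itv/= andbT => ft u /andP[su ut].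
have Du : D u by apply: (iD s t) => //; rewrite su ut.
by split => //; rewrite in_itv/= andbT (le_trans fs)// f_nd.
Qed.

Lemma ae_Omega_dense (P : set R) (a b : R) : 0 <= a -> a < b -> b <= 1 ->
  {ae mu, forall x, P x} -> exists2 x, P x & a < x < b.
Proof.
move=> a0 ab b1 [N [mN N0 NP]].
apply: contrapT => h.
have sub : `]a, b[%classic `<=` N.
  move=> x; rewrite /= in_itv/= => xab; apply: NP => Px; apply: h.
  by exists x.
have : (mu `]a, b[%classic <= mu N)%E by apply: le_measure; rewrite ?inE.
rewrite N0 muOmegaE setIidl; last first.
  by move=> x; rewrite /= !in_itv/= => /andP[ax xb]; rewrite (le_lt_trans a0 ax) (lt_le_trans xb).
by rewrite lebesgue_measure_itv/= lte_fin ab -EFinB lee_fin subr_le0 leNgt ab.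
Qed.

Lemma muOmega_null (A : set (measurableTypeR R)) : measurable A ->
  lebesgue_measure A = 0%E -> mu A = 0%E.
Proof.
move=> mA A0; apply/eqP; rewrite -measure_le0 -A0 [leLHS]muOmegaE.
by apply: le_measure; rewrite ?inE//; exact: measurableI.
Qed.

(** The intervals from [f x] to [g x] are disjoint, and each contains a rational. *)
Lemma countable_jump (A : set R) (f g : R -> R) :
  (forall x, A x -> f x < g x) ->
  (forall x y, A x -> A y -> x < y -> g x <= f y) -> countable A.
Proof.
move=> fg gf.
have ex x : exists q : rat, A x -> f x < ratr q < g x.
  have [Ax|nA] := pselect (A x); last by exists 0.
  by have [q] := rat_in_itvoo (fg x Ax); rewrite in_itv/= => h; exists q.
pose q x := projT1 (cid (ex x)).
have qP x : A x -> f x < ratr (q x) < g x by rewrite /q; case: cid.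
apply/countable_injP; exists (pickle \o q) => x y /set_mem Ax /set_mem Ay.
move=> /(pcan_inj pickleK) qxy.
have /andP[x1 x2] := qP x Ax; have /andP[y1 y2] := qP y Ay; rewrite qxy in x1 x2.
case: (ltgtP x y) => // [/(gf _ _ Ax Ay)|/(gf _ _ Ay Ax)] h.
  by have := lt_trans (lt_le_trans x2 h) y1; rewrite ltxx.
by have := lt_trans (lt_le_trans y2 h) x1; rewrite ltxx.
Qed.

(** Along an almost everywhere convergent subsequence the limit [U] is nondecreasing on a conull set
    [P]. Its right-continuous version [V] is the infimum of [U] over the points of [P] to the right;
    on [P] the two differ only at jumps, which are countable. *)
Lemma K_closed : L2closed (@K R).
Proof.
move=> u U0 Ku uU0.
have [U [uU [phi aeU]]] := L2_complete (L2lim_cauchy uU0).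
have U0U : L2norm (U0 - U) = 0 by apply: (L2lim_uniq uU0); exact/L2limP.
pose P (x : R) := 0 < x < 1 /\ u (phi k) x @[k --> \oo] --> U x.
have aeP : {ae mu, forall x, P x} by apply: ae_imp2 (@ae_Omega R) aeU.
have PU x y : P x -> P y -> x <= y -> U x <= U y.
  move=> [/andP[x0 x1] Px] [/andP[y0 y1] Py] xy; apply: (ler_cvg_to Px Py).
  by apply: nearW => k; exact: (K_le (Ku _)).
have dense (a b : R) : 0 <= a -> a < b -> b <= 1 -> exists2 x, P x & a < x < b.
  by move=> a0 ab b1; exact: ae_Omega_dense.
pose A m := [set U y | y in [set y | P y /\ m < y]].
have iA (m : R) : 0 < m -> m < 1 -> has_inf (A m).
  move=> m0 m1; split.
    by have [y Py /andP[my _]] := dense m 1 (ltW m0) m1 (lexx _); exists (U y), y.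
  have [z Pz /andP[z0 zm]] := dense 0 m (lexx _) m0 (ltW m1).
  by exists (U z) => _ [y [Py my] <-]; apply: PU => //; lra.
pose V m := inf (A m).
have Vle (m y : R) : 0 < m -> m < y -> P y -> V m <= U y.
  move=> m0 my Py; apply: ge_inf; last by exists y.
  by have [_] := iA m m0 (lt_trans my (andP Py.1).2).
have mV (x y : R) : 0 < x -> x <= y -> y < 1 -> V x <= V y.
  move=> x0 xy y1; apply: lb_le_inf => [|_ [z [Pz yz] <-]].
    by have [] := iA y (lt_le_trans x0 xy) y1.
  by apply: Vle => //; exact: le_lt_trans yz.
have VU x : P x -> U x <= V x.
  move=> Px; have [/andP[x0 x1] _] := Px; apply: lb_le_inf => [|_ [z [Pz yz] <-]].
    by have [] := iA x x0 x1.
  by apply: PU => //; exact: ltW.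
(* Outside Omega the infimum may be over an empty or unbounded set; the cutoff gives a measurable
   extension. *)
pose W := V \_ `]0, 1[.
have WE (x : R) : 0 < x < 1 -> W x = V x by move=> x01; rewrite /W patchE mem_setE in_itv/= x01.
have mW : measurable_fun setT W.
  apply/(measurable_restrictT _ _).1; first exact: measurable_itv.
  apply: measurable_nondecreasing_in; first exact: interval_is_interval.
  by move=> x y; rewrite /= !in_itv/= => /andP[x0 x1] /andP[y0 y1] xy; exact: mV.
have UW : {ae mu, forall x, U x = W x}.
  have cB : countable [set x | P x /\ U x < V x].
    apply: (@countable_jump _ U V) => [x []//|x y [Px _] [Py _] xy].
    by apply: Vle => //; have [/andP[]] := Px.
  have aeB : {ae mu, forall x, ~ (P x /\ U x < V x)}.
    have mB : measurable ([set x | P x /\ U x < V x] : set (measurableTypeR R)).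
      by apply: countable_measurable => // t; exact: measurable_set1.
    exists [set x | P x /\ U x < V x]; split => //; last by move=> x /= /contrapT.
    by apply: muOmega_null => //; exact: countable_lebesgue_measure0.
  apply: ae_imp2 aeP aeB => x Px /not_andP[//|/negP]; rewrite -leNgt => VUx.
  by rewrite WE; [apply: le_anti; rewrite VU|case: Px].
have WP : W \in Lfun mu 2%:E.
  apply: L2_intro => //.
  have -> : (\int[mu]_x (W x ^+ 2)%:E = \int[mu]_x (U x ^+ 2)%:E)%E.
    apply: ae_eq_integral => //.
    - by apply/measurable_EFinP; exact: measurable_funX.
    - by apply/measurable_EFinP; apply: measurable_funX; exact: L2_measurable.
    - by apply: ae_imp UW => x -> _.
  by rewrite L2norm_sqrE ltry.
exists (toL2 WP); split; last first.
  suff h : L2norm (U - toL2 WP) = 0.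
    apply: le_anti; rewrite L2norm_ge0 andbT.
    by rewrite (le_trans (L2norm_triangle U _ _))// h U0U addr0.
  by apply/L2_ae_eq; apply: ae_imp UW.
apply/KP; split=> [x y x0 xy y1|m e m0 m1 e0] /=.
  by rewrite !WE ?mV//; lra.
have [_ [y [Py my] <-] Uy] := inf_adherent e0 (iA m m0 m1).
have [/andP[y0 y1] _] := Py.
exists ((m + y) / 2); split; [lra|lra|].
rewrite !WE; [|lra..].
by apply: le_trans (ltW Uy); apply: Vle => //; lra.
Qed.

End K_closed.

(** * The subspace [HX] and its orthogonal projection *)

Section HX_projection.
Context (R : realType).
Local Notation mu := (@muOmega R).
Implicit Types (U V W X Y Z : L2 R).

Definition const_on U (a b : R) :=
  exists c, L2norm (L2res `[a, b[ (U - c *: L2one R)) = 0.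

(** The almost everywhere statement becomes the vanishing of a norm, which behaves well under limits
    and linear combinations. *)
Lemma HXP X U : HX X U <->
  forall a b : R, 0 <= a -> a < b -> b <= 1 -> `]a, b[%classic `<=` OmegaX X -> const_on U a b.
Proof.
split=> [h a b a0 ab b1 /h[c [N [mN N0 Nc]]]|h a b hab].
  exists c; rewrite -[L2res _ _]subr0; apply/L2_ae_eq.
  have N0' : mu (N `|` [set a]) = 0%E.
    by apply: muOmega_null; [exact: measurableU|apply/eqP; rewrite -measure_le0; apply: le_trans (measureU2 _ _ _) _ => //; rewrite [X in (X + _)%E]N0 [X in (_ + X)%E]lebesgue_measure_set1 adde0].
  exists (N `|` [set a]); split => //; first exact: measurableU.
  move=> x H; apply: contrapT => /not_orP[nN xa]; apply: H => _.
  rewrite L2resE L2_subcE in_itv/=; case: ifP => // /andP[ax xb].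
  have : x \in `]a, b[ -> U x = c by apply: contrapT => /Nc.
  rewrite in_itv/= xb andbT lt_neqAle ax andbT eq_sym => /(_ (introN eqP xa)) Uc.
  by rewrite Uc subrr.
have [ab|ba] := ltP a b; last first.
  by exists 0; apply: aeW => x; rewrite in_itv/= => /andP[/lt_trans/[apply]]; rewrite ltNge ba.
have O (x : R) : a < x < b -> 0 < x < 1.
  by move=> axb; have [] : OmegaX X x by apply: hab; rewrite /= in_itv.
(* [OmegaX X] lies in Omega, whereas an interval leaving [[0, 1]] would contain the point exhibited
   below, which is outside Omega; likewise for [b]. *)
have a0 : 0 <= a.
  rewrite leNgt; apply/negP => a0.
  have /O : a < Num.min ((a + b) / 2) (a / 2) < b.
    by rewrite lt_min gt_min; apply/andP; split; [apply/andP; split|apply/orP; left]; lra.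
  by rewrite lt_min => /andP[/andP[_]]; lra.
have b1 : b <= 1.
  rewrite leNgt; apply/negP => b1.
  have /O : a < Num.max ((a + b) / 2) ((b + 1) / 2) < b.
    by rewrite gt_max lt_max; apply/andP; split; [apply/orP; left|apply/andP; split]; lra.
  by rewrite gt_max => /andP[_ /andP[_]]; lra.
have [c cP] := h a b a0 ab b1 hab.
exists c; have : (L2res `[a, b[ (U - c *: L2one R) : R -> R) = (0 : L2 R) %[ae mu].
  by apply/L2_ae_eq; rewrite subr0.
move=> [N [mN N0 Nc]].
exists (N `&` `]0, 1[%classic); split => //; first exact: measurableI.
move=> x /= /not_implyP[xab Uc]; rewrite in_itv/= in xab.
split; last by rewrite in_itv/= O.
apply: Nc => /(_ Logic.I); rewrite L2resE L2_subcE in_itv/=.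
have /andP[ax xb] := xab; rewrite (ltW ax) xb/=.
by move/eqP; rewrite subr_eq0 => /eqP.
Qed.

Lemma L2norm_res i U : L2norm (L2res i U) <= L2norm U.
Proof. by apply: L2norm_le => x; rewrite L2resE; case: ifP; rewrite ?normr0. Qed.

Lemma L2ind_res (a b : R) U : L2dot (L2res `[a, b[ U) (L2ind a b) = L2dot U (L2ind a b).
Proof. by rewrite L2dot_res L2res_id. Qed.

(** The mean of [U] is its best constant approximation on the interval, so the distance of [U] to
    the constants there is at most [L2norm (U - u n)]. *)
Lemma const_on_closed (u : nat -> L2 R) U (a b : R) : 0 <= a -> a < b -> b <= 1 ->
  (forall n, const_on (u n) a b) -> L2lim u U -> const_on U a b.
Proof.
move=> a0 ab b1 hu uU.
have ee : L2dot (L2ind a b) (L2ind a b) = b - a by rewrite L2dot_ind_ind// ltW.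
have ba0 : 0 < b - a by rewrite subr_gt0.
have [c Ue] : exists c, L2dot U (L2ind a b) = c * (b - a).
  by exists (L2dot U (L2ind a b) / (b - a)); rewrite divfK ?gt_eqF.
exists c; apply: le_anti; rewrite L2norm_ge0 andbT.
have best d : L2norm (L2res `[a, b[ (U - c *: L2one R)) <= L2norm (L2res `[a, b[ (U - d *: L2one R)).
  apply: L2norm_dot_le.
  have E k : L2res `[a, b[ (U - k *: L2one R) = L2res `[a, b[ U - k *: L2ind a b.
    by rewrite L2resB L2resZ.
  rewrite !E !L2dotE (L2dotC (L2ind a b)) L2ind_res ee.
  rewrite Ue -subr_ge0; set q := L2dot _ _.
  rewrite [X in 0 <= X](_ : _ = (b - a) * (d - c) ^+ 2); last by ring.
  by rewrite mulr_ge0 ?sqr_ge0// ltW.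
apply/ler_addgt0Pr => eps eps0; rewrite add0r.
have [N /(_ N (leqnn N)) HN] := uU _ eps0.
have [d dP] := hu N; apply: le_trans (best d) _.
have -> : L2res `[a, b[ (U - d *: L2one R) =
    L2res `[a, b[ (U - u N) + L2res `[a, b[ (u N - d *: L2one R).
  by rewrite !L2resB subrKA.
rewrite (le_trans (L2normD _ _))// dP addr0 (le_trans (L2norm_res _ _))//.
by rewrite L2normB.
Qed.

Lemma const_onD U V s t a b : const_on U a b -> const_on V a b ->
  const_on (s *: U + t *: V) a b.
Proof.
move=> [c cP] [d dP]; exists (s * c + t * d).
have -> : L2res `[a, b[ (s *: U + t *: V - (s * c + t * d) *: L2one R) =
    s *: L2res `[a, b[ (U - c *: L2one R) + t *: L2res `[a, b[ (V - d *: L2one R).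
  by rewrite -!L2resZ -L2resD scalerDl opprD addrACA !scalerBr !scalerA.
apply: le_anti; rewrite L2norm_ge0 andbT.
by rewrite (le_trans (L2normD _ _))// !L2normZ cP dP !mulr0 addr0.
Qed.

Lemma const_on0 a b : const_on 0 a b.
Proof.
exists 0; apply: le_anti; rewrite L2norm_ge0 andbT.
by rewrite (le_trans (L2norm_res _ _))// scale0r subr0 L2norm0.
Qed.

Lemma HX_lin X U V s t : HX X U -> HX X V -> HX X (s *: U + t *: V).
Proof.
by move=> /HXP hU /HXP hV; apply/HXP => a b *; apply: const_onD; [apply: hU|apply: hV].
Qed.

Lemma HX0 X : HX X 0.
Proof. by apply/HXP => a b *; exact: const_on0. Qed.

Lemma HX_closed X : L2closed (HX X).
Proof.
move=> u U hu uU; exists U; split; last by rewrite subrr L2norm0.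
apply/HXP => a b a0 ab b1 hab; apply: (const_on_closed a0 ab b1 _ uU) => n.
by have /HXP := hu n; apply.
Qed.

(** The projection exists, so [xget] does not fall back on its default. On a subspace the
    variational inequality, tested with [P + Z] and [P - Z], becomes orthogonality. *)
Lemma orthogonal_projectionP X U :
  is_orthogonal_projection (HX X) U (orthogonal_projection (HX X) U).
Proof.
apply: xgetPex.
have [|||P [HP orth]] := @L2_projection R (HX X) U.
- exact: HX_closed.
- by exists 0; exact: HX0.
- move=> x y t hx hy _.
  have -> : x + t *: (y - x) = (1 - t) *: x + t *: y.
    by apply/LfuneqP => z; rewrite !L2_applyE; ring.
  exact: HX_lin.
exists P; split => // Z HZ; apply: le_anti.
have h s : L2dot (U - P) (s *: Z) <= 0.
  have := orth (1 *: P + s *: Z) (HX_lin _ _ HP HZ).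
  by rewrite scale1r addrAC subrr add0r.
have := h 1; have := h (-1); rewrite !L2dotZr mul1r mulN1r oppr_le0.
by move=> -> ->.
Qed.

End HX_projection.

(** * Means, fluctuations and Chebyshev's inequality *)

Section averaging.
Context (R : realType).
Local Notation mu := (@muOmega R).
Implicit Types (U V W X Y Z : L2 R).

Definition mean (a b : R) Z := L2dot Z (L2ind a b) / (b - a).

Definition fluct (a b : R) Z : L2 R := L2res `[a, b[ (Z - mean a b Z *: L2one R).

Lemma fluctE a b Z x : fluct a b Z x = if a <= x < b then Z x - mean a b Z else 0.
Proof. by rewrite L2resE L2_subcE in_itv/=. Qed.

Lemma meanK (a b : R) Z : a < b -> mean a b Z * (b - a) = L2dot Z (L2ind a b).
Proof. by move=> ab; rewrite divfK// subr_eq0 gt_eqF. Qed.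

Lemma fluct_ind (a b : R) Z : 0 <= a -> a < b -> b <= 1 ->
  L2dot (fluct a b Z) (L2ind a b) = 0.
Proof.
move=> a0 ab b1; have one : L2dot (L2one R) (L2ind a b) = b - a.
  by rewrite -L2ind_res -/(L2ind a b) L2dot_ind_ind ?(ltW ab).
by rewrite L2ind_res L2dotBl L2dotZl one (meanK _ ab) subrr.
Qed.

Lemma fluct_const (a b : R) Z U : 0 <= a -> a < b -> b <= 1 -> const_on U a b ->
  L2dot (fluct a b Z) U = 0.
Proof.
move=> a0 ab b1 [c cP]; rewrite /fluct -L2res_id L2dot_res -/(fluct a b Z).
have -> : L2res `[a, b[ U = L2res `[a, b[ (U - c *: L2one R) + c *: L2ind a b.
  by rewrite L2resB L2resZ subrK.
rewrite L2dotDr L2dotZr fluct_ind// mulr0 addr0 L2dotC (L2dot_aeq _ (V := 0)) ?L2dot0l//.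
by rewrite subr0.
Qed.

Lemma flat_const_on (a b : R) X : a < b -> flat X a b -> const_on X a b.
Proof.
move=> ab fX; exists (X ((a + b) / 2)).
have -> : L2norm (L2res `[a, b[ (X - X ((a + b) / 2) *: L2one R)) =
    L2norm (L2res `[a, b[ (X - X ((a + b) / 2) *: L2one R) - 0) by rewrite subr0.
apply/L2_ae_eq; exists [set a]; split => //.
  by apply: muOmega_null => //; rewrite lebesgue_measure_set1.
move=> x h; apply: contrapT => /eqP xa; apply: h => _.
rewrite L2resE L2_subcE in_itv/=; case: ifP => // /andP[ax xb].
apply/eqP; rewrite subr_eq0; apply/eqP.
by apply: fX; [rewrite xb andbT lt_neqAle eq_sym xa|apply/andP; split; lra].
Qed.

Lemma mean_ge (a b k : R) Z : 0 <= a -> a < b -> b <= 1 ->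
  (forall x : R, a < x < b -> k <= Z x) -> k <= mean a b Z.
Proof.
by move=> a0 ab b1 h; rewrite ler_pdivlMr ?subr_gt0// L2dot_ind_ge// (ltW ab).
Qed.

Lemma mean_le (a b k : R) Z : 0 <= a -> a < b -> b <= 1 ->
  (forall x : R, a < x < b -> Z x <= k) -> mean a b Z <= k.
Proof.
by move=> a0 ab b1 h; rewrite ler_pdivrMr ?subr_gt0// L2dot_ind_le// (ltW ab).
Qed.

(** [Z - fluct a b Z] is [Z] averaged over the interval. The mean lies between the values on either
    side, so averaging yields an admissible competitor in the projection inequality. *)
Lemma fluct_sub_K (a b : R) Z : 0 <= a -> a < b -> b <= 1 -> K Z -> K (Z - fluct a b Z).
Proof.
move=> a0 ab b1 KZ; have E x : (Z - fluct a b Z) x = if a <= x < b then mean a b Z else Z x.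
  by rewrite L2_applyD L2_applyN fluctE; case: ifP => _; rewrite ?subr0 ?subKr.
have lo (x : R) : 0 < x -> x < a -> Z x <= mean a b Z.
  move=> x0 xa; apply: mean_ge => // y /andP[ay yb].
  by apply: (K_le KZ); lra.
have hi (x : R) : x < 1 -> b <= x -> mean a b Z <= Z x.
  move=> x1 bx; apply: mean_le => // y /andP[ay yb].
  by apply: (K_le KZ); lra.
apply/KP; split=> [x y x0 xy y1|m e m0 m1 e0].
  rewrite !E; case: ifP => [/andP[ax xb]|/negbT/nandP xab];
    case: ifP => [/andP[ay yb]|/negbT/nandP yab] //.
  - by apply: hi => //; case: yab; lra.
  - by apply: lo => //; case: xab; lra.
  - exact: (K_le KZ).
have [ymb|] := boolP (a <= m < b).
  have /andP[am mb] := ymb; exists ((m + b) / 2); split; [lra|lra|].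
  by rewrite !E ymb ifT; [lra|apply/andP; split; lra].
move=> nab; have /KP[_ /(_ m e m0 m1 e0)[y [my y1 Zy]]] := KZ.
have [ma|am] := ltP m a.
  exists (Num.min y ((m + a) / 2)).
  have h1 : Num.min y ((m + a) / 2) <= y by rewrite ge_min lexx.
  have h2 : Num.min y ((m + a) / 2) <= (m + a) / 2 by rewrite ge_min lexx orbT.
  have h3 : m < Num.min y ((m + a) / 2) by rewrite lt_min my/=; lra.
  split; [by []|lra|].
  rewrite !E (negbTE nab) ifF; last by apply/negbTE/nandP; left; rewrite -ltNge; lra.
  by apply: le_trans Zy; apply: (K_le KZ); lra.
rewrite am/= -leNgt in nab.
exists y; split; [by []|by []|rewrite !E ifF]; last by apply/negbTE/nandP; right; rewrite -leNgt; lra.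
by rewrite ifF//; apply/negbTE/nandP; right; rewrite -leNgt.
Qed.

Lemma fluct_sub_flat (a b : R) Z : flat (Z - fluct a b Z) a b.
Proof.
move=> x y /andP[ax xb] /andP[ay yb].
by rewrite !L2_applyD !L2_applyN !fluctE (ltW ax) xb (ltW ay) yb !subKr.
Qed.

Lemma fluct_dot_self (a b : R) Z : 0 <= a -> a < b -> b <= 1 ->
  L2dot (fluct a b Z) Z = L2norm (fluct a b Z) ^+ 2.
Proof.
move=> a0 ab b1; rewrite L2norm_sqr; apply/eqP; rewrite -subr_eq0 -L2dotBr; apply/eqP.
by apply: fluct_const => //; apply: flat_const_on => //; exact: fluct_sub_flat.
Qed.

(* Chebyshev's correlation inequality for the nondecreasing functions [Y] and [Z]
   on [(a, b)]: for a threshold [k] of [Y] separating the sets where [Z] is below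
   and above its mean, [(Y - k) (Z - mean Z)] is pointwise nonnegative. *)
Lemma fluct_dot_ge0 (a b : R) Y Z : 0 <= a -> a < b -> b <= 1 ->
  K Y -> K Z -> 0 <= L2dot Y (fluct a b Z).
Proof.
move=> a0 ab b1 KY KZ.
have inj (x y : R) : a < x < b -> a < y < b -> x <= y -> Y x <= Y y /\ Z x <= Z y.
  by move=> /andP[ax xb] /andP[ay yb] xy; split; [apply: (K_le KY)|apply: (K_le KZ)]; lra.
(* Strictness survives integration by splitting at the midpoint [x]: on the right half [W] is at
   least [W x], a fixed excess over the mean. *)
have bad (W : L2 R) : K W -> (forall x : R, a < x < b -> mean a b W < W x) -> False.
  move=> KW h; pose x := (a + b) / 2.
  have xab : a < x < b by apply/andP; split; rewrite /x; lra.
  have := meanK W ab; rewrite (@L2ind_step _ a b) ?(ltW ab)//.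
  have -> : L2step a - L2step b = L2ind a x + L2ind x b.
    by rewrite !L2ind_step ?subrKA//; rewrite /x; lra.
  rewrite L2dotDr.
  have h1 : mean a b W * (x - a) <= L2dot W (L2ind a x).
    by apply: L2dot_ind_ge => [|||y yab]; rewrite /x; [lra|lra|lra|apply/ltW/h; move: yab => /andP[]; rewrite /x; lra].
  have h2 : W x * (b - x) <= L2dot W (L2ind x b).
    apply: L2dot_ind_ge => [|||y /andP[xy yb]]; [rewrite /x; lra..|].
    by apply: (K_le KW); move: xy; rewrite /x; lra.
  have h3 := h x xab.
  have : 0 < (W x - mean a b W) * (b - x) by rewrite mulr_gt0 ?subr_gt0//; case/andP: xab.
  by move: h1 h2; rewrite mulrBl !mulrBr; set m := mean a b W; lra.
have bad' (W : L2 R) : K W -> (forall x : R, a < x < b -> W x < mean a b W) -> False.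
  move=> KW h; pose x := (a + b) / 2.
  have xab : a < x < b by apply/andP; split; rewrite /x; lra.
  have := meanK W ab; rewrite (@L2ind_step _ a b) ?(ltW ab)//.
  have -> : L2step a - L2step b = L2ind a x + L2ind x b.
    by rewrite !L2ind_step ?subrKA//; rewrite /x; lra.
  rewrite L2dotDr.
  have h1 : L2dot W (L2ind a x) <= W x * (x - a).
    apply: L2dot_ind_le => [|||y /andP[xy yb]]; [rewrite /x; lra..|].
    by apply: (K_le KW); move: yb; rewrite /x; lra.
  have h2 : L2dot W (L2ind x b) <= mean a b W * (b - x).
    by apply: L2dot_ind_le => [|||y yab]; rewrite /x; [lra|lra|lra|apply/ltW/h; move: yab => /andP[]; rewrite /x; lra].
  have h3 := h x xab.
  have : 0 < (mean a b W - W x) * (x - a) by rewrite mulr_gt0 ?subr_gt0//; case/andP: xab.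
  by move: h1 h2; rewrite mulrBl !mulrBr; set m := mean a b W; lra.
have shift k : L2dot Y (fluct a b Z) = L2dot (Y - k *: L2one R) (fluct a b Z).
  rewrite L2dotBl [X in _ - X]L2dotC fluct_const ?subr0//.
  by exists k; rewrite subrr -(scale0r 0) L2resZ scale0r L2norm0.
suff [k hk] : exists k, forall x, a < x < b -> 0 <= (Y x - k) * (Z x - mean a b Z).
  rewrite (shift k) L2dotC (@L2dot_aeq _ _ (L2res `]a, b[ (Z - mean a b Z *: L2one R))).
    rewrite L2dotC; apply: L2dot_ge0_on => x _; rewrite L2resE !L2_subcE in_itv/=.
    by case: ifP => [/hk|]; rewrite ?mulr0.
  apply: (@L2_eq_but1 _ _ _ a) => x _ xa; rewrite !L2resE !in_itv/=.
  by rewrite le_eqVlt eq_sym (negbTE xa).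
pose S := [set Y x | x in [set x | a < x < b /\ Z x < mean a b Z]].
have [y yab Zy] : exists2 y : R, a < y < b & mean a b Z <= Z y.
  apply: contrapT => h; apply: (bad' Z KZ) => x xab.
  by rewrite ltNge; apply/negP => ?; apply: h; exists x.
have [S0|S0] := pselect (S !=set0).
  have sS : has_sup S.
    split => //; exists (Y y) => _ [x [xab Zx] <-].
    have [xy|yx] := leP x y; first by have [] := inj x y xab yab xy.
    by have [_] := inj y x yab xab (ltW yx); lra.
  exists (sup S) => x xab; have [Zx|Zx] := ltP (Z x) (mean a b Z).
    rewrite mulr_le0// ?subr_le0; last exact: ltW.
    by apply: ub_le_sup; [case: sS|exists x].
  rewrite mulr_ge0// ?subr_ge0//.
  apply: ge_sup => // _ [z [zab Zz] <-].
  have [zx|xz] := leP z x; first by have [] := inj z x zab xab zx.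
  by have [_] := inj x z xab zab (ltW xz); lra.
have Zge (x : R) : a < x < b -> mean a b Z <= Z x.
  by move=> xab; rewrite leNgt; apply/negP => Zx; apply: S0; exists (Y x), x.
have [x xab Zx] : exists2 x : R, a < x < b & Z x <= mean a b Z.
  apply: contrapT => h; apply: (bad Z KZ) => x xab.
  by rewrite ltNge; apply/negP => ?; apply: h; exists x.
(* Here [Z] is nowhere below its mean, so it equals the mean up to [x], and [Y x] serves as
   threshold. *)
exists (Y x) => z zab; have [zx|xz] := leP z x.
  have [_ h] := inj z x zab xab zx.
  have -> : Z z = mean a b Z by apply: le_anti; rewrite Zge// (le_trans h).
  by rewrite subrr mulr0.
by have [h1 h2] := inj x z xab zab (ltW xz); rewrite mulr_ge0// ?subr_ge0// Zge.
Qed.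

End averaging.

Lemma le0_of_small (R : realFieldType) (x C e0 : R) : 0 < e0 -> 0 <= C ->
  (forall e, 0 < e -> e <= e0 -> x <= C * e) -> x <= 0.
Proof.
move=> e00 C0 h; rewrite leNgt; apply/negP => x0.
have C1 : 0 < 2 * (C + 1) by lra.
pose e := Num.min e0 (x / (2 * (C + 1))).
have e1 : e <= e0 by rewrite ge_min lexx.
have e2 : e * (2 * (C + 1)) <= x by rewrite -ler_pdivlMr// ge_min lexx orbT.
have e3 : 0 < e by rewrite lt_min e00 divr_gt0.
by have := h e e3 e1; nra.
Qed.

(** * Normal cones *)

Section normal_cones.
Context (R : realType).
Implicit Types (U V W X Y Z xi : L2 R).

Definition polarK xi := forall Z, K Z -> L2dot xi Z <= 0.

(* The normal cone to [K] at [X], in a form that depends on [X] only through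
   [OmegaX X] and increases with it. *)
Definition in_S X xi := polarK xi /\
  forall m : R, 0 <= m -> m <= 1 -> ~ OmegaX X m -> L2dot xi (L2step m) = 0.

(** A convex cone that contains both [in_S X] and [HX X], hence every sticking force evaluated at
    [X]. *)
Definition in_N X W := forall a b : R, component X a b ->
  forall Z, K Z -> L2dot W (fluct a b Z) <= 0.

Lemma in_S_mono X Y xi : OmegaX X `<=` OmegaX Y -> in_S X xi -> in_S Y xi.
Proof. by move=> XY [p h]; split => // m m0 m1 nY; apply: h => // /XY. Qed.

Lemma in_SD X xi1 xi2 : in_S X xi1 -> in_S X xi2 -> in_S X (xi1 + xi2).
Proof.
move=> [p1 h1] [p2 h2]; split=> [Z KZ|m m0 m1 nm]; rewrite L2dotDl.
  by rewrite (le_trans (lerD (p1 Z KZ) (p2 Z KZ)))// addr0.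
by rewrite h1// h2// addr0.
Qed.

Lemma in_S0 X : in_S X 0.
Proof. by split=> [Z _|m _ _ _]; rewrite L2dot0l. Qed.

Lemma in_ND X W1 W2 : in_N X W1 -> in_N X W2 -> in_N X (W1 + W2).
Proof.
move=> h1 h2 a b cX Z KZ; rewrite L2dotDl.
by rewrite (le_trans (lerD (h1 a b cX Z KZ) (h2 a b cX Z KZ)))// addr0.
Qed.

Lemma in_NZ X t W : 0 <= t -> in_N X W -> in_N X (t *: W).
Proof.
move=> t0 h a b cX Z KZ; rewrite L2dotZl.
by rewrite mulr_ge0_le0// h.
Qed.

Lemma polarK_cst xi c : polarK xi -> L2dot xi (c *: L2one R) = 0.
Proof.
move=> p; apply: le_anti; rewrite (p _ (K_cst c))/=.
by have := p _ (K_cst (- c)); rewrite !L2dotZr mulNr oppr_le0.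
Qed.

Lemma polarK_step01 xi m : polarK xi -> m = 0 \/ m = 1 -> L2dot xi (L2step m) = 0.
Proof.
move=> p [->|->]; rewrite L2dotC.
  rewrite (@L2dot_aeq _ _ (1 *: L2one R)); first by rewrite L2dotC polarK_cst.
  by apply: L2_eq_on => x /andP[x0 _]; rewrite L2stepE (ltW x0) L2_applyZ L2oneE mulr1.
rewrite (@L2dot_aeq _ _ 0); first by rewrite L2dot0l.
by apply: L2_eq_on => x /andP[_ x1]; rewrite L2stepE leNgt x1.
Qed.

Lemma L2norm_le_on U V : (forall x : R, 0 < x < 1 -> `|U x| <= `|V x|) ->
  L2norm U <= L2norm V.
Proof.
move=> h; apply: L2norm_dot_le; apply: L2dot_le_on => x /h.
rewrite -!expr2 -[U x ^+ 2]real_normK ?num_real// -[V x ^+ 2]real_normK ?num_real//.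
by rewrite ler_sqr ?nnegrE.
Qed.

(** As [K] is a cone, [Z + Y] and 0 are admissible competitors. *)
Lemma subdiffK_polar Y xi : K Y -> subdiffK Y xi -> polarK xi /\ L2dot xi Y = 0.
Proof.
move=> KY h; have p : polarK xi.
  by move=> Z KZ; have := h _ (KD KZ KY); rewrite addrK.
split => //; apply: le_anti; rewrite (p _ KY)/=.
by have := h _ (@K0 R); rewrite sub0r L2dotNr oppr_le0.
Qed.

Lemma dist_indicator_le (c : bool) (q : R) : 0 <= q -> q <= 1 ->
  `|(if c then 1 else 0) - q| <= 1.
Proof. by move=> q0 q1; rewrite ler_norml; case: c; apply/andP; split; lra. Qed.

(** If [m] is outside [OmegaX Y], then [Y] increases across every neighbourhood of [m]. Clamping [Y]
    between its values at [m - d] and [m + d] and rescaling gives [phi], which is orthogonal to [xi]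
    by [K_clamp] and tends to the step at [m]. *)
Lemma subdiffK_in_S Y xi : K Y -> subdiffK Y xi -> in_S Y xi.
Proof.
move=> KY /(subdiffK_polar KY)[p xiY]; split => // m m0 m1 nm.
have [mE|m0'] := eqVneq m 0; first by apply: polarK_step01 => //; left.
have [mE|m1'] := eqVneq m 1; first by apply: polarK_step01 => //; right.
have {m0 m0'}m0 : 0 < m by rewrite lt_neqAle eq_sym m0'.
have {m1 m1'}m1 : m < 1 by rewrite lt_neqAle m1'.
suff : `|L2dot xi (L2step m)| <= 0 by rewrite normr_le0 => /eqP.
(* Halving keeps [m - d] and [m + d] strictly inside Omega. *)
pose e0 := Num.min (Num.min m (1 - m)) 1 / 2.
have h0 : 0 < Num.min (Num.min m (1 - m)) 1 by rewrite !lt_min m0 ltr01 subr_gt0 m1.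
have h1 : Num.min (Num.min m (1 - m)) 1 <= m by rewrite !ge_min lexx.
have h2 : Num.min (Num.min m (1 - m)) 1 <= 1 - m by rewrite !ge_min lexx orbT.
have h3 : Num.min (Num.min m (1 - m)) 1 <= 1 by rewrite !ge_min lexx orbT.
have n0 := L2norm_ge0 xi.
apply: (@le0_of_small _ _ (2 * L2norm xi) e0); rewrite /e0; [lra|lra|].
move: (Num.min (Num.min m (1 - m)) 1) h0 h1 h2 h3 => k h0 h1 h2 h3 e ep ek.
have e2 : e ^+ 2 <= e by rewrite expr2; nra.
have e20 : 0 < e ^+ 2 by rewrite exprn_gt0.
(* [phi] and the step differ by at most 1 on an interval of length [2 * d], hence by at most [2 * e]
   in norm when [d = e ^+ 2]. *)
have [d dE] : exists d, d = e ^+ 2 by exists (e ^+ 2).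
rewrite -dE in e2 e20.
have md1 : m - d < 1 by lra.
have md0 : 0 < m + d by lra.
have Yab x : m - d <= x -> x <= m + d -> Y (m - d) <= Y x <= Y (m + d).
  by move=> ax xb; apply/andP; split; apply: (K_le KY); lra.
have pq : Y (m - d) < Y (m + d).
  rewrite ltNge; apply/negP => qp; apply: nm; apply/OmegaXP.
  exists (m - d), (m + d); split; [lra|lra|lra|lra|].
  have Yc x : m - d < x < m + d -> Y x = Y (m - d).
    move=> /andP[/ltW xa /ltW xb]; have /andP[y1 y2] := Yab x xa xb.
    by apply: le_anti; rewrite y1 (le_trans y2).
  by move=> x y /Yc -> /Yc ->.
have [T [KT KYT TE]] := K_clamp (ltW pq) KY.
have xiT : L2dot xi T = 0.
  apply: le_anti; rewrite (p _ KT)/=.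
  by have := p _ KYT; rewrite L2dotBr xiY sub0r oppr_le0.
pose phi := (Y (m + d) - Y (m - d))^-1 *: (T - Y (m - d) *: L2one R).
have xiphi : L2dot xi phi = 0.
  by rewrite L2dotZr L2dotBr xiT polarK_cst// subrr mulr0.
have -> : L2dot xi (L2step m) = L2dot xi (L2step m - phi) by rewrite L2dotBr xiphi subr0.
apply: le_trans (L2_cauchy_schwarz_norm _ _) _.
rewrite [2 * _]mulrC -mulrA ler_wpM2l//.
apply: (@le_trans _ _ (L2norm (L2ind (m - d) (m + d)))); last first.
  rewrite -ler_sqr ?nnegrE ?L2norm_ge0 ?mulr_ge0 ?(ltW ep)//.
  apply: (le_trans (@L2norm_ind_le _ _ _ _)); first lra.
  by rewrite exprMn -dE; lra.
apply: L2norm_le_on => x /andP[x0 x1].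
have qp0 : 0 < Y (m + d) - Y (m - d) by rewrite subr_gt0.
have phiE : phi x = (T x - Y (m - d)) / (Y (m + d) - Y (m - d)).
  by rewrite L2_applyZ L2_subcE mulrC.
rewrite L2_applyD L2_applyN phiE TE L2indE L2stepE.
have [xa|ax] := ltP x (m - d).
  have Yx : Y x <= Y (m - d) by exact: (K_le KY x0 (ltW xa) md1).
  have xm : x < m by rewrite (lt_trans xa)// ltrBlDr ltrDl.
  rewrite [Num.min _ _]min_r; last by rewrite (le_trans Yx)// ltW.
  rewrite max_l// subrr mul0r subr0 ifF; last by rewrite leNgt xm.
  by rewrite normr0.
have [bx|xb] := leP (m + d) x.
  have Yx : Y (m + d) <= Y x by exact: (K_le KY md0 bx x1).
  have mx : m <= x by rewrite (le_trans _ bx)// lerDl ltW.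
  rewrite [Num.min _ _]min_l// max_r ?(ltW pq)// divff ?gt_eqF// mx.
  by rewrite subrr normr0.
have /andP[Yx1 Yx2] := Yab x ax (ltW xb).
rewrite [Num.min _ _]min_r// max_r//= normr1.
have q0 : 0 <= (Y x - Y (m - d)) / (Y (m + d) - Y (m - d)) by rewrite divr_ge0 ?subr_ge0// ltW.
have q1 : (Y x - Y (m - d)) / (Y (m + d) - Y (m - d)) <= 1.
  by rewrite ler_pdivrMr// mul1r lerD2r.
exact: dist_indicator_le.
Qed.

(** [Z] on the interval, continued by its endpoint values and written with the steps at [a] and [b],
    which elements of [in_S] annihilate at the ends of a component. For [a = 0] or [b = 1] the
    endpoint value is taken outside Omega only. *)
Lemma K_extension Z (a b : R) : 0 <= a -> a < b -> b <= 1 -> K Z ->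
  K (Z a *: (L2one R - L2step a) + L2res `[a, b[ Z + Z b *: L2step b).
Proof.
move=> a0 ab b1 KZ; set T := (X in K X).
have TE (x : R) : T x = if x < a then Z a else if x < b then Z x else Z b.
  rewrite !L2_applyD !L2_applyZ L2_applyD L2_applyN L2oneE !L2stepE L2resE in_itv/=.
  have [ax|xa] := leP a x; last first.
    rewrite [b <= x]leNgt (lt_trans xa ab)/=.
    by rewrite subr0 mulr1 mulr0 !addr0.
  rewrite subrr mulr0 add0r /=.
  by have [bx|xb] := leP b x; rewrite ?mulr1 ?mulr0 ?addr0 ?add0r.
apply/KP; split=> [x y x0 xy y1|m e m0 m1 e0].
  rewrite !TE; have [xa|ax] := ltP x a; have [ya|ay] := ltP y a => //.
  - by have [yb|yb] := ltP y b; apply: (K_le KZ); lra.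
  - by have := lt_le_trans ya (le_trans ax xy); rewrite ltxx.
  have [xb|bx] := ltP x b; have [yb|yb] := ltP y b => //.
  - by apply: (K_le KZ); lra.
  - by apply: (K_le KZ); lra.
  - by have := lt_le_trans yb (le_trans bx xy); rewrite ltxx.
have [ma|am] := ltP m a.
  exists ((m + a) / 2); split; [lra|lra|rewrite !TE ma ifT; lra].
have [mb|bm] := ltP m b.
  have /KP[_ /(_ m e m0 m1 e0)[y [my y1 Zy]]] := KZ.
  have h1 : Num.min y ((m + b) / 2) <= y by rewrite ge_min lexx.
  have h2 : Num.min y ((m + b) / 2) <= (m + b) / 2 by rewrite ge_min lexx orbT.
  have h3 : m < Num.min y ((m + b) / 2) by rewrite lt_min my/=; lra.
  exists (Num.min y ((m + b) / 2)); move: (Num.min _ _) h1 h2 h3 => z h1 h2 h3.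
  split; [by []|lra|].
  rewrite !TE ifF; last by apply/negbTE; rewrite -leNgt; lra.
  rewrite ifT; last lra.
  rewrite ifF; last by apply/negbTE; rewrite -leNgt; lra.
  by rewrite mb; apply: le_trans Zy; apply: (K_le KZ); lra.
exists ((m + 1) / 2); split; [lra|lra|].
rewrite !TE ifF; last by apply/negbTE; rewrite -leNgt; lra.
rewrite ifF; last by apply/negbTE; rewrite -leNgt; lra.
rewrite ifF; last by apply/negbTE; rewrite -leNgt; lra.
rewrite ifF; last by apply/negbTE; rewrite -leNgt; lra.
by rewrite lerDl ltW.
Qed.

(** Constants and the steps at [a] and [b] are annihilated, so the continuation and the mean both
    drop out of the pairing. *)
Lemma in_S_in_N X xi : in_S X xi -> in_N X xi.
Proof.
move=> [p h] a b [a0 ab b1 fl [na nb]] Z KZ.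
have sa : L2dot xi (L2step a) = 0 by apply: h => //; lra.
have sb : L2dot xi (L2step b) = 0 by apply: h => //; lra.
have := p _ (K_extension a0 ab b1 KZ).
rewrite !L2dotDr !L2dotZr L2dotBr sa sb subr0.
have -> : L2dot xi (L2one R) = 0 by rewrite -(scale1r (L2one R)) polarK_cst.
rewrite !mulr0 add0r addr0 => resZ.
rewrite /fluct L2resB L2resZ L2dotBr L2dotZr -/(L2ind a b) L2ind_step ?(ltW ab)//.
by rewrite L2dotBr sa sb subrr mulr0 subr0.
Qed.

Lemma HX_step X m : ~ OmegaX X m -> HX X (L2step m).
Proof.
move=> nm; apply/HXP => a b a0 ab b1 hab; apply: flat_const_on => // x y xab yab.
have mab : ~ (a < m < b) by move=> mab; apply/nm/hab; rewrite /= in_itv.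
move/andP: xab => [ax xb]; move/andP: yab => [ay yb].
rewrite !L2stepE; case: leP => mx; case: leP => my //.
  by case: mab; apply/andP; split; lra.
by case: mab; apply/andP; split; lra.
Qed.

Lemma in_N_HX X U : HX X U -> in_N X U.
Proof.
move=> /HXP h a b [a0 ab b1 fl _] Z KZ.
by rewrite L2dotC fluct_const//; apply: h => //; exact: flat_OmegaX.
Qed.

(** The part of the force off [HX X] is polar to [K], by sticking at [Y = 0], and orthogonal to the
    steps that jump outside [OmegaX X], since these lie in [HX X]; so it is in [in_S X]. The
    projected part is constant on components. *)
Lemma in_N_force (F : L2 R -> L2 R) X : force_sticking F -> K X -> in_N X (F X).
Proof.
move=> stk KX.
have [HP orth] := orthogonal_projectionP X (F X).
rewrite -(subrK (orthogonal_projection (HX X) (F X)) (F X)).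
apply: in_ND; last exact: in_N_HX.
apply: in_S_in_N; split=> [|m m0 m1 nm]; last by apply: orth; exact: HX_step.
have := stk X 0 KX (@K0 R) (@HX0 R X) => h Z /h.
by rewrite subr0.
Qed.

(** Testing the projection inequality with [Z1] averaged over a component of [Z0] bounds the squared
    norm of the fluctuation of [Z1] by [tau * L2dot W (fluct a b Z1)], which is nonpositive.
    Conversely, on a component of [Z1] the residual pairs nonpositively with fluctuations and [Z1]
    pairs to zero; as [Z0] pairs nonnegatively by Chebyshev, [W] pairs nonpositively. *)
Lemma sticky_step Z0 W tau Z1 : K Z0 -> in_N Z0 W -> 0 < tau -> K Z1 ->
  subdiffK Z1 (Z0 + tau *: W - Z1) ->
  [/\ OmegaX Z0 `<=` OmegaX Z1, in_S Z1 (Z0 + tau *: W - Z1) & in_N Z1 W].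
Proof.
move=> K0' N0 tau0 K1 sub.
have S1 := subdiffK_in_S K1 sub.
split => //.
  move=> m /(OmegaX_component K0')[a [b [cX mab]]].
  have [a0 ab b1 fl _] := cX.
  have := sub _ (fluct_sub_K a0 ab b1 K1).
  rewrite (_ : Z1 - fluct a b Z1 - Z1 = - fluct a b Z1); last by rewrite addrAC subrr add0r.
  rewrite L2dotNr oppr_le0 L2dotBl L2dotDl L2dotZl.
  have -> : L2dot Z0 (fluct a b Z1) = 0.
    by rewrite L2dotC fluct_const//; exact: flat_const_on.
  rewrite add0r [L2dot Z1 _]L2dotC fluct_dot_self// => h.
  have WD := N0 a b cX Z1 K1.
  have D0 : L2norm (fluct a b Z1) = 0.
    apply/eqP; rewrite -sqrf_eq0 eq_le sqr_ge0 andbT.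
    have : tau * L2dot W (fluct a b Z1) <= 0 by rewrite mulr_ge0_le0// ltW.
    by move: h; rewrite subr_ge0 => /le_trans h /h.
  have mab' : `]a, b[%classic m by rewrite /= in_itv.
  apply: (flat_OmegaX a0 b1 _ mab').
  (* The vanishing norm gives flatness almost everywhere only; [flat_closed] makes it pointwise. *)
  apply: (flat_closed K1) => // e e0; exists (Z1 - fluct a b Z1); split.
    exact: fluct_sub_flat.
  by rewrite subKr D0 ltW.
move=> a b cX Z KZ; have [a0 ab b1 fl _] := cX.
have h1 := in_S_in_N S1 cX KZ.
have h2 := fluct_dot_ge0 a0 ab b1 K0' KZ.
have h3 : L2dot Z1 (fluct a b Z) = 0.
  by rewrite L2dotC fluct_const//; exact: flat_const_on.
move: h1; rewrite L2dotBl h3 subr0 L2dotDl L2dotZl => h1.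
have : tau * L2dot W (fluct a b Z) <= 0 by lra.
by rewrite pmulr_rle0.
Qed.

(** By [flat_closed], if [m] is outside [OmegaX Y] and [Y'] is close to [Y], then [Y'] is not flat
    near [m], so some [m'] near [m] is outside [OmegaX Y']. The step at [m] is then close to the
    step at [m'], which [xi'] annihilates. *)
Lemma in_S_closed Y xi : K Y ->
  (forall d, 0 < d -> exists Y' xi', [/\ in_S Y' xi', L2norm (Y - Y') <= d &
    L2norm (xi - xi') <= d]) -> in_S Y xi.
Proof.
move=> KY h.
have p : polarK xi.
  move=> Z KZ; apply: (@le0_of_small _ _ (L2norm Z) 1) => // [|d d0 _]; first exact: L2norm_ge0.
  have [Y' [xi' [[p' _] _ xid]]] := h d d0.
  rewrite -(subrK xi' xi) L2dotDl.
  have := p' Z KZ; have := L2_cauchy_schwarz (xi - xi') Z.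
  have := ler_wpM2r (L2norm_ge0 Z) xid; lra.
split => // m m0 m1 nm.
have [mE|m0'] := eqVneq m 0; first by apply: polarK_step01 => //; left.
have [mE|m1'] := eqVneq m 1; first by apply: polarK_step01 => //; right.
have {m0 m0'}m0 : 0 < m by rewrite lt_neqAle eq_sym m0'.
have {m1 m1'}m1 : m < 1 by rewrite lt_neqAle m1'.
suff : `|L2dot xi (L2step m)| <= 0 by rewrite normr_le0 => /eqP.
pose k := Num.min (Num.min m (1 - m)) 1.
have h0 : 0 < k by rewrite !lt_min m0 ltr01 subr_gt0 m1.
have h1 : k <= m by rewrite !ge_min lexx.
have h2 : k <= 1 - m by rewrite !ge_min lexx orbT.
have h3 : k <= 1 by rewrite !ge_min lexx orbT.
have n0 := L2norm_ge0 xi.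
apply: (@le0_of_small _ _ (L2norm xi + 2) k) => //; [lra|].
move: k h0 h1 h2 h3 => k h0 h1 h2 h3 e ep ek.
have e2 : e ^+ 2 <= e by rewrite expr2; nra.
have e20 : 0 < e ^+ 2 by rewrite exprn_gt0.
have nfl : ~ flat Y (m - e ^+ 2) (m + e ^+ 2).
  by move=> fl; apply: nm; apply/OmegaXP; exists (m - e ^+ 2), (m + e ^+ 2); split; [lra|lra|lra|lra|].
have [d d0 dP] : exists2 d, 0 < d & forall Z, L2norm (Y - Z) <= d -> ~ flat Z (m - e ^+ 2) (m + e ^+ 2).
  apply: contrapT => nd; apply: nfl; apply: (flat_closed KY); [lra|lra|] => d d0.
  apply: contrapT => nd'; apply: nd; exists d => // Z YZ flZ; apply: nd'.
  by exists Z.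
have [Y' [xi' [[p' S'] YY' xixi']]] := h (Num.min d e) ltac:(by rewrite lt_min d0).
have {}YY' : L2norm (Y - Y') <= d by rewrite (le_trans YY')// ge_min lexx.
have {}xixi' : L2norm (xi - xi') <= e by rewrite (le_trans xixi')// ge_min lexx orbT.
have [m' mm' nm'] : exists2 m', m - e ^+ 2 < m' < m + e ^+ 2 & ~ OmegaX Y' m'.
  apply: contrapT => H; apply: (dP Y' YY'); apply: OmegaX_flat => x; rewrite /= in_itv/= => xP.
  by apply: contrapT => nx; apply: H; exists x.
have s0 : L2dot xi' (L2step m') = 0.
  by case/andP: mm' => ? ?; apply: S' => //; lra.
have close : L2norm (L2step m - L2step m') <= e.
  apply: L2norm_step_close; first exact: ltW.
  by case/andP: mm' => ? ?; rewrite ler_norml; apply/andP; split; lra.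
have one : L2norm (L2step m) <= 1.
  rewrite -(@L2norm_one R); apply: L2norm_le => x; rewrite L2oneE L2stepE normr1.
  by case: ifP; rewrite ?normr1 ?normr0.
have -> : L2dot xi (L2step m) = L2dot (xi - xi') (L2step m) + L2dot xi' (L2step m - L2step m').
  by rewrite L2dotBl L2dotBr s0; lra.
apply: le_trans (ler_normD _ _) _.
have c1 := L2_cauchy_schwarz_norm (xi - xi') (L2step m).
have c2 := L2_cauchy_schwarz_norm xi' (L2step m - L2step m').
have c3 : L2norm xi' <= L2norm xi + e.
  by have := L2normD (xi' - xi) xi; rewrite subrK [L2norm (xi' - xi)]L2normB; lra.
have c4 : L2norm (xi - xi') * L2norm (L2step m) <= e * 1 by rewrite ler_pM ?L2norm_ge0.
have c5 : L2norm xi' * L2norm (L2step m - L2step m') <= (L2norm xi + e) * e by rewrite ler_pM ?L2norm_ge0.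
have c6 : e * e <= e by rewrite -expr2.
by move: c1 c2 c4 c5; rewrite mulr1 !mulrDl; lra.
Qed.

End normal_cones.

(** * Real induction and differential inequalities almost everywhere *)

Section real_induction.
Context (R : realType).
Local Notation leb := (@lebesgue_measure R).

(** The supremum of the points where [phi <= phi s] inherits this bound by the second hypothesis,
    and by the first it cannot lie below [t]. *)
Lemma local_nonincreasing (phi : R -> R) (s t : R) : s <= t ->
  (forall x, s <= x -> x < t -> exists2 d, 0 < d &
    forall h, 0 < h -> h < d -> phi (x + h) <= phi x) ->
  (forall x, s <= x -> x <= t -> forall e, 0 < e -> exists2 d, 0 < d &
    forall y, s <= y -> y <= x -> x - d < y -> phi x <= phi y + e) ->
  phi t <= phi s.
Proof.
move=> st hr hl.
pose S := [set x : R | s <= x <= t /\ phi x <= phi s].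
have Ss : S s by split; [rewrite lexx st|].
have sS : has_sup S by split; [exists s|exists t => x [/andP[]]].
pose c := sup S.
have sc : s <= c by apply: ub_le_sup => //; case: sS.
have ct : c <= t by apply: ge_sup => [|x [/andP[]]//]; case: sS.
have Sc : phi c <= phi s.
  apply/ler_addgt0Pr => e e0.
  have [d d0 hd] := hl c sc ct e e0.
  have [y [/andP[sy yt] py] cy] := sup_adherent d0 sS.
  have yc : y <= c by apply: ub_le_sup; [case: sS|split => //; rewrite sy].
  by apply: le_trans (hd y sy yc cy) _; rewrite lerD2r.
have [tc|ct'] := leP t c.
  by have -> : t = c by apply: le_anti; rewrite tc ct.
have [d d0 hd] := hr c sc ct'.
pose h := Num.min (d / 2) (t - c).
have h0 : 0 < h by rewrite lt_min divr_gt0//= subr_gt0.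
have h1 : h <= d / 2 by rewrite ge_min lexx.
have h2 : h <= t - c by rewrite ge_min lexx orbT.
have hdh : h < d by lra.
have : c + h <= c.
  apply: ub_le_sup; first by case: sS.
  split; first by apply/andP; split; lra.
  exact: le_trans (hd h h0 hdh) Sc.
by lra.
Qed.

(** Cover the exceptional null set by an open [U] of measure at most [eps]. Outside [U] the bound on
    right difference quotients applies; inside [U] the Lipschitz bound is compensated by [C * g],
    where [g x] is the measure of [U] in [[s, x]] and grows there at unit rate. *)
Lemma lipschitz_ae_le (f : R -> R) (s t L M : R) : s <= t -> 0 <= L ->
  (forall x y : R, s <= x <= t -> s <= y <= t -> `|f x - f y| <= L * `|x - y|) ->
  {ae leb, forall x : R, s < x < t -> forall e, 0 < e -> exists2 d, 0 < d &
     forall h, 0 < h -> h < d -> f (x + h) - f x <= (M + e) * h} ->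
  f t - f s <= M * (t - s).
Proof.
move=> st L0 lip.
set P := (P in {ae leb, forall x, P x}) => aeP.
(* The point [s] joins the null set because the hypothesis concerns [s < x] only. *)
have negN : leb.-negligible (~` [set x | P x] `|` [set s]).
  apply: negligibleU; first exact: aeP.
  by exists [set s]; split => //; exact: lebesgue_measure_set1.
pose C := L + `|M|.
have C0 : 0 <= C by rewrite addr_ge0.
suff key eps : 0 < eps -> eps <= 1 -> f t - f s - M * (t - s) <= (t - s + C) * eps.
  by rewrite -subr_le0; apply: (@le0_of_small _ _ (t - s + C) 1) => //; lra.
move=> eps0 eps1.
have [U [oU NU mU]] := outer_measure_open_le (~` [set x | P x] `|` [set s]) eps0.
move: mU; have /negligible_outer_measure -> := negN; rewrite add0e => mU.
pose g x := fine (leb (U `&` `[s, x])).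
have mUI (A : set R) : measurable A -> measurable (U `&` A).
  by move=> mA; apply: measurableI => //; exact: open_measurable.
have gfin A : measurable A -> leb (U `&` A) \is a fin_num.
  move=> mA; rewrite ge0_fin_numE//; apply: (@le_lt_trans _ _ (leb U)).
    apply: le_measure; rewrite ?inE//; [exact: mUI|exact: open_measurable].
  by apply: le_lt_trans mU _; rewrite ltry.
have split_g x y : s <= x -> x <= y -> g y = g x + fine (leb (U `&` `]x, y])).
  move=> sx xy; rewrite /g -fineD ?gfin//; congr fine.
  rewrite -measureU; [|exact: mUI|exact: mUI|].
    rewrite -setIUr; congr (leb (U `&` _)).
    by rewrite -itv_bndbnd_setU.
  rewrite setIACA setIid; apply/seteqP; split => // z [_ [/=]].
  by rewrite !in_itv/= => /andP[_ zx] /andP[]; rewrite ltNge zx.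
have g_mono x y : s <= x -> x <= y -> g x <= g y.
  by move=> sx xy; rewrite (split_g x y)// lerDl fine_ge0.
have g_lip x y : s <= x -> x <= y -> g y <= g x + (y - x).
  move=> sx xy; rewrite (split_g x y)// lerD2l -lee_fin fineK ?gfin//.
  apply: (@le_trans _ _ (leb `]x, y])).
    by apply: le_measure; rewrite ?inE//; exact: mUI.
  rewrite lebesgue_measure_itv/= lte_fin; case: ifP => _; first by rewrite -EFinB.
  by rewrite lee_fin subr_ge0.
have g_in x h : s <= x -> 0 < h -> `]x, x + h] `<=` U -> g (x + h) = g x + h.
  move=> sx h0 sub; rewrite (split_g x (x + h))//; last by rewrite lerDl ltW.
  rewrite setIidr// lebesgue_measure_itv/= lte_fin ltrDl h0 -EFinB/=; congr (_ + _); lra.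
have gt1 : g t <= eps.
  rewrite -lee_fin fineK ?gfin//; apply: le_trans mU.
  by apply: le_measure; rewrite ?inE//; [exact: mUI|exact: open_measurable].
have gs : g s = 0.
  suff z : leb (U `&` `[s, s]) = 0%E by exact: (congr1 fine z).
  apply/eqP; rewrite -measure_le0; apply: (@le_trans _ _ (leb [set s])).
    by rewrite set_itv1; apply: le_measure; rewrite ?inE//; exact: mUI.
  by have -> : leb [set s] = 0%E by exact: lebesgue_measure_set1.
pose phi x := f x - (M + eps) * (x - s) - C * g x.
have : phi t <= phi s.
  apply: local_nonincreasing => // [x sx xt|x sx xt e e0].
    have [Ux|nUx] := pselect (U x).
      have /nbhs_ballP[d /= d0 hd] : nbhs x U by exact: open_nbhs_nbhs.
      exists (Num.min d (t - x)) => [|h h0]; first by rewrite lt_min d0 subr_gt0.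
      rewrite lt_min => /andP[hd' ht].
      have gE : g (x + h) = g x + h.
        apply: g_in => // z; rewrite /= in_itv/= => /andP[xz zh].
        by apply: hd; rewrite /ball/= ltr_norml; apply/andP; split; lra.
      rewrite /phi gE.
      have := lip (x + h) x; rewrite addrAC subrr add0r (ger0_norm (ltW h0)).
      have -> : (s <= x + h <= t) = true by apply/andP; split; lra.
      have -> : (s <= x <= t) = true by apply/andP; split; lra.
      move=> /(_ isT isT) /(le_trans (ler_norm _)).
      have : - M <= `|M| by rewrite -normrN ler_norm.
      by rewrite /C; nra.
    have sx' : s < x.
      rewrite lt_neqAle sx andbT; apply/eqP => sxE; apply: nUx; apply: NU; right.
      by rewrite -sxE.
    have Px : P x by apply: contrapT => nP; apply: nUx; apply: NU; left.
    have [d d0 hd] := Px ltac:(by rewrite sx' xt) eps eps0.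
    exists d => // h h0 hh; have := hd h h0 hh.
    have : g x <= g (x + h) by apply: g_mono => //; rewrite lerDl ltW.
    rewrite /phi => g1 f1.
    have : C * g x <= C * g (x + h) by exact: ler_wpM2l.
    by move: f1; lra.
  have K0 : 0 < L + `|M + eps| + C + 1 by rewrite ltr_pwDr// !addr_ge0.
  exists (e / (L + `|M + eps| + C + 1)); first by rewrite divr_gt0.
  move=> y sy yx xy.
  have hd : (x - y) * (L + `|M + eps| + C + 1) <= e.
    by rewrite -ler_pdivlMr//; lra.
  have := lip x y; rewrite (ger0_norm (_ : 0 <= x - y)) ?subr_ge0//.
  have -> : (s <= x <= t) = true by apply/andP; split; lra.
  have -> : (s <= y <= t) = true by apply/andP; split; lra.
  move=> /(_ isT isT) /(le_trans (ler_norm _)) f1.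
  have g1 : g y <= g x by exact: g_mono.
  have g2 : C * g y <= C * g x by exact: ler_wpM2l.
  have m1 : - (M + eps) * (x - y) <= `|M + eps| * (x - y).
    by rewrite ler_wpM2r ?subr_ge0// -normrN ler_norm.
  have m2 : 0 <= C * (x - y) by rewrite mulr_ge0// subr_ge0.
  by rewrite /phi; move: hd f1 m1 m2; lra.
rewrite /phi gs subrr !mulr0 !subr0.
have : C * g t <= C * eps by exact: ler_wpM2l.
by lra.
Qed.

End real_induction.

(** Applied to [L2norm (f r - L2simple s r)] as a function of [r], which comes without a proof of
    measurability. *)
Lemma ge0_le_integral_nonmeasurable d (T : measurableType d) (R : realType)
    (m : {measure set T -> \bar R}) (D : set T) (f g : T -> \bar R) :
  (forall x, D x -> (0 <= f x)%E) -> (forall x, D x -> (f x <= g x)%E) ->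
  (\int[m]_(x in D) f x <= \int[m]_(x in D) g x)%E.
Proof.
move=> f0 fg; rewrite !ge0_integralE//; last by move=> x Dx; rewrite (le_trans (f0 x Dx)) ?fg.
apply: ereal_sup_le => _ [h /= hf <-]; exists h => // x; apply: le_trans (hf x) _.
by rewrite !patchE; case: ifPn => // /set_mem; exact: fg.
Qed.

Lemma cvg_inv_squeeze (R : realType) (a : nat -> R) (C : R) :
  (forall n, 0 <= a n <= C * n.+1%:R^-1) -> a @ \oo --> (0 : R).
Proof.
move=> h; apply: (@squeeze_cvgr _ _ _ _ (fun=> 0) (fun n => C * n.+1%:R^-1)).
- exact: nearW.
- exact: cvg_cst.
- rewrite -[X in _ --> X](mulr0 C); apply: cvgMr; exact: cvg_harmonic.
Qed.

(** * Bochner integrals of Lipschitz curves *)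

Section bochner.
Context (R : realType).
Local Notation leb := (@lebesgue_measure R).
Implicit Types (U V I : L2 R).

Definition simple_on (D : set R) (s : seq (set R * L2 R)) := forall p, p \in s ->
  [/\ measurable (p.1 : set (measurableTypeR R)), p.1 `<=` D & (leb p.1 < +oo)%E].

Lemma L2simple_dot (D : set R) s V : measurable (D : set (measurableTypeR R)) -> simple_on D s ->
  leb.-integrable D (EFin \o (fun r => L2dot (L2simple s r) V)) /\
  \int[leb]_(r in D) L2dot (L2simple s r) V = L2dot (L2simple_integral s) V.
Proof.
move=> mD; elim: s => [|[A u] s IH] hs.
  have E r : L2dot (L2simple [::] r) V = 0 by rewrite /L2simple big_nil L2dot0l.
  split.
    by apply: (eq_integrable mD (cst 0%E)) => [r _|]; [rewrite /= E|exact: integrable0].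
  rewrite /L2simple_integral big_nil L2dot0l.
  rewrite (@eq_Rintegral _ _ _ leb D (fun=> 0)) => [|r _]; last exact: E.
  by rewrite Rintegral_cst// mul0r.
have [mA AD Afin] := hs (A, u) (mem_head _ _).
have [iS eS] := IH (fun p ps => hs p (mem_behead (s := _ :: _) ps)).
have E r : L2dot (L2simple ((A, u) :: s) r) V =
    L2dot u V * \1_A r + L2dot (L2simple s r) V.
  by rewrite /L2simple big_cons L2dotDl L2dotZl mulrC.
have iA : leb.-integrable D (EFin \o (fun r => \1_A r : R)).
  apply/integrableP; split; first by apply/measurable_EFinP; exact: measurable_indic.
  have -> : (\int[leb]_(r in D) `|(EFin \o (fun r => \1_A r : R)) r|)%E = leb A.
    rewrite -[X in leb X](setIidl AD) -integral_indic//.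
    by apply: eq_integral => r _; rewrite gee0_abs ?lee_fin.
  exact: Afin.
have iuA : leb.-integrable D (EFin \o (fun r => L2dot u V * \1_A r)).
  apply: (eq_integrable mD _ _ _ (integrableZl mD (L2dot u V) iA)) => r _.
  by rewrite /= EFinM.
split.
  apply: (eq_integrable mD _ _ _ (integrableD mD iuA iS)) => r _.
  by rewrite /= E EFinD.
rewrite (@eq_Rintegral _ _ _ leb D (fun r => L2dot u V * \1_A r + L2dot (L2simple s r) V)) => [|r _]; last exact: E.
rewrite RintegralD// eS RintegralZl// /L2simple_integral big_cons L2dotDl L2dotZl /=.
congr (_ + _); rewrite mulrC; congr (_ * _).
by rewrite /Rintegral integral_indic// setIidl.
Qed.

Lemma lebesgue_measure_cc (a b : R) : a <= b ->
  lebesgue_measure (`[a, b]%classic : set R) = (b - a)%:E.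
Proof.
rewrite lebesgue_measure_itv/= lte_fin le_eqVlt => /predU1P[->|->]; last by rewrite EFinB.
by rewrite ltxx subrr.
Qed.

Lemma lebesgue_measure_cc_lty (a b : R) :
  (lebesgue_measure (`[a, b]%classic : set R) < +oo)%E.
Proof.
by rewrite lebesgue_measure_itv/= lte_fin; case: ifP => _; rewrite ?ltry// -EFinB ltry.
Qed.

Section lipschitz.
Context (f : R -> L2 R) (t l : R).

Definition lipschitz_to := 0 <= t /\ 0 <= l /\
  forall r r' : R, 0 <= r <= t -> 0 <= r' <= t -> L2norm (f r - f r') <= l * `|r - r'|.

Lemma lipschitz_dot_integrable V : lipschitz_to ->
  leb.-integrable `[0, t] (EFin \o (fun r => L2dot (f r) V)).
Proof.
move=> [t0 [l0 lip]].
(* Clamping the time extends the curve to the whole line as a Lipschitz, hence continuous, curve. *)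
pose c (r : R) := Num.max 0 (Num.min t r).
have cP r : 0 <= c r <= t by rewrite /c le_max lexx/= ge_max t0 ge_min lexx.
have cid r : 0 <= r <= t -> c r = r by move=> /andP[r0 rt]; rewrite /c min_r// max_r.
have clip r r' : `|c r - c r'| <= `|r - r'|.
  wlog rr : r r' / r <= r' => [H|].
    by have [/H//|/ltW/H] := leP r r'; rewrite distrC [`|r' - _|]distrC.
  rewrite [leRHS]distrC [leRHS]ger0_norm ?subr_ge0// /c.
  by case: (clampP r t0) => -[h1 ->]; case: (clampP r' t0) => -[h2 ->];
    rewrite ler_norml; apply/andP; split; lra.
pose g r := L2dot (f (c r)) V.
have glip r r' : `|g r - g r'| <= (l * L2norm V) * `|r - r'|.
  rewrite /g -L2dotBl; apply: le_trans (L2_cauchy_schwarz_norm _ _) _.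
  rewrite mulrAC ler_wpM2r ?L2norm_ge0// (le_trans (lip _ _ (cP r) (cP r')))//.
  by rewrite ler_wpM2l.
have k0 : 0 <= l * L2norm V by rewrite mulr_ge0// L2norm_ge0.
have gc : continuous g.
  move=> x; apply/cvgrPdist_le => e e0; near=> y.
  apply: le_trans (glip _ _) _.
  have : `|x - y| <= e / (l * L2norm V + 1).
    by near: y; apply: cvgr_dist_le; [exact: cvg_id|rewrite divr_gt0// ltr_pwDr].
  rewrite ler_pdivlMr ?ltr_pwDr// mulrDr mulr1 mulrC; apply: le_trans.
  by rewrite lerDl.
have mD : measurable (`[0, t]%classic : set (measurableTypeR R)) by exact: measurable_itv.
apply: (eq_integrable mD (EFin \o g)).
  by move=> r; rewrite inE/= in_itv/= => rt; rewrite /g cid.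
apply: (measurable_bounded_integrable mD).
- exact: lebesgue_measure_cc_lty.
- by apply: measurable_funS (continuous_measurable_fun gc).
- exists (`|g 0| + l * L2norm V * t); split; first exact: num_real.
  move=> M hM r /=; rewrite in_itv/= => /andP[r0 rt].
  apply: le_trans (ltW hM); have := glip r 0; rewrite subr0 (ger0_norm r0) => h1.
  have h2 : l * L2norm V * r <= l * L2norm V * t by exact: ler_wpM2l.
  have := ler_normD (g r - g 0) (g 0); rewrite subrK; lra.
Unshelve. all: by end_near. Qed.

(** This weak form reduces the later estimates of the integral to real integrals. *)
Lemma bochner_dot I V : lipschitz_to -> is_bochner_integral `[0, t]%classic f I ->
  L2dot I V = \int[leb]_(r in `[0, t]) L2dot (f r) V.
Proof.
move=> lt [s [hs _ int0 lim0]].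
have iF := lipschitz_dot_integrable V lt.
have mD : measurable (`[0, t]%classic : set (measurableTypeR R)) by exact: measurable_itv.
have V0 := L2norm_ge0 V.
apply/eqP; rewrite -subr_eq0 -normr_le0.
apply: (@le0_of_small _ _ (2 * L2norm V + 1) 1) => // [|e e0 _]; first lra.
have /fine_cvgP[finN /cvgrPdist_le /(_ e e0) cvN] := int0.
move/cvgrPdist_le : lim0 => /(_ e e0) lim0.
have [n [fin_n int_n lim_n]] : exists n, [/\
    (\int[leb]_(r in `[0%R, t]) (L2norm (f r - L2simple (s n) r))%:E)%E \is a fin_num,
    (\int[leb]_(r in `[0%R, t]) (L2norm (f r - L2simple (s n) r))%:E <= e%:E)%E &
    L2norm (L2simple_integral (s n) - I) <= e].
  near \oo => n; exists n.
  have fin_n : (\int[leb]_(r in `[0%R, t]) (L2norm (f r - L2simple (s n) r))%:E)%E \is a fin_num by near: n.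
  split => //.
    rewrite -(fineK fin_n) lee_fin; apply: le_trans (ler_norm _) _.
    by rewrite -normrN -sub0r; near: n.
  by apply: le_trans (ler_norm _) _; rewrite -normrN -sub0r; near: n.
have [iS eS] := L2simple_dot V mD (hs n).
rewrite -[L2dot I V](subrK (L2dot (L2simple_integral (s n)) V)) -addrA.
apply: le_trans (ler_normD _ _) _.
have h1 : `|L2dot I V - L2dot (L2simple_integral (s n)) V| <= e * L2norm V.
  rewrite -L2dotBl; apply: le_trans (L2_cauchy_schwarz_norm _ _) _.
  by rewrite ler_wpM2r// L2normB.
suff h2 : `|L2dot (L2simple_integral (s n)) V - \int[leb]_(r in `[0, t]) L2dot (f r) V|
   <= e * (L2norm V + 1).
  by move: h1 h2; move: `|_| => p; move: `|_| => q; lra.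
rewrite -eS -RintegralB//.
have iD := integrableB mD iS iF.
apply: le_trans (le_normr_Rintegral _ _) _ => //.
set g := (fun r => `|L2dot (L2simple (s n) r) V - L2dot (f r) V|).
have V1 : 0 < L2norm V + 1 by lra.
rewrite -ler_pdivrMr// mulrC.
have iN : leb.-integrable `[0, t] (EFin \o g).
  have := integrable_abse iD; apply: eq_integrable => //.
rewrite -RintegralZl// -lee_fin.
have iZ : leb.-integrable `[0, t] (EFin \o (fun r => (L2norm V + 1)^-1 * g r)).
  apply: (eq_integrable mD _ _ _ (integrableZl mD (L2norm V + 1)^-1 iN)) => r _.
  by rewrite /= EFinM.
rewrite /Rintegral fineK; last exact: integrable_fin_num.
apply: le_trans int_n; apply: ge0_le_integral_nonmeasurable => r _.
  by rewrite lee_fin mulr_ge0// invr_ge0 ltW.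
rewrite lee_fin mulrC ler_pdivrMr// /g -L2dotBl.
apply: le_trans (L2_cauchy_schwarz_norm _ _) _.
by rewrite L2normB ler_wpM2l ?L2norm_ge0// lerDl.
Unshelve. all: by end_near. Qed.

(** The pieces are half-open, so the endpoint [t] is a separate piece of measure zero. *)
Definition riemann_step (n : nat) : seq (set R * L2 R) :=
  ([set t], f t) ::
  [seq (`[k%:R * (t / n.+1%:R), k.+1%:R * (t / n.+1%:R)[%classic, f (k%:R * (t / n.+1%:R)))
    | k <- iota 0 n.+1].

Lemma riemann_step_on n : 0 <= t -> simple_on `[0, t]%classic (riemann_step n).
Proof.
move=> t0; have h0 : 0 <= t / n.+1%:R by rewrite divr_ge0.
have hn : n.+1%:R * (t / n.+1%:R) = t by rewrite mulrCA mulfV ?mulr1// pnatr_eq0.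
move=> p; rewrite inE => /predU1P[->|/mapP[k]].
  split => //=; first by move=> x ->; rewrite /= in_itv/= t0 lexx.
  by have -> : leb [set t] = 0%E by exact: lebesgue_measure_set1.
rewrite mem_iota add0n => /andP[_ kn] ->; split => //=.
  move=> x; rewrite /= !in_itv/= => /andP[kx xk]; apply/andP; split.
    by apply: le_trans kx; rewrite mulr_ge0.
  by apply: le_trans (ltW xk) _; rewrite -[leRHS]hn ler_wpM2r// ler_nat.
apply: (@le_lt_trans _ _ (leb `[k%:R * (t / n.+1%:R), k.+1%:R * (t / n.+1%:R)]%classic)).
  by apply: le_measure; rewrite ?inE//; apply: subset_itvl; rewrite bnd_simp.
exact: lebesgue_measure_cc_lty.
Qed.

Lemma riemann_step_close n (r : R) : lipschitz_to -> 0 <= r <= t ->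
  L2norm (f r - L2simple (riemann_step n) r) <= l * t * n.+1%:R^-1.
Proof.
move=> [t0 [l0 lip]] /andP[r0 rt].
have hn : n.+1%:R * (t / n.+1%:R) = t by rewrite mulrCA mulfV ?mulr1// pnatr_eq0.
rewrite -mulrA; set h := t / n.+1%:R in hn *.
have n0 : 0 < n.+1%:R :> R by rewrite ltr0n.
have h0 : 0 <= h by rewrite -(pmulr_rge0 _ n0) hn.
suff [k [kr kt E]] : exists k : nat, [/\ `|r - k%:R * h| <= h, 0 <= k%:R * h <= t &
    L2simple (riemann_step n) r = f (k%:R * h)].
  rewrite E; apply: le_trans (lip _ _ _ kt) _; first by rewrite r0 rt.
  by rewrite ler_wpM2l.
have ind0 (k : nat) : ~ (k%:R * h <= r < k.+1%:R * h) ->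
    (\1_(`[k%:R * h, k.+1%:R * h[%classic) r : R) *: f (k%:R * h) = 0.
  move=> nk; rewrite indicE memNset ?scale0r//= in_itv/=; exact/negP.
have simpleE : L2simple (riemann_step n) r = (\1_[set t] r : R) *: f t +
    \sum_(k <- iota 0 n.+1) (\1_(`[k%:R * h, k.+1%:R * h[%classic) r : R) *: f (k%:R * h).
  by rewrite /L2simple /riemann_step big_cons big_map.
have [rtE|rt'] := eqVneq r t.
  exists n.+1; split.
  - by rewrite hn rtE subrr normr0.
  - by rewrite hn t0 lexx.
  rewrite simpleE hn rtE indicE mem_set// scale1r -rtE big1_seq ?addr0// => k /andP[_].
  rewrite mem_iota add0n => /andP[_ kn]; apply: ind0 => /andP[_].
  by rewrite ltNge rtE -{1}hn ler_wpM2r// ler_nat.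
have {rt' rt}rt : r < t by rewrite lt_neqAle rt'.
have {}h0 : 0 < h by rewrite -(pmulr_rgt0 _ n0) hn (le_lt_trans r0).
have /truncn_itv /andP[] : 0 <= r / h by rewrite divr_ge0// ltW.
move: (Num.truncn (r / h)) => k; rewrite ler_pdivlMr// ltr_pdivrMr// => kr rk.
have kn : (k < n.+1)%N by rewrite -(ltr_nat R) -(ltr_pM2r h0) hn (le_lt_trans kr).
exists k; split.
- by rewrite ger0_norm ?subr_ge0//; move: rk; rewrite -addn1 natrD mulrDl mul1r; lra.
- by rewrite mulr_ge0 ?(ltW h0)//= (le_trans kr)// ltW.
rewrite simpleE indicE memNset ?scale0r ?add0r; last by move=> /= re; move: rt; rewrite re ltxx.
rewrite (bigD1_seq k) ?iota_uniq ?mem_iota ?add0n//=.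
rewrite big1_seq ?addr0; last first.
  move=> j /andP[jk _]; apply: ind0 => /andP[jr rj].
  have [kj|jk'|jkE] := ltngtP k j.
  - have : k.+1%:R * h <= j%:R * h by rewrite ler_pM2r// ler_nat.
    by move=> /le_trans /(_ jr); rewrite leNgt rk.
  - have : j.+1%:R * h <= k%:R * h by rewrite ler_pM2r// ler_nat.
    by move=> /le_trans /(_ kr); rewrite leNgt rj.
  - by rewrite jkE eqxx in jk.
by rewrite indicE mem_set ?scale1r//= in_itv/= kr rk.
Qed.

(** The Riemann steps converge uniformly with error [C * n.+1%:R^-1]. Pairing the difference [V] of
    two of their integrals with [V] itself shows that the integrals are Cauchy. *)
Lemma bochner_exists : lipschitz_to -> exists I, is_bochner_integral `[0, t]%classic f I.
Proof.
move=> lt; have [t0 [l0 lip]] := lt.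
have mD : measurable (`[0, t]%classic : set (measurableTypeR R)) by exact: measurable_itv.
pose C := l * t.
have C0 : 0 <= C by rewrite mulr_ge0.
have inv0 n : 0 <= n.+1%:R^-1 :> R by rewrite invr_ge0.
have dist n m : L2norm (L2simple_integral (riemann_step n) - L2simple_integral (riemann_step m)) <=
    t * (C * n.+1%:R^-1 + C * m.+1%:R^-1).
  set V := _ - _; set c := _ + _.
  have c0 : 0 <= c by rewrite addr_ge0// mulr_ge0.
  have [in_ en] := L2simple_dot V mD (@riemann_step_on n t0).
  have [im em] := L2simple_dot V mD (@riemann_step_on m t0).
  have : L2norm V ^+ 2 <= t * c * L2norm V.
    rewrite L2norm_sqr {1}/V L2dotBl -en -em -RintegralB//.
    have -> : t * c * L2norm V = \int[leb]_(r in `[0, t]) (c * L2norm V).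
      rewrite Rintegral_cst//. have ->: fine (leb `[0, t]) = t by rewrite -[RHS](subr0 t) -[RHS]/(fine (t - 0)%:E) -(lebesgue_measure_cc t0).
      by rewrite [RHS]mulrC mulrA.
    apply: le_Rintegral => //.
    - exact: (integrableB mD in_ im).
    - apply: (measurable_bounded_integrable mD); first exact: lebesgue_measure_cc_lty.
        exact: measurable_cst.
      exact: bounded_cst.
    move=> r /=; rewrite in_itv/= => rt; rewrite -L2dotBl.
    apply: le_trans (L2_cauchy_schwarz _ _) _; rewrite ler_wpM2r ?L2norm_ge0//.
    apply: le_trans (L2norm_triangle (f r) _ _) _.
    by rewrite /c lerD ?riemann_step_close// L2normB riemann_step_close.
  have := L2norm_ge0 V; rewrite le_eqVlt => /predU1P[<- _|V0]; first by rewrite mulr_ge0.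
  by rewrite expr2 ler_pM2r.
have small (K : R) : 0 <= K -> forall e, 0 < e -> exists N : nat, forall n, (N <= n)%N -> K * n.+1%:R^-1 <= e.
  move=> K0 e e0.
  have /cvgrPdist_le /(_ e e0)[N _ HN] := @cvg_inv_squeeze R (fun n => K * n.+1%:R^-1) K
    (fun n => ltac:(by rewrite lexx mulr_ge0)).
  by exists N => n Nn; have := HN n Nn; rewrite /= sub0r normrN => /(le_trans (ler_norm _)).
have [I [cI _]] : exists I, L2norm (L2simple_integral (riemann_step n) - I) @[n --> \oo] --> (0 : R) /\
    exists phi : nat -> nat, {ae @muOmega R, forall x, L2simple_integral (riemann_step (phi k)) x @[k --> \oo] --> I x}.
  apply: L2_complete => e e0.
  have tC : 0 <= t * C by exact: mulr_ge0.
  have e20 : 0 < e / 2 by rewrite divr_gt0.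
  have [N HN] := small (t * C) tC (e / 2) e20; exists N => n m Nn Nm.
  apply: le_trans (dist n m) _; have := HN n Nn; have := HN m Nm.
  by move: (n.+1%:R^-1) (m.+1%:R^-1) => i j; lra.
exists I, riemann_step; split => //.
- by move=> n p pn; exact: (@riemann_step_on n t0 p pn).
- apply: aeW => r /=; rewrite in_itv/= => rt.
  apply: (@cvg_inv_squeeze _ _ C) => n.
  by rewrite L2norm_ge0/=; exact: riemann_step_close.
apply: (@squeeze_cvge _ _ _ _ (fun=> 0%E) _ (fun n => ((t * C) * n.+1%:R^-1)%:E)).
- apply: nearW => n; apply/andP; split; first by apply: integral_ge0 => r _; rewrite lee_fin L2norm_ge0.
  apply: (@le_trans _ _ (\int[leb]_(r in `[0%R, t]) (cst (C * n.+1%:R^-1)%:E) r)%E).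
    apply: ge0_le_integral_nonmeasurable => r; rewrite /= in_itv/= => rt; rewrite lee_fin ?L2norm_ge0//.
    exact: riemann_step_close.
  have E : leb `[0, t] = (t - 0)%:E := lebesgue_measure_cc t0.
  rewrite integral_cst//; apply: (@le_trans _ _ ((C * n.+1%:R^-1)%:E * (t - 0)%:E)%E).
    by rewrite -E.
  by rewrite subr0 -EFinM lee_fin mulrC mulrA.
- exact: cvg_cst.
- apply/cvg_EFin; first exact: nearW.
  by apply: (@cvg_inv_squeeze _ _ (t * C)) => n; rewrite /= lexx andbT !mulr_ge0.
Qed.

End lipschitz.

Lemma bochner_integralP (f : R -> L2 R) (t l : R) : lipschitz_to f t l ->
  is_bochner_integral `[0, t]%classic f (bochner_integral `[0, t]%classic f).
Proof. by move=> /bochner_exists; exact: xgetPex. Qed.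

(** Paired with itself, the defect [V] is an integral over []s, t]]; after Cauchy-Schwarz one factor
    [L2norm V] cancels. *)
Lemma bochner_increment (f : R -> L2 R) (s t l c : R) U : 0 <= s -> s <= t ->
  lipschitz_to f t l -> 0 <= c ->
  (forall r, s <= r <= t -> L2norm (f r - U) <= c) ->
  L2norm (bochner_integral `[0, t]%classic f - bochner_integral `[0, s]%classic f
    - (t - s) *: U) <= c * (t - s).
Proof.
move=> s0 st lt c0 hU; have [t0 [l0 lip]] := lt.
have ls : lipschitz_to f s l.
  split=> //; split=> // r r' /andP[r0 rs] /andP[r'0 r's].
  by apply: lip; rewrite ?r0 ?r'0 (le_trans _ st).
set It := bochner_integral _ _; set Is := bochner_integral _ _.
have VE W : L2dot (It - Is - (t - s) *: U) W =
    L2dot It W - L2dot Is W - (t - s) * L2dot U W.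
  by rewrite L2dotBl L2dotBl L2dotZl.
have hIt : is_bochner_integral `[0, t]%classic f It by exact: bochner_integralP lt.
have hIs : is_bochner_integral `[0, s]%classic f Is by exact: bochner_integralP ls.
set V := _ - _ - _.
have mD : measurable (`]s, t]%classic : set (measurableTypeR R)) by exact: measurable_itv.
have iF := lipschitz_dot_integrable V lt.
have iF' : leb.-integrable `]s, t] (EFin \o (fun r => L2dot (f r) V)).
  apply: (integrableS _ _ _ iF) => //.
  by apply: subset_itvr; rewrite bnd_simp.
have leb_st : leb `]s, t] = (t - s)%:E.
  rewrite -[RHS](lebesgue_measure_cc st) [LHS]lebesgue_measure_itv/=.
  by rewrite lebesgue_measure_itv/=.
have fE : fine (leb `]s, t]) = t - s by rewrite leb_st.
have icst (k : R) : leb.-integrable `]s, t] (EFin \o (fun=> k)).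
  apply: (measurable_bounded_integrable mD); first by have := ltry (t - s); rewrite -leb_st.
    exact: measurable_cst.
  exact: bounded_cst.
have : L2norm V ^+ 2 <= c * (t - s) * L2norm V.
  rewrite L2norm_sqr {1}/V VE (bochner_dot V lt hIt) (bochner_dot V ls hIs).
  rewrite Rintegral_itvB ?bnd_simp//.
  have -> : (t - s) * L2dot U V = \int[leb]_(r in `]s, t]) (L2dot U V).
    by rewrite Rintegral_cst// fE mulrC.
  rewrite -(RintegralB mD iF' (icst _)).
  have -> : c * (t - s) * L2norm V = \int[leb]_(r in `]s, t]) (c * L2norm V).
    by rewrite Rintegral_cst// fE mulrAC.
  apply: le_Rintegral => //; first exact: (integrableB mD iF' (icst _)).
  move=> r /=; rewrite in_itv/= => /andP[sr rt]; rewrite -L2dotBl.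
  apply: le_trans (L2_cauchy_schwarz _ _) _; rewrite ler_wpM2r ?L2norm_ge0//.
  by apply: hU; rewrite (ltW sr).
have ts0 : 0 <= t - s by rewrite subr_ge0.
have := L2norm_ge0 V; rewrite le_eqVlt => /predU1P[<- _|V0]; first by rewrite mulr_ge0.
by rewrite expr2 ler_pM2r.
Qed.

End bochner.

(** * The implicit scheme *)

Local Ltac nonneg := repeat first [exact: sqr_ge0 | assumption | (by apply: ltW)
  | apply: mulr_ge0 | apply: addr_ge0 | exact: ler0n].

(** [d], [e] are the errors of position and of [w] before a step, [d'], [e'] those after it. Young's
    inequality gives [(1 - x) * f' <= (1 + x) * f + 9 * B] with [x = tau * G <= 2^-1]; dividing by
    [1 - x] costs the factors 4 and 18. *)
Lemma gronwall_step (R : realFieldType) (A tau d e d' e' : R) :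
  0 <= A -> 0 < tau -> tau <= 1 -> 0 <= d -> 0 <= e -> 0 <= d' -> 0 <= e' ->
  tau * (2 * A ^+ 2 + A + 3) <= 2^-1 ->
  d' ^+ 2 <= d ^+ 2 + 2 * tau * e * d' + 2 * A * tau ^+ 2 * d' + 4 * A ^+ 2 * tau ^+ 2
    + 2 * A * tau ^+ 2 * e ->
  e' <= e + tau * A * d' + A * tau ^+ 2 ->
  d' ^+ 2 + e' ^+ 2 <= (1 + 4 * (2 * A ^+ 2 + A + 3) * tau) * (d ^+ 2 + e ^+ 2)
    + 18 * A ^+ 2 * tau ^+ 2.
Proof.
move=> A0 t0 t1 d0 e0 d'0 e'0 small hd he.
have tt : tau ^+ 2 <= tau by rewrite expr2 ler_piMl// ltW.
have tt0 : 0 <= tau ^+ 2 by rewrite sqr_ge0.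
have s1 : 2 * tau * e * d' <= tau * (e ^+ 2 + d' ^+ 2).
  rewrite -subr_ge0 (_ : _ - _ = tau * (e - d') ^+ 2); last by ring.
  by nonneg.
have s2 : 2 * A * tau ^+ 2 * d' <= A ^+ 2 * tau ^+ 2 + tau * d' ^+ 2.
  have : 2 * A * tau ^+ 2 * d' <= tau ^+ 2 * (A ^+ 2 + d' ^+ 2).
    rewrite -subr_ge0 (_ : _ - _ = tau ^+ 2 * (A - d') ^+ 2); last by ring.
    by nonneg.
  have : tau ^+ 2 * d' ^+ 2 <= tau * d' ^+ 2 by rewrite ler_wpM2r ?sqr_ge0.
  lra.
have s3 : 2 * A * tau ^+ 2 * e <= A ^+ 2 * tau ^+ 2 + tau * e ^+ 2.
  have : 2 * A * tau ^+ 2 * e <= tau ^+ 2 * (A ^+ 2 + e ^+ 2).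
    rewrite -subr_ge0 (_ : _ - _ = tau ^+ 2 * (A - e) ^+ 2); last by ring.
    by nonneg.
  have : tau ^+ 2 * e ^+ 2 <= tau * e ^+ 2 by rewrite ler_wpM2r ?sqr_ge0.
  lra.
have s4 : e' ^+ 2 <= (e + tau * A * d' + A * tau ^+ 2) ^+ 2.
  by rewrite ler_sqr ?nnegrE// (le_trans e'0).
have s5 : 2 * tau * A * e * d' <= tau * A * (e ^+ 2 + d' ^+ 2).
  rewrite -subr_ge0 (_ : _ - _ = tau * A * (e - d') ^+ 2); last by ring.
  by nonneg.
have s6 : (tau * A * d' + A * tau ^+ 2) ^+ 2 <= 2 * tau * A ^+ 2 * d' ^+ 2 + 2 * tau ^+ 2 * A ^+ 2.
  have h1 : (tau * A * d' + A * tau ^+ 2) ^+ 2 <=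
      tau ^+ 2 * (2 * A ^+ 2 * d' ^+ 2) + tau ^+ 2 * (2 * A ^+ 2 * tau ^+ 2).
    rewrite -subr_ge0 (_ : _ - _ = tau ^+ 2 * A ^+ 2 * (d' - tau) ^+ 2); last by ring.
    by nonneg.
  have h2 : tau ^+ 2 * (2 * A ^+ 2 * d' ^+ 2) <= tau * (2 * A ^+ 2 * d' ^+ 2).
    by rewrite ler_wpM2r//; nonneg.
  have h3 : tau ^+ 2 * (2 * A ^+ 2 * tau ^+ 2) <= tau ^+ 2 * (2 * A ^+ 2 * 1).
    apply: ler_wpM2l => //; apply: ler_wpM2l; [by nonneg|exact: le_trans tt t1].
  lra.
move: small; set G := 2 * A ^+ 2 + A + 3 => small.
have AA : 0 <= A ^+ 2 by rewrite sqr_ge0.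
(* The coefficient 9 collects 4 from the hypothesis, 1 from [s2], 2 from two uses of [s3] and 2 from
   [s6]. *)
have main : d' ^+ 2 + e' ^+ 2 <= (d ^+ 2 + e ^+ 2) + tau * G * (d ^+ 2 + e ^+ 2)
   + tau * G * (d' ^+ 2 + e' ^+ 2) + 9 * A ^+ 2 * tau ^+ 2.
  have p1 : 0 <= tau * G * d ^+ 2 by rewrite /G; nonneg.
  have p2 : 0 <= tau * G * e' ^+ 2 by rewrite /G; nonneg.
  have p3 : 0 <= tau * A ^+ 2 * e ^+ 2 by nonneg.
  have p4 : 0 <= tau * d' ^+ 2 by nonneg.
  have exp : (e + tau * A * d' + A * tau ^+ 2) ^+ 2 = e ^+ 2 + 2 * tau * A * e * d'
    + 2 * A * tau ^+ 2 * e + (tau * A * d' + A * tau ^+ 2) ^+ 2 by ring.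
  have q : tau * G * (d ^+ 2 + e ^+ 2) = tau * G * d ^+ 2
     + (2 * (tau * A ^+ 2 * e ^+ 2) + tau * A * e ^+ 2 + 3 * (tau * e ^+ 2)) by rewrite /G; ring.
  have q' : tau * G * (d' ^+ 2 + e' ^+ 2) = tau * G * e' ^+ 2
     + (2 * (tau * A ^+ 2 * d' ^+ 2) + tau * A * d' ^+ 2 + 3 * (tau * d' ^+ 2)) by rewrite /G; ring.
  rewrite q q'; rewrite exp in s4; lra.
have f0 : 0 <= d ^+ 2 + e ^+ 2 by rewrite addr_ge0 ?sqr_ge0.
have f'0 : 0 <= d' ^+ 2 + e' ^+ 2 by rewrite addr_ge0 ?sqr_ge0.
move: main f0 f'0; set f := d ^+ 2 + e ^+ 2; set f' := d' ^+ 2 + e' ^+ 2 => main f0 f'0.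
have x0 : 0 <= tau * G by rewrite /G; nonneg.
move: main small x0; rewrite -[4 * G * tau]mulrA [G * tau]mulrC; set x := tau * G => main small x0.
have B0 : 0 <= A ^+ 2 * tau ^+ 2 by rewrite mulr_ge0.
move: main B0; rewrite -![_ * A ^+ 2 * tau ^+ 2]mulrA; set B := A ^+ 2 * tau ^+ 2 => main B0.
have x1 : 0 < 1 - x by lra.
rewrite -(ler_pM2l x1).
have : (1 - x) * f' <= (1 + x) * f + 9 * B by lra.
move/le_trans; apply.
have c1 : 0 <= x * f * (1 - 2 * x) by apply: mulr_ge0; [nonneg|lra].
have c2 : 0 <= B * (1 - 2 * x) by apply: mulr_ge0; [nonneg|lra].
lra.
Qed.

Lemma gronwall (R : realType) (f : nat -> R) (q c : R) (n : nat) :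
  f 0%N <= 0 -> 0 <= q -> 0 <= c ->
  (forall k, (k < n)%N -> f k.+1 <= (1 + q) * f k + c) ->
  forall k, (k <= n)%N -> f k <= expR (n%:R * q) * (n%:R * c).
Proof.
move=> f0 q0 c0 h.
have q1 : 1 <= 1 + q by rewrite lerDl.
have key k : (k <= n)%N -> f k <= (1 + q) ^+ k * (k%:R * c).
  elim: k => [_|k IH kn]; first by rewrite mul0r mulr0.
  apply: le_trans (h k kn) _.
  have : (1 + q) * f k <= (1 + q) ^+ k.+1 * (k%:R * c).
    by rewrite exprS -mulrA; apply: ler_wpM2l; [exact: le_trans q1|exact: IH (ltnW kn)].
  have : c <= (1 + q) ^+ k.+1 * c by rewrite ler_peMl// exprn_ege1.
  have -> : k.+1%:R * c = k%:R * c + c by rewrite -natr1 mulrDl mul1r.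
  lra.
move=> k kn; apply: le_trans (key k kn) _.
have e1 : (1 + q) ^+ k <= expR (n%:R * q).
  apply: (@le_trans _ _ ((1 + q) ^+ n)).
    by rewrite ler_weXn2l.
  rewrite mulrC expRM_natr lerXn2r ?nnegrE ?expR_ge0//; first lra.
  exact: expR_ge1Dx.
rewrite ler_pM// ?mulr_ge0 ?exprn_ge0//; first lra.
by rewrite ler_wpM2r// ler_nat.
Qed.

Section scheme.
Context (R : realType).
Implicit Types (U V W X Y Z : L2 R).

Lemma projK_ex U : exists P, @K R P /\ subdiffK P (U - P).
Proof.
have [|||P [KP sP]] := @L2_projection R (@K R) U; last by exists P.
- exact: K_closed.
- by exists 0; exact: K0.
- by move=> x y s; exact: K_convex.
Qed.

Definition projK U : L2 R := projT1 (cid (projK_ex U)).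

Lemma projK_K U : K (projK U).
Proof. by rewrite /projK; case: cid => P []. Qed.

Lemma projK_subdiff U : subdiffK (projK U) (U - projK U).
Proof. by rewrite /projK; case: cid => P []. Qed.

Variable F : L2 R -> L2 R.

(** [F] is evaluated at the new position, where the force satisfies the condition [in_N] required of
    the updated second component. *)
Fixpoint scheme (tau : R) (p : L2 R * L2 R) (k : nat) : L2 R * L2 R :=
  if k is k'.+1 then
    let q := scheme tau p k' in
    let z := projK (q.1 + tau *: q.2) in (z, q.2 + tau *: F z)
  else p.

Lemma scheme_sticky tau p : force_sticking F -> 0 < tau -> K p.1 -> in_N p.1 p.2 ->
  forall k, [/\ K (scheme tau p k).1, in_N (scheme tau p k).1 (scheme tau p k).2,
    OmegaX (scheme tau p k).1 `<=` OmegaX (scheme tau p k.+1).1 &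
    in_S (scheme tau p k.+1).1
      ((scheme tau p k).1 + tau *: (scheme tau p k).2 - (scheme tau p k.+1).1)].
Proof.
move=> stk tau0 Kp Np.
have step k : K (scheme tau p k).1 -> in_N (scheme tau p k).1 (scheme tau p k).2 ->
    [/\ OmegaX (scheme tau p k).1 `<=` OmegaX (scheme tau p k.+1).1,
    in_S (scheme tau p k.+1).1
      ((scheme tau p k).1 + tau *: (scheme tau p k).2 - (scheme tau p k.+1).1) &
    in_N (scheme tau p k.+1).1 (scheme tau p k).2].
  by move=> Kk Nk; apply: sticky_step => //; [exact: projK_K|exact: projK_subdiff].
have inv k : K (scheme tau p k).1 /\ in_N (scheme tau p k).1 (scheme tau p k).2.
  elim: k => [//|k [Kk Nk]]; split; first exact: projK_K.
  have [_ _ N'] := step k Kk Nk.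
  apply: in_ND => //; apply: in_NZ; first exact: ltW.
  by apply: in_N_force => //; exact: projK_K.
by move=> k; have [Kk Nk] := inv k; have [h1 h2 _] := step k Kk Nk.
Qed.

Lemma scheme_OmegaX tau p : force_sticking F -> 0 < tau -> K p.1 -> in_N p.1 p.2 ->
  forall k, OmegaX p.1 `<=` OmegaX (scheme tau p k).1.
Proof.
move=> stk tau0 Kp Np; elim=> [//|k IH].
by have [_ _ h _] := scheme_sticky stk tau0 Kp Np k; exact: subset_trans IH h.
Qed.

Lemma scheme_in_S tau p : force_sticking F -> 0 < tau -> K p.1 -> in_N p.1 p.2 ->
  forall j i, in_S (scheme tau p (j + i)).1
    ((scheme tau p j).1 - (scheme tau p (j + i)).1
      + \sum_(m < i) tau *: (scheme tau p (j + m)).2).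
Proof.
move=> stk tau0 Kp Np j; elim=> [|i IH].
  by rewrite addn0 subrr big_ord0 addr0; exact: in_S0.
have [_ _ h S1] := scheme_sticky stk tau0 Kp Np (j + i)%N.
have := in_SD (in_S_mono h IH) S1.
rewrite addnS big_ord_recr/=.
move: (scheme _ _ j).1 (scheme _ _ (j + i)) (projK _) (\sum_(_ < _) _) => a b c s.
rewrite (_ : _ + _ + _ = a - c + (s + tau *: b.2))//.
by apply/LfuneqP => x; rewrite !L2_applyE; ring.
Qed.

(* [ev_evi] is the inclusion [x' + subdiffK x \ni w] tested with a fixed [Y] and
   integrated in time; it needs no derivative of [x]. *)
Record evolution (x w : R -> L2 R) (T A : R) : Prop := Evolution {
  ev_T : 0 < T;
  ev_A : 0 <= A;
  ev_K : forall r, 0 <= r <= T -> K (x r);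
  ev_lip : forall s r : R, 0 <= s <= T -> 0 <= r <= T -> L2norm (x s - x r) <= A * `|s - r|;
  ev_bound : forall r, 0 <= r <= T -> L2norm (w r) <= A;
  ev_wlip : forall s r : R, 0 <= s <= T -> 0 <= r <= T -> L2norm (w s - w r) <= A * `|s - r|;
  ev_w : forall s r : R, 0 <= s -> s <= r -> r <= T ->
    L2norm (w r - w s - (r - s) *: F (x r)) <= A * (r - s) ^+ 2;
  ev_F : forall Y Z, K Y -> K Z -> L2norm (F Y - F Z) <= A * L2norm (Y - Z);
  ev_evi : forall (s r : R) Y M, 0 <= s -> s < r -> r <= T -> K Y ->
    (forall u, s < u < r -> L2dot (w u) (x u - Y) <= M) ->
    L2norm (x r - Y) ^+ 2 - L2norm (x s - Y) ^+ 2 <= 2 * M * (r - s)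
}.

Definition scheme_error (x w : R -> L2 R) (tau : R) (k : nat) :=
  L2norm (x (k%:R * tau) - (scheme tau (x 0, w 0) k).1) ^+ 2 +
  L2norm (w (k%:R * tau) - (scheme tau (x 0, w 0) k).2) ^+ 2.

(** The evolution inequality is tested with the new scheme position [b'], the projection inequality
    with the old position [x s]. In the sum the squared distance from [x s] to [b'] cancels and the
    pairings combine into [L2dot (w s - v) (x (s + tau) - b')]; freezing [x] and [w] during the step
    costs order [tau ^+ 2]. *)
Lemma scheme_error_step x w T A tau k : evolution x w T A -> 0 < tau -> tau <= 1 ->
  tau * (2 * A ^+ 2 + A + 3) <= 2^-1 -> k.+1%:R * tau <= T ->
  scheme_error x w tau k.+1 <= (1 + 4 * (2 * A ^+ 2 + A + 3) * tau) * scheme_error x w tau k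
    + 18 * A ^+ 2 * tau ^+ 2.
Proof.
move=> ev t0 t1 small kT; have A0 := ev_A ev.
rewrite /scheme_error /=.
have K1 := projK_K ((scheme tau (x 0, w 0) k).1 + tau *: (scheme tau (x 0, w 0) k).2).
have S1 := projK_subdiff ((scheme tau (x 0, w 0) k).1 + tau *: (scheme tau (x 0, w 0) k).2).
move: (projK _) K1 S1 => b' Kb' sub.
move: (scheme tau (x 0, w 0) k) sub => [b v] /= sub.
have E : k.+1%:R * tau = k%:R * tau + tau by rewrite -natr1 mulrDl mul1r.
have s0 : 0 <= k%:R * tau by rewrite mulr_ge0// ltW.
rewrite E in kT *; move: (k%:R * tau) s0 kT => s s0 sT {E}.
have sT' : 0 <= s <= T by apply/andP; split; lra.
have rT' : 0 <= s + tau <= T by apply/andP; split; lra.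
have Ka := ev_K ev sT'.
apply: gronwall_step => //; try exact: L2norm_ge0.
  have h1 : L2norm (x (s + tau) - b') ^+ 2 - L2norm (x s - b') ^+ 2 <=
     2 * (L2dot (w s) (x (s + tau) - b') + A * tau * L2norm (x (s + tau) - b') + A * (A * tau)) * tau.
    have := ev_evi ev (s := s) (r := s + tau) (Y := b')
      (M := L2dot (w s) (x (s + tau) - b') + A * tau * L2norm (x (s + tau) - b') + A * (A * tau)).
    have sr : s < s + tau by rewrite ltrDl.
    rewrite [s + tau - s]addrAC subrr add0r => /(_ s0 sr sT Kb'); apply.
    move=> u /andP[su ur].
    have uT : 0 <= u <= T by apply/andP; split; lra.
    have -> : L2dot (w u) (x u - b') = L2dot (w s) (x (s + tau) - b')
        + L2dot (w u - w s) (x (s + tau) - b') + L2dot (w u) (x u - x (s + tau)).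
      by rewrite !L2dotBl !L2dotBr; ring.
    have c1 := L2_cauchy_schwarz (w u - w s) (x (s + tau) - b').
    have c2 := L2_cauchy_schwarz (w u) (x u - x (s + tau)).
    have d1 : L2norm (w u - w s) <= A * tau.
      apply: le_trans (ev_wlip ev uT sT') _; rewrite ler_wpM2l// ger0_norm; lra.
    have d2 : L2norm (x u - x (s + tau)) <= A * tau.
      apply: le_trans (ev_lip ev uT rT') _; rewrite ler_wpM2l// distrC ger0_norm; lra.
    have e1 := ler_wpM2r (L2norm_ge0 (x (s + tau) - b')) d1.
    have e2 : L2norm (w u) * L2norm (x u - x (s + tau)) <= A * (A * tau).
      by rewrite ler_pM ?L2norm_ge0// (ev_bound ev uT).
    lra.
  (* The discrete evolution inequality, with the square of [b - b'] discarded. *)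
  have h2 : L2norm (b' - x s) ^+ 2 <= L2norm (b - x s) ^+ 2 + 2 * tau * L2dot v (b' - x s).
    have := sub _ Ka; rewrite -subr_ge0.
    have := L2dot_ge0 (b - b').
    rewrite !L2norm_sqr !L2dotE (L2dotC (x s) b') (L2dotC (x s) b) (L2dotC b' b); lra.
  have h3 : L2dot v (b' - x s) <= L2dot v (b' - x (s + tau)) + (A + L2norm (w s - v)) * (A * tau).
    have -> : L2dot v (b' - x s) = L2dot v (b' - x (s + tau)) + L2dot v (x (s + tau) - x s).
      by rewrite !L2dotBr; ring.
    rewrite lerD2l; apply: le_trans (L2_cauchy_schwarz _ _) _.
    rewrite ler_pM ?L2norm_ge0//.
      have := L2normD (v - w s) (w s); rewrite subrK [L2norm (v - w s)]L2normB.
      by have := ev_bound ev sT'; lra.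
    apply: le_trans (ev_lip ev rT' sT') _; rewrite ler_wpM2l//.
    by rewrite ger0_norm; lra.
  have c3 := L2_cauchy_schwarz (w s - v) (x (s + tau) - b').
  have c4 : L2dot (w s) (x (s + tau) - b') + L2dot v (b' - x (s + tau)) =
      L2dot (w s - v) (x (s + tau) - b') by rewrite L2dotBl !L2dotBr; ring.
  have g1 := ler_wpM2l (ltW t0) h3.
  have g2 := ler_wpM2l (ltW t0) c3.
  move: h1 h2 g1 g2; rewrite -c4 [L2norm (x s - b')]L2normB [L2norm (b - x s)]L2normB.
  move: (L2norm (x (s + tau) - b')) (L2norm (b' - x s)) (L2norm (x s - b)) (L2norm (w s - v)) => p q u e.
  move: (L2dot (w s) _) (L2dot v (b' - x s)) (L2dot v _) => d1 d2 d3; lra.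
have -> : w (s + tau) - (v + tau *: F b') = (w s - v) + tau *: (F (x (s + tau)) - F b')
    + (w (s + tau) - w s - tau *: F (x (s + tau))).
  by apply/LfuneqP => z; rewrite !L2_applyE; ring.
apply: le_trans (L2normD _ _) _; apply: lerD.
  apply: le_trans (L2normD _ _) _; rewrite lerD2l L2normZ (ger0_norm (ltW t0)).
  by rewrite -mulrA ler_wpM2l ?(ltW t0)//; apply: (ev_F ev) => //; exact: (ev_K ev).
have := ev_w ev (s := s) (r := s + tau) s0.
by rewrite [s + tau - s]addrAC subrr add0r lerDl (ltW t0) => /(_ isT); apply; case/andP: rT'.
Qed.

End scheme.

Lemma archi_div (R : realType) (T d : R) : 0 < T -> 0 < d ->
  exists2 N, (0 < N)%N & forall n, (N <= n)%N -> 0 < T / n%:R /\ T / n%:R <= d.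
Proof.
move=> T0 d0; exists (Num.truncn (T / d)).+1 => // n Nn.
have n0 : 0 < n%:R :> R by rewrite ltr0n (leq_trans _ Nn).
split; first by rewrite divr_gt0.
rewrite ler_pdivrMr// mulrC -ler_pdivrMr//.
have /truncn_itv /andP[_ /ltW h] : 0 <= T / d by rewrite divr_ge0// ltW.
by apply: le_trans h _; rewrite ler_nat.
Qed.

Lemma telescope_step (V : zmodType) (a a' s S t v : V) :
  a - s - (S + v) = (a' - s - S) + (a - a' - t) + (t - v).
Proof.
by rewrite !addrA subrK -(addrA _ a) [_ + (a - a')]addrC !addrA subrK opprD addrA.
Qed.

Lemma regroup_step (V : zmodType) (xs xT zs zT J S : V) :
  xs - xT + J - (zs - zT + S) = (xs - zs) + (zT - xT) + (J - S).
Proof.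
rewrite opprD addrACA; congr (_ + _).
by rewrite opprB addrACA [RHS]addrACA; congr (_ + _); rewrite addrC.
Qed.

(** * Convergence of the scheme and passage to the limit *)

Section evolution_sticky.
Context (R : realType) (F : L2 R -> L2 R).
Implicit Types (U V W X Y Z : L2 R).

Lemma scheme_cvg x w (T A e : R) : evolution F x w T A -> 0 < e ->
  exists2 N, (0 < N)%N & forall n, (N <= n)%N -> 0 < T / n%:R /\
    forall k, (k <= n)%N ->
      L2norm (x (k%:R * (T / n%:R)) - (scheme F (T / n%:R) (x 0, w 0) k).1) <= e /\
      L2norm (w (k%:R * (T / n%:R)) - (scheme F (T / n%:R) (x 0, w 0) k).2) <= e.
Proof.
move=> ev e0; have T0 := ev_T ev; have A0 := ev_A ev.
pose G := 2 * A ^+ 2 + A + 3.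
have AA : 0 <= A ^+ 2 by rewrite sqr_ge0.
have G0 : 0 < G by rewrite /G; lra.
(* Since [n * tau = T], the discrete Gronwall bound for the squared error is [E * tau]. *)
pose E := expR (4 * G * T) * (18 * A ^+ 2 * T).
have E0 : 0 <= E by rewrite mulr_ge0 ?expR_ge0 ?mulr_ge0// ltW.
pose d := Num.min 1 (Num.min (2^-1 / G) (e ^+ 2 / (E + 1))).
have E1 : 0 < E + 1 by lra.
have d0 : 0 < d by rewrite !lt_min ltr01 !divr_gt0 ?exprn_gt0.
have [N N0 HN] := archi_div T0 d0.
exists N => // n Nn; have [t0 td] := HN n Nn; split => // k kn.
have n0 : (0 < n)%N by exact: leq_trans Nn.
have nT : n%:R * (T / n%:R) = T by rewrite mulrCA mulfV ?mulr1// pnatr_eq0 -lt0n.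
move: (T / n%:R) t0 td nT => tau t0 td nT.
have t1 : tau <= 1 by rewrite (le_trans td)// ge_min lexx.
have tG : tau * G <= 2^-1.
  by rewrite -ler_pdivlMr// (le_trans td)// !ge_min lexx orbT.
have tE : tau * (E + 1) <= e ^+ 2.
  by rewrite -ler_pdivlMr// (le_trans td)// !ge_min lexx !orbT.
have err : scheme_error F x w tau k <= expR (n%:R * (4 * G * tau)) * (n%:R * (18 * A ^+ 2 * tau ^+ 2)).
  apply: (@gronwall _ (scheme_error F x w tau) _ _ n) => //.
  - by rewrite /scheme_error mul0r !subrr !L2norm0 expr0n/= addr0.
  - by rewrite !mulr_ge0// ltW.
  - by apply: mulr_ge0; [apply: mulr_ge0|exact: sqr_ge0].
  move=> j jn; apply: (scheme_error_step ev) => //.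
  by rewrite -nT ler_wpM2r ?(ltW t0)// ler_nat.
have {err} err : scheme_error F x w tau k <= e ^+ 2.
  apply: le_trans err _.
  have -> : n%:R * (4 * G * tau) = 4 * G * T by rewrite mulrCA nT.
  have -> : n%:R * (18 * A ^+ 2 * tau ^+ 2) = 18 * A ^+ 2 * T * tau.
    by rewrite -nT; ring.
  rewrite mulrA -/E; apply: le_trans tE; rewrite mulrC ler_wpM2l ?(ltW t0)//.
  by rewrite lerDl.
have h (u : R) : 0 <= u -> u ^+ 2 <= e ^+ 2 -> u <= e.
  by move=> u0; rewrite ler_sqr ?nnegrE// ltW.
by split; (apply: h; first exact: L2norm_ge0); apply: le_trans err;
  rewrite /scheme_error ?lerDl ?lerDr sqr_ge0.
Qed.

Lemma evolution_OmegaX x w (T A : R) : evolution F x w T A -> force_sticking F ->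
  in_N (x 0) (w 0) -> OmegaX (x 0) `<=` OmegaX (x T).
Proof.
move=> ev stk N0 m; have T0 := ev_T ev.
have K0 : K (x 0) by apply: (ev_K ev); rewrite lexx ltW.
have KT : K (x T) by apply: (ev_K ev); rewrite lexx ltW.
move=> /(OmegaX_component K0)[a [b [[a0 ab b1 fl _] mab]]].
have mab' : `]a, b[%classic m by rewrite /= in_itv.
apply: (flat_OmegaX a0 b1 _ mab'); apply: (flat_closed KT) => // e e0.
have [n n0 /(_ n (leqnn n))[t0 /(_ n (leqnn n))[xn _]]] := scheme_cvg ev e0.
exists (scheme F (T / n%:R) (x 0, w 0) n).1; split.
  apply: OmegaX_flat; apply: subset_trans (flat_OmegaX a0 b1 fl) _.
  exact: (@scheme_OmegaX _ F (T / n%:R) (x 0, w 0) stk t0 K0 N0 n).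
by move: xn; rewrite mulrCA mulfV ?mulr1// pnatr_eq0 -lt0n.
Qed.

(** [s] is a rational multiple of [T], so both are grid points whenever the number of steps is a
    multiple of [j + i]. *)
Lemma evolution_in_S x w (T A : R) (j i : nat) : evolution F x w T A -> force_sticking F ->
  in_N (x 0) (w 0) -> (0 < i)%N ->
  let s := j%:R * (T / (j + i)%:R) in
  in_S (x T) (x s - x T + (bochner_integral `[0, T]%classic w - bochner_integral `[0, s]%classic w)).
Proof.
move=> ev stk N0 i0 s; have T0 := ev_T ev; have A0 := ev_A ev.
have K0 : K (x 0) by apply: (ev_K ev); rewrite lexx ltW.
have KT : K (x T) by apply: (ev_K ev); rewrite lexx ltW.
pose J r := bochner_integral `[0, r]%classic w.
have lipw r : 0 <= r -> r <= T -> lipschitz_to w r A.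
  move=> r0 rT; split => //; split => // u u' /andP[u0 ur] /andP[u'0 u'r].
  by apply: (ev_wlip ev); rewrite ?u0 ?u'0 (le_trans _ rT).
apply: (in_S_closed KT) => d d0.
have T1 : 0 < T + 2 by lra.
(* The total error is at most [2 * e] from the two endpoints plus [T * (2 * e)] from the sum. *)
pose e := Num.min d (d / (2 * (T + 2))).
have e0 : 0 < e by rewrite lt_min d0 divr_gt0// mulr_gt0.
have ed : e <= d by rewrite ge_min lexx.
have eT : e * (2 * (T + 2)) <= d by rewrite -ler_pdivlMr ?mulr_gt0// ge_min lexx orbT.
have [N N0' HN] := scheme_cvg ev e0.
have c0 : 0 < e / (A + 1) by rewrite divr_gt0// ltr_wpDl.
have [M M0 HM] := archi_div T0 c0.
(* With this factor [n] is a multiple of [j + i] that exceeds both thresholds. *)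
pose k := (N * M)%N; have k0 : (0 < k)%N by rewrite muln_gt0 N0'.
have ji0 : (0 < j + i)%N by rewrite addn_gt0 i0 orbT.
pose n := ((j + i) * k)%N.
have kn : (k <= n)%N by rewrite /n leq_pmull.
have Nn : (N <= n)%N by rewrite (leq_trans _ kn)// /k leq_pmulr.
have Mn : (M <= n)%N by rewrite (leq_trans _ kn)// /k leq_pmull.
have [t0 conv] := HN n Nn; have [_ tA] := HM n Mn.
have n0 : (0 < n)%N by rewrite (leq_trans _ Nn).
have nT : n%:R * (T / n%:R) = T by rewrite mulrCA mulfV ?mulr1// pnatr_eq0 -lt0n.
have sE : (j * k)%:R * (T / n%:R) = s.
  rewrite /s /n !natrM.
  have ji0' : (j + i)%:R != 0 :> R by rewrite pnatr_eq0 -lt0n.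
  move: ji0'; move: ((j + i)%:R : R) => p p0; field; rewrite p0 !pnatr_eq0 -!lt0n M0 N0'//.
move: (T / n%:R) t0 conv tA nT sE => tau t0 conv tA nT sE.
have {}tA : A * tau <= e.
  by move: tA; rewrite ler_pdivlMr ?ltr_wpDl// mulrDr mulr1 mulrC; lra.
have nE : (j * k + i * k)%N = n by rewrite -mulnDl.
have S1 := @scheme_in_S _ F tau (x 0, w 0) stk t0 K0 N0 (j * k)%N (i * k)%N.
rewrite nE in S1.
have [xn _] := conv n (leqnn n); rewrite nT in xn.
have jn : (j * k <= n)%N by rewrite -nE leq_addr.
have [xs _] := conv _ jn; rewrite sE in xs.
eexists; eexists; split; [exact: S1|exact: le_trans ed|].
(* Each step contributes [tau * e] for freezing [w] and [tau * e] for the error of the scheme. *)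
have tel : forall m, (m <= i * k)%N ->
    L2norm (J ((j * k + m)%:R * tau) - J s -
      \sum_(q < m) tau *: (scheme F tau (x 0, w 0) (j * k + q)).2) <= m%:R * tau * (2 * e).
  elim=> [_|m IH mi]; first by rewrite addn0 sE big_ord0 subr0 subrr L2norm0 mul0r mul0r.
  have mn : (j * k + m <= n)%N by rewrite -nE leq_add2l ltnW.
  have mn' : (j * k + m.+1 <= n)%N by rewrite -nE leq_add2l.
  have [_ wm] := conv _ mn.
  rewrite addnS big_ord_recr/=; move: (\sum_(q < m) _) (scheme _ _ _ _).2 (IH (ltnW mi)) wm => S u IH' wm.
  have pE : (j * k + m).+1%:R * tau = (j * k + m)%:R * tau + tau by rewrite -natr1 mulrDl mul1r.
  have r0 : 0 <= (j * k + m)%:R * tau by rewrite mulr_ge0// ltW.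
  have rT : (j * k + m)%:R * tau + tau <= T.
    by rewrite -pE -nT ler_wpM2r ?(ltW t0)// ler_nat -addnS.
  rewrite pE; move: ((j * k + m)%:R * tau) wm IH' r0 rT => r wm IH' r0 rT.
  have -> : J (r + tau) - J s - (S + tau *: u) =
      (J r - J s - S) + (J (r + tau) - J r - tau *: w r) + tau *: (w r - u).
    by rewrite scalerBr; exact: telescope_step.
  apply: le_trans (L2normD _ _) _; rewrite L2normZ (ger0_norm (ltW t0)).
  have b1 : L2norm (J r - J s - S + (J (r + tau) - J r - tau *: w r)) <= m%:R * tau * (2 * e) + e * tau.
    apply: le_trans (L2normD _ _) _; apply: lerD => //.
    have rr : r <= r + tau by rewrite lerDl ltW.
    have inc := @bochner_increment _ w r (r + tau) A e (w r) r0 rr (lipw _ (addr_ge0 r0 (ltW t0)) rT) (ltW e0).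
    have rE : r + tau - r = tau by rewrite addrC addKr.
    rewrite rE in inc; apply: inc => u' /andP[ru ur].
    have r0T : 0 <= r <= T by rewrite r0 (le_trans rr rT).
    have u0T : 0 <= u' <= T by rewrite (le_trans r0 ru) (le_trans ur rT).
    apply: le_trans (ev_wlip ev u0T r0T) _; rewrite ger0_norm ?subr_ge0//.
    by apply: le_trans tA; rewrite ler_wpM2l// lerBlDl.
  have b2 : tau * L2norm (w r - u) <= tau * e by rewrite ler_wpM2l// ltW.
  have -> : m.+1%:R * tau * (2 * e) = m%:R * tau * (2 * e) + tau * (2 * e).
    by rewrite -natr1; ring.
  by apply: le_trans (lerD b1 b2) _; rewrite -addrA lerD2l; lra.
have := tel _ (leqnn _); rewrite nE nT => tl.
have ik : (i * k)%:R * tau <= T.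
  by rewrite -[leRHS]nT ler_wpM2r ?(ltW t0)// ler_nat -nE leq_addl.
have ike : (i * k)%:R * tau * (2 * e) <= T * (2 * e) by rewrite ler_wpM2r// mulr_ge0// ltW.
move: tl; rewrite -/(J T) -/(J s).
move: (\sum_(_ < _) _) => S tl.
move: (scheme F tau (x 0, w 0) n).1 (scheme F tau (x 0, w 0) (j * k)).1 xn xs => zn zj xn xs.
rewrite (_ : _ - _ = (x s - zj) + (zn - x T) + (J T - J s - S)); last exact: regroup_step.
apply: le_trans (L2normD _ _) _.
have := L2normD (x s - zj) (zn - x T); rewrite [L2norm (zn - _)]L2normB.
by lra.
Qed.

Lemma evolution_in_N x w (T A : R) : evolution F x w T A -> force_sticking F ->
  in_N (x 0) (w 0) -> in_N (x T) (w T).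
Proof.
move=> ev stk N0 a b cX Z KZ; have T0 := ev_T ev; have A0 := ev_A ev.
have [a0 ab b1 fl _] := cX.
have D0 := L2norm_ge0 (fluct a b Z).
apply: (@le0_of_small _ _ (A * L2norm (fluct a b Z)) T) => //; first exact: mulr_ge0.
move=> e e0 eT.
have [M M0 /(_ M.+1 (leqnSn _))[h0 he]] := archi_div T0 e0.
(* With [j = M] and [i = 1] the earlier time is [T - h], where [h = T / M.+1%:R] is at most [e]. *)
have := @evolution_in_S x w T A M 1 ev stk N0 isT; rewrite addn1 /=.
have M1 : M.+1%:R * (T / M.+1%:R) = T by rewrite mulrCA mulfV ?mulr1// pnatr_eq0.
have : M%:R * (T / M.+1%:R) = T - T / M.+1%:R.
  by rewrite -{2}M1 -natr1 mulrDl mul1r addrK.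
move: (T / M.+1%:R) h0 he => h h0 he ->.
have hT : h <= T by exact: le_trans eT.
set s := T - h => S1.
have sT : s <= T by rewrite /s; lra.
have s0 : 0 <= s by rewrite /s; lra.
have TT : 0 <= T <= T by rewrite lexx ltW.
have ss : 0 <= s <= T by rewrite s0.
have h1 := in_S_in_N S1 cX KZ.
(* The term of [x s] is nonnegative by Chebyshev and that of [x T] vanishes by flatness, so the
   integral of [w] over [[s, T]] inherits the sign. *)
have h2 := fluct_dot_ge0 a0 ab b1 (ev_K ev ss) KZ.
have h3 : L2dot (x T) (fluct a b Z) = 0.
  by rewrite L2dotC fluct_const//; exact: flat_const_on.
have lipw : lipschitz_to w T A.
  by split; [exact: ltW|split => //; exact: (ev_wlip ev)].
have Ah : 0 <= A * h by rewrite mulr_ge0// ltW.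
have inc := @bochner_increment _ w s T A (A * h) (w T) s0 sT lipw Ah.
have {}inc : L2norm (bochner_integral `[0, T]%classic w - bochner_integral `[0, s]%classic w
    - h *: w T) <= A * h * h.
  have hE : T - s = h by rewrite /s subKr.
  rewrite hE in inc; apply: inc => r /andP[sr rT].
  apply: le_trans (ev_wlip ev _ TT) _; first by apply/andP; split; lra.
  by rewrite ler_wpM2l// distrC ger0_norm ?subr_ge0//; rewrite /s in sr; lra.
move: inc h1; move: (bochner_integral _ _ - _) => I inc h1.
have {}h1 : L2dot I (fluct a b Z) <= 0.
  by move: h1; rewrite L2dotDl L2dotBl h3 subr0; lra.
have h4 : h * L2dot (w T) (fluct a b Z) <= h * (A * h * L2norm (fluct a b Z)).
  have -> : h * L2dot (w T) (fluct a b Z) = L2dot I (fluct a b Z) - L2dot (I - h *: w T) (fluct a b Z).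
    by rewrite L2dotBl L2dotZl; ring.
  have := L2_cauchy_schwarz_norm (I - h *: w T) (fluct a b Z); rewrite ler_norml => /andP[c _].
  have := ler_wpM2r D0 inc; lra.
rewrite ler_pM2l// in h4; apply: le_trans h4 _.
by rewrite mulrAC ler_wpM2l// mulr_ge0.
Qed.

End evolution_sticky.

Lemma double_sub (K : pzRingType) (V : lmodType K) (a b y : V) :
  a - y + (b - y) = (a - b) + 2 *: (b - y).
Proof. by rewrite scaler_nat mulr2n [RHS]addrA; congr (_ + _); rewrite addrA subrK. Qed.

(** * Lagrangian solutions *)

Section lagrangian.
Context (R : realType).
Implicit Types (U V W Y Z : L2 R).

(** Points of agreement are dense, and right continuity carries the equality to every point of
    Omega. *)
Lemma K_ae_eq Y Z : K Y -> K Z -> (Y : R -> R) = Z %[ae @muOmega R] ->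
  forall x : R, 0 < x < 1 -> Y x = Z x.
Proof.
move=> KY KZ aeYZ.
suff H (U V : L2 R) (x : R) : K U -> K V -> (U : R -> R) = V %[ae @muOmega R] ->
    0 < x < 1 -> V x <= U x.
  move=> x x01; apply: le_anti; rewrite !H//.
  by apply: ae_imp aeYZ => z h _; rewrite h.
move=> KU KV aeUV /andP[x0 x1]; apply/ler_addgt0Pr => e e0.
have /KP[_ /(_ x e x0 x1 e0)[y [xy y1 Uy]]] := KU.
have aeUV' : {ae @muOmega R, forall z, U z = V z} by apply: ae_imp aeUV => z /(_ Logic.I).
have [z Uz /andP[xz zy]] := ae_Omega_dense (ltW x0) xy (ltW y1) aeUV'.
have h1 : V x <= V z by apply: (K_le KV); lra.
have h2 : U z <= U y by apply: (K_le KU); lra.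
by rewrite -Uz in h1; lra.
Qed.

(** Stated by pairing, since the chosen representative of the integral is controlled only almost
    everywhere. *)
Lemma bochner_integral0 (f : R -> L2 R) (l : R) V : lipschitz_to f 0 l ->
  L2dot (bochner_integral `[0, 0]%classic f) V = 0.
Proof.
move=> lf; rewrite (bochner_dot V lf (bochner_integralP lf)).
by rewrite set_itv1 Rintegral_set1.
Qed.

Variables (F : L2 R -> L2 R) (Xbar Vbar : L2 R) (X : R -> L2 R).

Definition impulse (t : R) := Vbar + bochner_integral `[0, t]%classic (F \o X).

(** At almost every [u] the squared distance to [Y] has derivative [2 * L2dot V (X u - Y)], at most
    [2 * M] by the inclusion tested with [Y]; [lipschitz_ae_le] integrates this bound. *)
Lemma solution_evi (T l s r : R) Y M : lagrangian_solution F Xbar Vbar X -> 0 <= l ->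
  (forall a b : R, 0 <= a <= T -> 0 <= b <= T -> L2norm (X a - X b) <= l * `|a - b|) ->
  0 <= s -> s < r -> r <= T -> K Y ->
  (forall u, s < u < r -> L2dot (impulse u) (X u - Y) <= M) ->
  L2norm (X r - Y) ^+ 2 - L2norm (X s - Y) ^+ 2 <= 2 * M * (r - s).
Proof.
move=> [KX _ _ aeX] l0 lip s0 sr rT KY hM.
pose B := L2norm (X s - Y) + l * (r - s).
have B0 : 0 <= B by rewrite addr_ge0 ?L2norm_ge0// mulr_ge0// subr_ge0 ltW.
have bnd u : s <= u <= r -> L2norm (X u - Y) <= B.
  move=> /andP[su ur]; apply: le_trans (L2norm_triangle (X s) _ _) _.
  rewrite addrC lerD2l; apply: le_trans (lip _ _ _ _) _.
  - by apply/andP; split; lra.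
  - by apply/andP; split; lra.
  by rewrite ler_wpM2l// ger0_norm ?subr_ge0//; lra.
have diff a b : L2norm (X a - Y) ^+ 2 - L2norm (X b - Y) ^+ 2 =
    L2dot (X a - X b) ((X a - Y) + (X b - Y)).
  rewrite !L2norm_sqr !L2dotE (L2dotC (X b) (X a)) (L2dotC Y (X a)) (L2dotC Y (X b)).
  by ring.
apply: (@lipschitz_ae_le _ (fun u => L2norm (X u - Y) ^+ 2) s r (l * (2 * B)) (2 * M)).
- exact: ltW.
- by rewrite mulr_ge0// mulr_ge0.
- move=> a b ab bb; rewrite diff.
  apply: le_trans (L2_cauchy_schwarz_norm _ _) _.
  rewrite mulrAC ler_pM ?L2norm_ge0//.
    by apply: lip; [case/andP: ab|case/andP: bb] => h1 h2; apply/andP; split; lra.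
  apply: le_trans (L2normD _ _) _.
  by have := bnd a ab; have := bnd b bb; lra.
apply: ae_imp aeX => u hu /andP[su ur] e e0.
have u0 : 0 < u by exact: le_lt_trans su.
have [V derV subV] := hu u0.
have VM : L2dot V (X u - Y) <= M.
  apply: le_trans (hM u _); last by rewrite su.
  have := subV Y KY; rewrite -/(impulse u) !L2dotBl !L2dotBr; lra.
set n := L2norm (X u - Y).
have n0 : 0 <= n by exact: L2norm_ge0.
(* Half of the allowance [e * h] is for the quadratic term [l ^+ 2 * h ^+ 2], half for twice the
   remainder of the difference quotient, whence the 4. *)
have dl0 : 0 < e / (4 * (n + 1)) by rewrite divr_gt0//; lra.
have := derV; rewrite /is_L2derivative => /cvgrPdist_le /(_ _ dl0) /nbhs_ballP[d1 /= d10 hd1].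
have l1 : 0 < 2 * (l ^+ 2 + 1) by have := sqr_ge0 l; lra.
pose d := Num.min d1 (Num.min (r - u) (e / (2 * (l ^+ 2 + 1)))).
exists d; first by rewrite !lt_min d10 subr_gt0 ur divr_gt0.
move=> h h0; rewrite !lt_min => /and3P[hd hr]; rewrite ltr_pdivlMr// => he.
have {hd1} hd1 : L2norm (h^-1 *: (X (u + h) - X u) - V) <= e / (4 * (n + 1)).
  have := hd1 h; rewrite /ball/= sub0r normrN (ger0_norm (ltW h0)) => /(_ hd).
  rewrite sub0r normrN ger0_norm ?L2norm_ge0//; apply.
  by rewrite gt_eqF.
rewrite diff; set D := X (u + h) - X u.
have -> : X (u + h) - Y + (X u - Y) = D + 2 *: (X u - Y).
  exact: double_sub.
have Dh : D = h *: (h^-1 *: D - V) + h *: V.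
  by rewrite scalerBr scalerA mulfV ?gt_eqF// scale1r subrK.
rewrite L2dotDr L2dotZr -L2norm_sqr.
have c1 : L2norm D ^+ 2 <= l ^+ 2 * h ^+ 2.
  rewrite -exprMn ler_sqr ?nnegrE ?L2norm_ge0 ?mulr_ge0 ?(ltW h0)//.
  have uh : u + h - u = h by rewrite addrC addKr.
  have uT : 0 <= u <= T by apply/andP; split; lra.
  have uhT : 0 <= u + h <= T by apply/andP; split; lra.
  by have := lip _ _ uhT uT; rewrite uh (ger0_norm (ltW h0)).
have c2 : L2dot D (X u - Y) <= h * (e / (4 * (n + 1)) * n) + h * M.
  rewrite {1}Dh L2dotDl !L2dotZl; apply: lerD; rewrite ler_wpM2l ?(ltW h0)//.
  apply: le_trans (L2_cauchy_schwarz _ _) _.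
  by rewrite ler_wpM2r.
have c3 : e / (4 * (n + 1)) * n <= e / 4.
  have n1 : n + 1 != 0 by rewrite gt_eqF// ltr_wpDl.
  have -> : e / 4 = e / (4 * (n + 1)) * (n + 1) by field.
  by rewrite ler_wpM2l ?(ltW dl0)// lerDl.
have c4 : h * (e / (4 * (n + 1)) * n) <= h * (e / 4) by rewrite ler_wpM2l ?(ltW h0).
have c5 : l ^+ 2 * h ^+ 2 <= h * (e / 2).
  have : h * (l ^+ 2 * h) <= h * (e / 2).
    rewrite ler_wpM2l ?(ltW h0)//; have := ltW h0; lra.
  by rewrite expr2; lra.
by move: c1 c2 c4 c5; lra.
Qed.

Lemma solution_evolution (t T : R) : force_lipschitz F ->
  lagrangian_solution F Xbar Vbar X -> 0 <= t -> 0 < T ->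
  exists A, evolution F (fun r => X (t + r)) (fun r => impulse (t + r)) T A.
Proof.
move=> [L L0 lipF] sol t0 T0; have [KX lipX _ _] := sol.
have TT0 : 0 <= t + T by rewrite addr_ge0// ltW.
have z0 : (0 : R) <= 0 <= t + T by apply/andP.
have [l' hl'] := lipX _ TT0.
pose l := `|l'|; have l0 : 0 <= l by exact: normr_ge0.
have lip a b : 0 <= a <= t + T -> 0 <= b <= t + T -> L2norm (X a - X b) <= l * `|a - b|.
  move=> ha hb; apply: le_trans (hl' a b ha hb) _.
  by rewrite ler_wpM2r// ler_norm.
have KX' a : 0 <= a <= t + T -> K (X a) by move=> /andP[/KX].
have lipFX a b : 0 <= a <= t + T -> 0 <= b <= t + T ->
    L2norm (F (X a) - F (X b)) <= L * l * `|a - b|.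
  move=> ha hb; apply: le_trans (lipF _ _ (KX' a ha) (KX' b hb)) _.
  by rewrite -mulrA ler_wpM2l// lip.
have Ll0 : 0 <= L * l by rewrite mulr_ge0.
have ltFX r : 0 <= r -> r <= t + T -> lipschitz_to (F \o X) r (L * l).
  move=> r0 rT; split => //; split => // a b /andP[a0 ar] /andP[b0 br].
  by apply: lipFX; rewrite ?a0 ?b0 (le_trans _ rT).
(* A bound of the force along the curve, hence a Lipschitz constant of the impulse. *)
pose B := L2norm (F (X 0)) + L * l * (t + T).
have n0 := L2norm_ge0 (F (X 0)).
have B0 : 0 <= B by rewrite addr_ge0// mulr_ge0.
have bF a : 0 <= a <= t + T -> L2norm (F (X a)) <= B.
  move=> ha; have h := L2normD (F (X a) - F (X 0)) (F (X 0)); rewrite subrK in h.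
  have := lipFX a 0 ha z0; rewrite subr0.
  case/andP: ha => a0 aT; rewrite (ger0_norm a0).
  have : L * l * a <= L * l * (t + T) by rewrite ler_wpM2l.
  by rewrite /B; lra.
have inc a b U c : 0 <= a -> a <= b -> b <= t + T -> 0 <= c ->
    (forall r, a <= r <= b -> L2norm (F (X r) - U) <= c) ->
    L2norm (impulse b - impulse a - (b - a) *: U) <= c * (b - a).
  move=> a0 ab bT c0 h.
  have -> : impulse b - impulse a = bochner_integral `[0, b]%classic (F \o X)
      - bochner_integral `[0, a]%classic (F \o X).
    by rewrite /impulse opprD addrACA subrr add0r.
  by apply: (bochner_increment a0 ab (ltFX b _ bT) c0 h); exact: le_trans ab.
have wlip a b : 0 <= a <= t + T -> 0 <= b <= t + T ->
    L2norm (impulse a - impulse b) <= B * `|a - b|.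
  wlog ab : a b / a <= b => [H ha hb|].
    have [ab|/ltW ba] := leP a b; first exact: H.
    by rewrite (L2normB (impulse a) (impulse b)) (distrC a b); exact: H.
  move=> /andP[a0 aT] /andP[b0 bT].
  have := inc a b 0 B a0 ab bT B0.
  rewrite (L2normB (impulse a) (impulse b)) (distrC a b) (ger0_norm (_ : 0 <= b - a)) ?subr_ge0//.
  move: (impulse b - impulse a) => D; rewrite (scaler0 _ (b - a)) (subr0 D); apply=> r /andP[ar rb].
  rewrite (subr0 (F (X r))); apply: bF.
  by apply/andP; split; lra.
(* A single constant dominates all those required; the last summand bounds the impulse itself. *)
pose A := l + L + L * l + B + (L2norm (impulse 0) + B * (t + T)).
have i0 := L2norm_ge0 (impulse 0).
have BT0 : 0 <= B * (t + T) by rewrite mulr_ge0.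
have lA : l <= A by rewrite /A; lra.
have LA : L <= A by rewrite /A; lra.
have LlA : L * l <= A by rewrite /A; lra.
have BA : B <= A by rewrite /A; lra.
have iA : L2norm (impulse 0) + B * (t + T) <= A by rewrite /A lerDr (addr_ge0 (addr_ge0 (addr_ge0 l0 L0) Ll0) B0).
have A0 : 0 <= A by exact: le_trans lA.
have sh r : 0 <= r <= T -> 0 <= t + r <= t + T.
  by move=> /andP[r0 rT]; rewrite addr_ge0// lerD2l.
have shd (a b : R) : t + a - (t + b) = a - b by ring.
exists A; split => //.
- by move=> r /sh /KX'.
- move=> s r /sh hs /sh hr; apply: le_trans (lip _ _ hs hr) _.
  by rewrite shd ler_wpM2r.
- move=> r /sh hr.
  have h := L2normD (impulse (t + r) - impulse 0) (impulse 0); rewrite subrK in h.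
  apply: le_trans h (le_trans _ iA); rewrite (addrC (L2norm (impulse 0))) lerD2r.
  apply: le_trans (wlip _ _ hr z0) _; rewrite (subr0 (t + r)).
  by case/andP: hr => r0 rT; rewrite (ger0_norm r0) ler_wpM2l.
- move=> s r /sh hs /sh hr; apply: le_trans (wlip _ _ hs hr) _.
  by rewrite shd ler_wpM2r.
- move=> s r s0 sr rT.
  have ts0 : 0 <= t + s by rewrite addr_ge0.
  have tsr : t + s <= t + r by rewrite lerD2l.
  have trT : t + r <= t + T by rewrite lerD2l.
  have c0 : 0 <= L * l * (r - s) by rewrite mulr_ge0// subr_ge0.
  have := inc (t + s) (t + r) (F (X (t + r))) (L * l * (r - s)) ts0 tsr trT c0.
  rewrite shd => h; apply: (@le_trans _ _ (L * l * (r - s) * (r - s))); last first.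
    by rewrite -mulrA -expr2 ler_wpM2r ?sqr_ge0.
  apply: h => u /andP[su ur].
  have uT : 0 <= u <= t + T by rewrite (le_trans ts0 su) (le_trans ur trT).
  have rtT : 0 <= t + r <= t + T by rewrite (le_trans ts0 tsr).
  apply: le_trans (lipFX _ _ uT rtT) _.
  by rewrite ler_wpM2l// distrC ger0_norm ?subr_ge0// -(shd r s) lerD2l lerN2.
- move=> Y Z KY KZ; apply: le_trans (lipF _ _ KY KZ) _.
  by rewrite ler_wpM2r ?L2norm_ge0.
- move=> s r Y M s0 sr rT KY hM.
  rewrite -(shd r s); apply: (solution_evi sol l0 lip) => //.
  + by rewrite addr_ge0.
  + by rewrite ltrD2l.
  + by rewrite lerD2l.
  move=> u /andP[su ur].
  have := hM (u - t); rewrite addrCA subrr addr0; apply.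
  by apply/andP; split; lra.
Qed.

Lemma solution_in_N0 : K Xbar -> HX Xbar Vbar ->
  lagrangian_solution F Xbar Vbar X -> in_N (X 0) (impulse 0).
Proof.
move=> KXbar HV sol a b [a0 ab b1 fl nab] Z KZ.
have [KX _ X0 _] := sol.
have lt0 : lipschitz_to (F \o X) 0 0.
  split => //; split => // r r'; rewrite -!eq_le => /eqP <- /eqP <-.
  by rewrite !subrr L2norm0 mul0r.
rewrite L2dotDl (bochner_integral0 _ lt0) addr0 L2dotC fluct_const//.
move/HXP : HV; apply => //; apply: flat_OmegaX => // x y xab yab.
(* The initial condition holds almost everywhere; both sides being in [K], it holds at every point
   of Omega. *)
have X01 : forall x : R, a < x < b -> X 0 x = Xbar x.
  move=> z /andP[az zb]; apply: (K_ae_eq (KX 0 (lexx 0)) KXbar X0).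
  by apply/andP; split; lra.
by rewrite -!X01//; exact: fl.
Qed.

Lemma solution_in_N (t : R) : force_lipschitz F -> force_sticking F -> K Xbar -> HX Xbar Vbar ->
  lagrangian_solution F Xbar Vbar X -> 0 <= t -> in_N (X t) (impulse t).
Proof.
move=> lipF stk KXbar HV sol; have N0 := solution_in_N0 KXbar HV sol.
rewrite le_eqVlt => /predU1P[<- //|t0].
have [A ev] := solution_evolution lipF sol (lexx 0) t0.
have := evolution_in_N ev stk; rewrite !add0r; apply.
exact: N0.
Qed.

End lagrangian.

Theorem theorem3p11 (R : realType) (F : L2 R -> L2 R)
    (Xbar Vbar : L2 R) (X : R -> L2 R)
    (F_lip : force_lipschitz F) (F_stick : force_sticking F)
    (K_Xbar : @K R Xbar) (H_Vbar : HX Xbar Vbar)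
    (X_sol : lagrangian_solution F Xbar Vbar X) :
  sticky X.
Proof.
move=> t1 t2 t10; rewrite le_eqVlt => /predU1P[->//|t12].
have T0 : 0 < t2 - t1 by rewrite subr_gt0.
have [A ev] := solution_evolution F_lip X_sol t10 T0.
have := evolution_OmegaX ev F_stick; rewrite addr0 addrC subrK; apply.
exact: solution_in_N F_lip F_stick K_Xbar H_Vbar X_sol t10.
Qed.
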